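(* Let $Y_i$, $i\in I_n^d$, be a field of independent random variables from the exponential family model described in the context, let $\mathcal R^*\subset\mathcal P([0,1]^d)$ be a set of candidate regions whose discretizations satisfy $\#(\mathcal R_n)\le c_1 n^{c_2}$ for all $n$, with some constants $c_1,c_2>0$, and let $(r_n)_n\subset(0,\infty)$ be a sequence such that $\log^{12}(n)=o(r_n)$ as $n\to\infty$. Let $v\ge 0$ be fixed. (a) Under $\mathbb P_0$ (i.e. when all $Y_i$ are i.i.d. with distribution $F_{\theta_0}$), for each $n$ the fields $(Y_i)_{i\in I_n^d}$ and $(X_i)_{i\in I_n^d}$ (the latter i.i.d. standard normal) can be defined on a common probability space such that $$T_n(Y,\theta_0,\mathcal R_{n|r_n},v)-M_n(\mathcal R_{n|r_n},v)=O_{\mathbb P}\left(\left(\frac{\log^{12}(n)}{r_n}\right)^{1/10}\right)\qquad\text{as } n\to\infty .$$ (b) For all $q\in\mathbb R$, $$\lim_{n\to\infty}\left|\mathbb P_0\left[T_n(Y,\theta_0,\mathcal R_{n|r_n},v)>q\right]-\mathbb P\left[M_n(\mathcal R_{n|r_n},v)>q\right]\right|=0 .$$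
   Context: Let $d\ge 1$ and $I_n^d=\{1,\dots,n\}^d$. Exponential family: $\nu$ is a $\sigma$-finite measure on $\mathbb R$, the natural parameter space $\mathcal N=\{\theta\in\mathbb R:\int e^{\theta x}\,d\nu(x)<\infty\}$ is open, $\Theta=\mathcal N$, and $F_\theta$ ($\theta\in\Theta$) has $\nu$-density $f_\theta(x)=\exp(\theta x-\psi(\theta))$, where the cumulant transform $\psi$ is strictly convex on $\mathcal N$; the variance of $F_\theta$ is positive. The observations $Y_i\sim F_{\theta_i}$, $i\in I_n^d$, are independent. A baseline parameter $\theta_0\in\Theta$ is fixed; $\mathbb P_0$ denotes the law under which $\theta_i=\theta_0$ for all $i\in I_n^d$. Discretized regions: $\mathcal R_n=\{R\subset I_n^d: R=I_n^d\cap nR^*\text{ for some }R^*\in\mathcal R^*\}$. For $R\subset I_n^d$, $|R|$ is the number of points in $R$. For $c>0$, $\mathcal R_{n|c}=\{R\in\mathcal R_n:|R|\ge c\}$. It is assumed that $\mathcal R_{n|r_n}\neq\emptyset$, so that the maxima below are defined. Local likelihood ratio statistic: $$T_R(Y,\theta_0)=\sqrt{2\log\left(\frac{\sup_{\theta\in\Theta}\prod_{i\in R}f_\theta(Y_i)}{\prod_{i\in R}f_{\theta_0}(Y_i)}\right)} .$$ Penalty: $\mathrm{pen}_v(r)=\sqrt{2v(\log(n^d/r)+1)}$. Multiscale statistic and its Gaussian version, for a system $\mathcal A$ of nonempty subsets of $I_n^d$: $$T_n(Y,\theta_0,\mathcal A,v)=\max_{R\in\mathcal A}\left[T_R(Y,\theta_0)-\mathrm{pen}_v(|R|)\right],\qquad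 M_n(\mathcal A,v)=\max_{R\in\mathcal A}\left[|R|^{-1/2}\left|\sum_{i\in R}X_i\right|-\mathrm{pen}_v(|R|)\right],$$ with $X_i$, $i\in I_n^d$, i.i.d. standard normal. *)

(* Defs.v *)
From HB Require Import structures.
From mathcomp Require Export all_boot all_order all_algebra.
From mathcomp Require Export all_classical all_reals all_analysis.
Export Order.TTheory GRing.Theory Num.Theory.
Export numFieldNormedType.Exports.

Set Implicit Arguments.
Unset Strict Implicit.
Unset Printing Implicit Defensive.

Local Open Scope classical_set_scope.
Local Open Scope ring_scope.

Definition strictly_convex_on (R : realType) (D : set R) (f : R -> R) : Prop :=
  forall x y t, D x -> D y -> x != y -> 0 < t -> t < 1 ->
    f (t * x + (1 - t) * y) < t * f x + (1 - t) * f y.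

Section exponential_family.
Context (R : realType) (nu : set (measurableTypeR R) -> \bar R).
Local Open Scope ereal_scope.

Definition natural_space : set R :=
  [set theta | \int[nu]_x (expR (theta * x))%:E < +oo].

Definition cumulant (theta : R) : R :=
  ln (fine (\int[nu]_x (expR (theta * x))%:E)).

Definition expfam_pdf (theta x : R) : R := expR (theta * x - cumulant theta).

End exponential_family.

Section random_fields.
Context (disp : measure_display) (T : measurableType disp) (R : realType)
  (P : probability T R) (I : finType).

Definition mutually_independent (X : I -> {RV P >-> R}) : Prop :=
  forall (J : {set I}) (B : I -> set R), (forall i, measurable (B i)) ->
    P (\bigcap_(i in [set` J]) (X i @^-1` B i)) =
    (\prod_(i in J) P (X i @^-1` B i))%E.

Definition iid_field (X : I -> {RV P >-> R})
    (mu : probability (measurableTypeR R) R) : Prop :=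
  mutually_independent X /\
  forall i (A : set R), measurable A -> distribution P (X i) A = mu A.

End random_fields.

(* [Z n = O_P(a n)]; the [n]-th variable may live on its own probability
   space. *)
Definition bigO_prob (R : realType) (disp : nat -> measure_display)
    (T : forall n, measurableType (disp n)) (P : forall n, probability (T n) R)
    (Z : forall n, T n -> \bar R) (a : nat -> R) : Prop :=
  forall e : R, 0 < e -> exists2 C : R, 0 < C &
    \forall n \near \oo,
      (P n [set w | (C * a n)%:E < `|Z n w|] <= e%:E)%E.

(* The grid {1,...,n}^d; the index [i] stands for the point with coordinates
   [(i j).+1]. *)
Notation grid n d := {ffun 'I_d -> 'I_n}.

Definition unit_cube (R : realType) (d : nat) : set 'rV[R]_d :=
  [set x | forall j, 0 <= x ord0 j <= 1].

Section regions.
Context (R : realType) (d : nat).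
Implicit Types (n : nat) (RR : set (set 'rV[R]_d)).

Definition grid_point n (i : grid n d) : 'rV[R]_d := \row_j (i j).+1%:R.

Definition discretize n (S : set 'rV[R]_d) : {set grid n d} :=
  [set i | `[< ((fun x => n%:R *: x) @` S) (grid_point i) >]]%SET.

Definition regions RR n : {set {set grid n d}} :=
  [set A | `[< exists2 S, RR S & A = discretize n S >]]%SET.

Definition regions_ge RR n (c : R) : {set {set grid n d}} :=
  [set A in regions RR n | c <= #|A|%:R]%SET.

End regions.

Section statistics.
Context (R : realType) (n d : nat).

Definition pen (v r : R) : R :=
  Num.sqrt (2 * v * (ln (n%:R ^+ d / r) + 1)).

(* Extended-real valued: off a null set of observations the supremum over
   [theta] can be infinite. *)
Definition local_lr (nu : set (measurableTypeR R) -> \bar R) (theta0 : R)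
    (y : grid n d -> R) (A : {set grid n d}) : \bar R :=
  sqrte (2%:E * lne
    (ereal_sup [set (\prod_(i in A) expfam_pdf nu theta (y i))%:E |
                theta in natural_space nu]
     / (\prod_(i in A) expfam_pdf nu theta0 (y i))%:E))%E.

Definition multiscale (nu : set (measurableTypeR R) -> \bar R)
    (y : grid n d -> R) (theta0 : R) (AA : {set {set grid n d}}) (v : R)
    : \bar R :=
  \big[maxe/-oo%E]_(A in AA) (local_lr nu theta0 y A - (pen v #|A|%:R)%:E)%E.

Definition gauss_multiscale (x : grid n d -> R) (AA : {set {set grid n d}})
    (v : R) : \bar R :=
  \big[maxe/-oo%E]_(A in AA)
    ((Num.sqrt #|A|%:R)^-1 * `|\sum_(i in A) x i| - pen v #|A|%:R)%:E.

End statistics.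

(* Main.v *)
(** Write [Q] for the law of a field of i.i.d. coordinates. Both maxima are
    maxima of finitely many (polynomially many in [n]) affine functions of such
    a field, so that [{max <= q}] is a polyhedron [below a b q].

    Comparison. The indicator of a polyhedron is smoothed by
    [1 / (1 + sum_j exp(beta (a_j . w - b_j - q)))]. Exchanging one coordinate
    between two laws with mean 0, variance 1 and exponential moments changes
    its expectation by a third order Taylor remainder that is proportional to
    the variance of the direction under the softmax weights; as each [a_j] is
    a unit vector, these variances sum to at most [beta^2], whatever the number
    of coordinates. This gives a Lévy-type comparison of the distribution
    functions of the standardized and the Gaussian maximum, with shift [delta]
    and error [eta = O(beta^3 max |a_j k| + #J exp(-beta delta / 2))].

    Likelihood ratio. A Taylor expansion of the cumulant function turns the
    local statistic into [|Z_R|], with [Z_R] the standardized sum over [R], up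
    to [O(Z_R^2 / sqrt |R|)], and [|Z_R| = O(sqrt (log n))] by Chernoff bounds.

    Part (b) follows with a Gaussian anti-concentration bound: by a
    Cameron-Martin shift along [a_j], a band of width [e] at a level of order
    [H] has probability [O(e H)]. In part (a), space is cut into cells of width
    [2 m delta]; among the [m] possible offsets of the grid, one puts
    probability at most [1/m] within [delta] of the cut points. The two cell
    distributions are then close in total variation, and a maximal coupling of
    the cells, of piecewise constant density with respect to the product
    measure, couples the two fields.

    With [s = sqrt (log n)] and [a = (log^12 n / r_n)^(1/10)] the choice is
    [delta = a / s], [m = floor s] and [beta] of order [s^3 / a]. *)

From HB Require Import structures.
From mathcomp Require Import ring lra measurable_realfun.
Require Import Defs.

Set Implicit Arguments.
Unset Strict Implicit.
Unset Printing Implicit Defensive.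

Local Open Scope classical_set_scope.
Local Open Scope ring_scope.

(** * Product laws and resampling *)

Section product_laws.
Context {R : realType}.
Local Notation TR := (measurableTypeR R).
Local Notation vec n := (n.-tuple TR).
Local Notation law := (probability TR R).
Implicit Types (mus : nat -> law) (n : nat).

(** The comparison controls half-lines only, whereas a coupling of the maxima has to control all
    events; passing through cells multiplies the error [eta] by the number of cells. This is
    affordable because the Gaussian maximum stays, off a small event, in an interval of length O(s),
    so that O(s / a) cells of width of order a suffice.

    The exponents fit as follows. With the given [beta], the product [beta * delta] is a large
    multiple of s^2 = log n, which beats the polynomial number of regions. The directions have
    entries of size at most 1 / sqrt r_n = a^5 / s^12, so beta^3 / sqrt r_n is of order a^2 / s^3,
    and of order a / s^2 after multiplication by the number of cells. All failure probabilities are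
    then O(a + 1 / s), at distance O(a). In part (b) a band of width O(a / s) meets levels of order
    s, again with product O(a).

    The supremum over the parameter can be infinite, but not where all [|Z_R|] are O(s); elsewhere
    only its measurability matters. *)

Definition rectangle n (B : nat -> set R) : set (vec n) :=
  [set w | forall i : 'I_n, B i (tnth w i)].

Lemma measurable_rectangle n (B : nat -> set R) :
  (forall i, measurable (B i)) -> measurable (@rectangle n B).
Proof.
move=> mB; have -> : @rectangle n B =
    \bigcap_(i in [set: 'I_n]) ((fun w : vec n => tnth w i) @^-1` B i).
  by apply/seteqP; split=> [w Bw i _|w Bw i]; [exact: Bw|exact: (Bw i I)].
apply: fin_bigcap_measurable => // i _.
by have := @measurable_tnth _ TR n i measurableT _ (mB i); rewrite setTI.
Qed.

(** Rectangles are stable under intersection and generate the product sigma-algebra, so they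
    determine a finite measure. *)
Lemma tuple_measure_unique n (m1 m2 : {measure set (vec n) -> \bar R}) :
  (m1 setT < +oo)%E ->
  (forall B, (forall i, measurable (B i)) ->
     m1 (@rectangle n B) = m2 (@rectangle n B)) ->
  forall A, measurable A -> m1 A = m2 A.
Proof.
move=> m1T E.
pose G : set (set (vec n)) :=
  [set A | exists2 B, (forall i, measurable (B i)) & A = @rectangle n B].
have GT : G setT by exists (fun _ => setT) => //; apply/seteqP; split.
apply: (measure_unique G (fun _ => setT)) => //.
- apply/seteqP; split; last first.
    apply: smallest_sub; first exact: sigma_algebra_measurable.
    by move=> A [B mB ->]; exact: measurable_rectangle.
  apply: smallest_sub; first exact: smallest_sigma_algebra.
  move=> A; rewrite -bigcup_seq => -[i _ [B mB <-]].
  apply: sub_sigma_algebra.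
  exists (fun k : nat => if k == val i then B : set R else setT) => [k|].
    by case: ifP.
  rewrite setTI; apply/seteqP; split=> [w Bw j|w /(_ i)]; last by rewrite eqxx.
  by case: ifP => // /eqP/val_inj ->.
- move=> _ _ [B mB ->] [C mC ->]; exists (fun i => B i `&` C i).
    by move=> i; exact: measurableI.
  by apply/seteqP; split=> [w [Bw Cw] i|w BCw]; split=> //i;
    have [] := BCw i.
- by rewrite bigcup_const.
- by move=> _ [B mB ->]; exact: E.
Qed.

Definition tcons n (z : TR * vec n) : vec n.+1 :=
  [the n.+1.-tuple TR of z.1 :: z.2].

Lemma measurable_tcons n : measurable_fun [set: TR * vec n] (@tcons n).
Proof. exact: measurable_cons. Qed.

HB.instance Definition _ n :=
  isMeasurableFun.Build _ _ _ _ (@tcons n) (@measurable_tcons n).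

(* The laws are indexed by all of [nat], so that [upd] and the recursion on [n]
   need no casts between ordinal types. *)
Fixpoint prod_law n mus : probability (vec n) R :=
  match n with
  | 0 => \d_([tuple] : vec 0)
  | n.+1 => distribution (mus 0%N \x prod_law n (fun i => mus i.+1))%E (@tcons n)
  end.

Lemma prod_law_rectangle n mus B : (forall i, measurable (B i)) ->
  prod_law n mus (@rectangle n B) = (\prod_(i < n) mus i (B i))%E.
Proof.
elim: n mus B => [|n IH] mus B mB /=.
  by rewrite big_ord0 /rectangle diracE mem_set// => -[].
rewrite big_ord_recl /= -(IH (fun i => mus i.+1) (fun i => B i.+1))//.
rewrite -product_measure1E; [|exact: mB|exact: measurable_rectangle].
rewrite /distribution /pushforward; congr (_ _).
apply/seteqP; split=> [[x w] Bw|[x w] [/= Bx Bw] i] /=.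
  split=> /= [|i]; first exact: (Bw ord0).
  by have := Bw (lift ord0 i); rewrite tnthS.
case: (unliftP ord0 i) => [j|] -> //.
by rewrite tnthS; exact: (Bw j).
Qed.

(** An index [i] beyond the last coordinate leaves the tuple unchanged, so that the resampling
    lemmas hold for every natural number [i]. *)
Definition tset n (w : vec n) (i : nat) (x : TR) : vec n :=
  [tuple (if val j == i then x else tnth w j) | j < n].

Definition resample n i (z : TR * vec n) : vec n :=
  tset z.2 i z.1.

Lemma measurable_resample n i : measurable_fun setT (@resample n i).
Proof.
apply: (proj2 (@measurable_fun_tnthP _ _ _ TR n _)) => j.
apply: (eq_measurable_fun (fun z : TR * vec n =>
  if val j == i then z.1 else tnth z.2 j)) => [z _|].
  by rewrite /= tnth_mktuple.
case: (val j == i); first exact: measurable_fst.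
by apply: (measurableT_comp (measurable_tnth j)); exact: measurable_snd.
Qed.

HB.instance Definition _ n i :=
  isMeasurableFun.Build _ _ _ _ (@resample n i) (@measurable_resample n i).

Definition upd mus i (lam : law) : nat -> law :=
  fun k => if k == i then lam else mus k.

(** On a rectangle the overwritten coordinate is unconstrained and contributes mass 1, while the
    fresh one contributes the factor of [lam]. *)
Lemma prod_law_upd n mus i (lam : law) A : measurable A ->
  prod_law n (upd mus i lam) A =
  distribution (lam \x prod_law n mus)%E (@resample n i) A.
Proof.
move: A; apply: tuple_measure_unique => [|B mB].
  exact: (le_lt_trans (probability_le1 _ measurableT) (ltry 1)).
rewrite [LHS](prod_law_rectangle n (upd mus i lam) mB).
transitivity ((lam \x prod_law n mus)%E (@resample n i @^-1` rectangle B)); last by [].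
have -> : @resample n i @^-1` rectangle B =
    (if (i < n)%N then B i else setT) `*`
    @rectangle n (fun k => if k == i then setT else B k).
  apply/seteqP; split=> [[x w] /= Bw|[x w] [/= Bx Bw] j].
    split=> /= [|j].
      case: ifP => // ni; have := Bw (Ordinal ni).
      by rewrite tnth_mktuple /= eqxx.
    by case: ifP => // ji; have := Bw j; rewrite tnth_mktuple ji.
  rewrite tnth_mktuple; case: ifPn => ji; last by have := Bw j; rewrite (negbTE ji).
  by move: Bx; rewrite (eqP ji)// -(eqP ji) ltn_ord.
rewrite product_measure1E; last 2 first.
- by case: ifP => // _; exact: mB.
- by apply: measurable_rectangle => k; case: ifP.
rewrite [X in (_ * X)%E](prod_law_rectangle n mus); last by move=> k; case: ifP.
case: ifPn => ni.
  rewrite (bigD1 (Ordinal ni))//= /upd eqxx; congr (_ * _)%E.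
  rewrite [RHS](bigD1 (Ordinal ni))//= eqxx probability_setT mul1e.
  apply: eq_bigr => j; rewrite -val_eqE /= => /negbTE ->.
  by [].
rewrite [X in _ = (X * _)%E](_ : _ = 1%E); last exact: probability_setT.
rewrite mul1e; apply: eq_bigr => j _; rewrite /upd.
by case: ifP => // /eqP ji; move: ni; rewrite -ji ltn_ord.
Qed.

(** The outer law at coordinate [i] is irrelevant because [tset] overwrites it. Two choices of [lam]
    are thus compared under one common outer measure, by a one-dimensional estimate for each [w]. *)
Lemma ge0_integral_prod_law_upd n mus (i : nat) (lam : law)
    (f : vec n -> \bar R) :
  measurable_fun [set: vec n] f -> (forall w, 0 <= f w)%E ->
  (\int[prod_law n (upd mus i lam)]_w f w =
   \int[prod_law n mus]_w \int[lam]_x f (tset w i x))%E.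
Proof.
move=> mf f0.
transitivity (\int[distribution (lam \x prod_law n mus)%E (@resample n i)]_w f w)%E.
  apply: eq_measure_integral => A mA _; exact: prod_law_upd.
rewrite ge0_integral_distribution//.
have mfg : measurable_fun setT (f \o @resample n i).
  by apply: measurableT_comp => //; exact: measurable_resample.
rewrite (fubini_tonelli2 _ mfg) /fubini_G//.
by move=> z; exact: f0.
Qed.

Lemma eq_prod_law n mus mus' : (forall i, (i < n)%N -> mus i = mus' i) ->
  prod_law n mus = prod_law n mus'.
Proof.
elim: n mus mus' => //= n IH mus mus' E.
rewrite (E 0%N)// (IH _ (fun i => mus' i.+1))// => i ni.
exact: E.
Qed.

Lemma bounded_integrable d (T : measurableType d) (P : probability T R)
    (f : T -> R) (C : R) : measurable_fun [set: T] f -> (forall x, `|f x| <= C) ->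
  P.-integrable [set: T] (EFin \o f).
Proof.
move=> mf fC; apply: measurable_bounded_integrable => //.
  by rewrite (le_lt_trans (probability_le1 P measurableT))// ltry.
exists C; split; first by rewrite num_real.
by move=> y Cy x _; exact: le_trans (fC x) (ltW Cy).
Qed.

Lemma bounded_RintegralE d (T : measurableType d) (P : probability T R)
    (f : T -> R) (C : R) : measurable_fun [set: T] f -> (forall x, `|f x| <= C) ->
  (\int[P]_x (f x)%:E = (\int[P]_x f x)%:E)%E.
Proof.
move=> mf fC; rewrite /Rintegral fineK//.
by apply: integrable_fin_num => //; exact: bounded_integrable fC.
Qed.

Lemma Rintegral_prob_cst d (T : measurableType d) (P : probability T R) (r : R) :
  \int[P]_x r = r.
Proof.
rewrite Rintegral_cst// [X in fine X](_ : _ = 1%E) ?mulr1//.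
exact: probability_setT.
Qed.

Lemma Rintegral_bound d (T : measurableType d) (P : probability T R)
    (f : T -> R) (C : R) : measurable_fun [set: T] f -> (forall x, 0 <= f x <= C) ->
  0 <= \int[P]_x f x <= C.
Proof.
move=> mf fC.
have fC' x : `|f x| <= C by have /andP[? ?] := fC x; rewrite ger0_norm.
rewrite Rintegral_ge0 /=; last by move=> x _; have /andP[] := fC x.
rewrite -[leRHS](Rintegral_prob_cst P).
apply: le_Rintegral => //; first exact: bounded_integrable fC'.
  by apply: (@bounded_integrable _ _ _ _ `|C|).
by move=> x _; have /andP[] := fC x.
Qed.

Lemma measurable_tset1 n (w : vec n) i : measurable_fun [set: TR] (tset w i).
Proof.
have mp : measurable_fun [set: TR] (fun x : TR => (x, w)).
  exact: (@pair2_measurable _ _ TR (vec n)).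
exact: (measurableT_comp (@measurable_resample n i) mp).
Qed.

Section resampling.
Variables (n : nat) (f : vec n -> R) (C : R).
Hypotheses (mf : measurable_fun [set: vec n] f) (fC : forall w, 0 <= f w <= C).

Let fC' w : `|f w| <= C.
Proof. by have /andP[? ?] := fC w; rewrite ger0_norm. Qed.

Lemma measurable_tset_comp w i : measurable_fun [set: TR] (fun x => f (tset w i x)).
Proof. by apply: measurableT_comp => //; exact: measurable_tset1. Qed.

Lemma measurable_Rintegral_tset (lam : law) i :
  measurable_fun [set: vec n] (fun w => \int[lam]_x f (tset w i x)).
Proof.
apply/measurable_EFinP.
apply: (eq_measurable_fun (fun w => \int[lam]_x (f (tset w i x))%:E)%E).
  move=> w _; rewrite /= (@bounded_RintegralE _ _ lam _ C)//.
  exact: measurable_tset_comp.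
have mg : measurable_fun [set: TR * vec n] (EFin \o f \o @resample n i).
  by apply: measurableT_comp; [exact/measurable_EFinP|exact: measurable_resample].
apply: (measurable_fun_fubini_tonelli_G _ mg) => z.
by rewrite lee_fin; have /andP[] := fC (resample i z).
Qed.

Lemma Rintegral_tset_bound (lam : law) i w :
  0 <= \int[lam]_x f (tset w i x) <= C.
Proof. by apply: Rintegral_bound => //; exact: measurable_tset_comp. Qed.

Lemma Rintegral_prod_law_upd mus i (lam : law) :
  \int[prod_law n (upd mus i lam)]_w f w =
  \int[prod_law n mus]_w \int[lam]_x f (tset w i x).
Proof.
rewrite [LHS]/Rintegral ge0_integral_prod_law_upd; last 2 first.
- exact/measurable_EFinP.
- by move=> w; rewrite lee_fin; have /andP[] := fC w.
congr fine; apply: eq_integral => w _.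
by rewrite (@bounded_RintegralE _ _ lam _ C)//; exact: measurable_tset_comp.
Qed.

End resampling.

End product_laws.

(** * Random fields on a finite index type as random tuples *)

Section field_law.
Context {R : realType}.
Local Notation TR := (measurableTypeR R).
Local Notation vec n := (n.-tuple TR).
Local Notation law := (probability TR R).
Context d (T : measurableType d) (P : probability T R) (I : finType).
Implicit Types (X : I -> {RV P >-> R}) (mu : law).

Definition field_vec (x : I -> R) : vec #|I| := [tuple x (enum_val k) | k < #|I|].

Lemma tnth_field_vec x i : tnth (field_vec x) (enum_rank i) = x i.
Proof. by rewrite tnth_mktuple enum_rankK. Qed.

Lemma measurable_field_vec X :
  measurable_fun [set: T] (fun w => field_vec (fun i => X i w)).
Proof.
apply: (proj2 (@measurable_fun_tnthP _ _ _ TR _ _)) => k.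
apply: (eq_measurable_fun (X (enum_val k))); last exact: measurable_funPT.
by move=> w _; rewrite /= tnth_mktuple.
Qed.

(** Independence over the full index set gives the mass of every rectangle. All probabilities about
    a field, on whatever space it lives, are thereby moved to one fixed product law. *)
Lemma iid_field_law X mu A : iid_field X mu -> measurable A ->
  P ((fun w => field_vec (fun i => X i w)) @^-1` A) =
  prod_law #|I| (fun=> mu) A.
Proof.
move=> [iX lX] mA.
pose V : T -> vec #|I| := fun w => field_vec (fun i => X i w).
have mV : measurable_fun [set: T] V by exact: measurable_field_vec.
pose hV := isMeasurableFun.Build _ _ _ _ V mV.
pose VV : {mfun T >-> vec #|I|} := HB.pack V hV.
transitivity (distribution P VV A); first by [].
move: A mA; apply: tuple_measure_unique.
  exact: (le_lt_trans (probability_le1 _ measurableT) (ltry 1)).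
move=> B mB; rewrite [RHS](@prod_law_rectangle _ _ (fun=> mu) B mB).
transitivity (P (\bigcap_(i in [set` [set: I]%SET])
    (X i @^-1` B (enum_rank i)))).
  congr (P _); apply/seteqP; split=> w /= Bw.
    by move=> i _; have := Bw (enum_rank i); rewrite tnth_field_vec.
  by move=> k; rewrite tnth_mktuple; have := Bw (enum_val k); rewrite /= enum_valK inE; apply.
rewrite iX//; transitivity (\prod_(i in [set: I]%SET) mu (B (enum_rank i)))%E.
  by apply: eq_bigr => i _; rewrite -(lX i (B (enum_rank i))).
rewrite (reindex_onto (@enum_val I predT) (@enum_rank I)) /=; last first.
  by move=> i _; rewrite enum_rankK.
apply: eq_big => [k|k _]; rewrite ?inE enum_valK ?eqxx//.
Qed.

Lemma prod_law_coord_iid n (mu : law) (B : nat -> set R) (J : {set 'I_n}) :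
  (forall i, measurable (B i)) ->
  prod_law n (fun=> mu) (\bigcap_(i in [set` J]) ((@tnth _ TR)^~ i @^-1` B i)) =
  (\prod_(i in J) mu (B i))%E.
Proof.
move=> mB.
pose B' k := if insub k is Some i then if i \in J then B k else setT else setT.
have mB' k : measurable (B' k).
  by rewrite /B'; case: insub => // i; case: ifP.
have -> : \bigcap_(i in [set` J]) ((@tnth _ TR)^~ i @^-1` B i) =
    @rectangle R n B'.
  apply/seteqP; split=> w /= Bw i.
    by rewrite /B' valK; case: ifPn => // iJ; exact: (Bw i iJ).
  by move=> /= iJ; have := Bw i; rewrite /B' valK iJ.
rewrite prod_law_rectangle//= [RHS]big_mkcond/=; apply: eq_bigr => i _.
rewrite /B' valK; case: ifP => // _; exact: probability_setT.
Qed.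

End field_law.

(** * Mixtures of two laws *)

Section mixture.
Context {R : realType}.
Local Notation TR := (measurableTypeR R).
Local Notation law := (probability TR R).
Variables mu nu : law.

Lemma clamp_ge0 (t : R) : 0 <= Num.min 1 (Num.max 0 t).
Proof. by rewrite le_min ler01 le_max lexx. Qed.

Lemma clamp_le1 (t : R) : 0 <= 1 - Num.min 1 (Num.max 0 t).
Proof. by rewrite subr_ge0 ge_min lexx. Qed.

(* Clamping [t] to [0, 1] makes this a probability for every real [t]. *)
Definition mixture (t : R) : set TR -> \bar R :=
  measure_add (mscale (NngNum (clamp_le1 t)) mu) (mscale (NngNum (clamp_ge0 t)) nu).

HB.instance Definition _ t := Measure.on (mixture t).

Lemma mixture_setT t : mixture t setT = 1%E.
Proof.
rewrite /mixture measure_addE /mscale /=.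
rewrite -[X in (_ * X + _)%E]/(mu setT) -[X in (_ + _ * X)%E]/(nu setT).
rewrite !probability_setT !mule1 -EFinD.
by rewrite subrK.
Qed.

HB.instance Definition _ t :=
  Measure_isProbability.Build _ _ _ (mixture t) (mixture_setT t).

Definition mix (t : R) : law := mixture t.

Lemma Rintegral_mix (t : R) (f : TR -> R) (C : R) : 0 <= t <= 1 ->
  measurable_fun [set: TR] f -> (forall x, 0 <= f x <= C) ->
  \int[mix t]_x f x = (1 - t) * (\int[mu]_x f x) + t * (\int[nu]_x f x).
Proof.
move=> /andP[t0 t1] mf fC.
have fC' x : `|f x| <= C by have /andP[? ?] := fC x; rewrite ger0_norm.
have f0 x : (0 <= (f x)%:E)%E by rewrite lee_fin; have /andP[] := fC x.
have ct : Num.min 1 (Num.max 0 t) = t by rewrite max_r// min_r.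
rewrite [LHS]/Rintegral ge0_integral_measure_add//; last exact/measurable_EFinP.
rewrite !ge0_integral_mscale//=; try exact/measurable_EFinP.
by rewrite !(bounded_RintegralE _ mf fC') -!EFinM -EFinD /= ct.
Qed.

End mixture.

(** * Replacement of the coordinates *)

Section lindeberg.
Context {R : realType}.
Local Notation TR := (measurableTypeR R).
Local Notation vec n := (n.-tuple TR).
Local Notation law := (probability TR R).
Implicit Types (mu nu : law) (mus : nat -> law).

(** A product law is affine in each of its factors. *)
Lemma Rintegral_upd_mix n mu nu mus (i : nat) (t : R) (f : vec n -> R) (C : R) : 0 <= t <= 1 ->
  measurable_fun [set: vec n] f -> (forall w, 0 <= f w <= C) ->
  \int[prod_law n (upd mus i (mix mu nu t))]_w f w =
  (1 - t) * (\int[prod_law n (upd mus i mu)]_w f w) +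
  t * (\int[prod_law n (upd mus i nu)]_w f w).
Proof.
move=> t01 mf fC; rewrite !(Rintegral_prod_law_upd mf fC).
have Ib (lam : law) : (prod_law n mus).-integrable [set: vec n]
    (EFin \o (fun w => \int[lam]_x f (tset w i x))).
  apply: (@bounded_integrable _ _ _ _ _ C) => [|w].
    exact: (measurable_Rintegral_tset mf fC lam i).
  have /andP[? ?] := Rintegral_tset_bound mf fC lam i w.
  by rewrite ger0_norm.
rewrite -!RintegralZl// -RintegralD//; last 2 first.
- exact: (integrableZl measurableT _ (Ib mu)).
- exact: (integrableZl measurableT _ (Ib nu)).
apply: eq_Rintegral => w _.
rewrite (@Rintegral_mix _ mu nu _ (fun x => f (tset w i x)) C)//.
exact: measurable_tset_comp.
Qed.

Lemma Rintegral_eq_law n mus mus' (f : vec n -> R) :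
  (forall i, (i < n)%N -> forall A, measurable A -> mus i A = mus' i A) ->
  \int[prod_law n mus]_w f w = \int[prod_law n mus']_w f w.
Proof.
move=> E; rewrite /Rintegral; congr fine.
apply: eq_measure_integral => A mA _.
move: A mA; apply: tuple_measure_unique.
  exact: (le_lt_trans (probability_le1 _ measurableT) (ltry 1)).
move=> B mB; rewrite [LHS](@prod_law_rectangle _ n mus B mB).
rewrite [RHS](@prod_law_rectangle _ n mus' B mB).
by apply: eq_bigr => i _; apply: E; [exact: ltn_ord|exact: mB].
Qed.

(* Exchanging the coordinates one after the other costs [c * sum_i E (V i)], but
   with a different product law for each [i], so that [sum_i V i <= B] cannot be
   used. Going from [mu] to [nu] along the mixtures [(1 - t) mu + t nu] in
   [K + 1] small steps, the laws within one step differ by [O(n / K)], and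
   [K] tends to infinity at the end. *)
Section replacement.
Variables (n : nat) (mu nu : law) (f : vec n -> R) (V : nat -> vec n -> R).
Variables (c B Vm : R).
Hypotheses (mf : measurable_fun [set: vec n] f) (f01 : forall w, 0 <= f w <= 1).
Hypotheses (mV : forall i, measurable_fun [set: vec n] (V i))
  (Vb : forall i w, 0 <= V i w <= Vm).
Hypothesis c0 : 0 <= c.
Hypothesis swap_mu : forall i w,
  `|\int[nu]_x f (tset w i x) - \int[mu]_x f (tset w i x)| <=
  c * \int[mu]_x V i (tset w i x).
Hypothesis swap_nu : forall i w,
  `|\int[nu]_x f (tset w i x) - \int[mu]_x f (tset w i x)| <=
  c * \int[nu]_x V i (tset w i x).
Hypothesis sumV : forall w, \sum_(i < n) V i w <= B.

(** The left-hand side does not involve the law that integrates [V i], so the bounds under [mu] and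
    under [nu] can be averaged with weights [1 - t] and [t]. *)
Lemma swap_mix i w t : 0 <= t <= 1 ->
  `|\int[nu]_x f (tset w i x) - \int[mu]_x f (tset w i x)| <=
  c * \int[mix mu nu t]_x V i (tset w i x).
Proof.
move=> /[dup] t01 /andP[t0 t1].
rewrite (@Rintegral_mix _ mu nu t (fun x => V i (tset w i x)) Vm)//; last first.
  exact: measurable_tset_comp.
set D := `|_|.
rewrite (_ : D = (1 - t) * D + t * D); last by rewrite -mulrDl subrK mul1r.
rewrite mulrDr; apply: lerD.
  by rewrite mulrCA ler_wpM2l ?subr_ge0//; exact: swap_mu.
by rewrite mulrCA ler_wpM2l//; exact: swap_nu.
Qed.

Lemma swap_coordinate mus i t : 0 <= t <= 1 ->
  `|\int[prod_law n (upd mus i nu)]_w f w - \int[prod_law n (upd mus i mu)]_w f w| <=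
  c * \int[prod_law n (upd mus i (mix mu nu t))]_w V i w.
Proof.
move=> t01; rewrite !(Rintegral_prod_law_upd mf f01).
rewrite (Rintegral_prod_law_upd (mV i) (Vb i)).
have Ib (g : vec n -> R) C (lam : law) : measurable_fun [set: vec n] g ->
    (forall w, 0 <= g w <= C) -> (prod_law n mus).-integrable [set: vec n]
    (EFin \o (fun w => \int[lam]_x g (tset w i x))).
  move=> mg gC; apply: (@bounded_integrable _ _ _ _ _ C) => [|w].
    exact: (measurable_Rintegral_tset mg gC lam i).
  by have /andP[? ?] := Rintegral_tset_bound mg gC lam i w; rewrite ger0_norm.
rewrite -RintegralB//; [|exact: (Ib _ _ nu mf f01)|exact: (Ib _ _ mu mf f01)].
have IB : (prod_law n mus).-integrable [set: vec n] (EFin \o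
    (fun w => \int[nu]_x f (tset w i x) - \int[mu]_x f (tset w i x))).
  exact: (integrableB measurableT (Ib _ _ nu mf f01) (Ib _ _ mu mf f01)).
apply: le_trans (le_normr_Rintegral measurableT IB) _.
have IV := Ib _ _ (mix mu nu t) (mV i) (Vb i).
rewrite -RintegralZl//; apply: le_Rintegral => //.
- exact: integrable_norm IB.
- exact: (integrableZl measurableT _ IV).
- by move=> w _; exact: swap_mix.
Qed.

Let K_ K k : R := k%:R / K.+1%:R.

Let K01 K k : (k <= K.+1)%N -> 0 <= K_ K k <= 1.
Proof.
move=> kK; rewrite /K_ divr_ge0//= ler_pdivrMr ?ltr0n// mul1r.
by rewrite ler_nat.
Qed.

(** The intermediate law inside step [k]: the coordinates before [i] have already moved to the next
    mixture, the others have not. *)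
Let path K k i : nat -> law := fun j =>
  if (j < i)%N then mix mu nu (K_ K k.+1) else mix mu nu (K_ K k).

Let pathE K k i : path K k i = upd (path K k i) i (mix mu nu (K_ K k)).
Proof. by apply/funext => j; rewrite /path /upd; case: ltngtP. Qed.

Let pathS K k i : path K k i.+1 = upd (path K k i) i (mix mu nu (K_ K k.+1)).
Proof. by apply/funext => j; rewrite /path /upd ltnS; case: ltngtP. Qed.

(** Moving one coordinate to the next mixture changes its weight on [nu] by [K.+1%:R^-1], and the
    expectation is affine in that weight. *)
Let step K k i (g : vec n -> R) C : (k < K.+1)%N ->
  measurable_fun [set: vec n] g -> (forall w, 0 <= g w <= C) ->
  \int[prod_law n (path K k i.+1)]_w g w - \int[prod_law n (path K k i)]_w g w =
  (\int[prod_law n (upd (path K k i) i nu)]_w g w -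
   \int[prod_law n (upd (path K k i) i mu)]_w g w) / K.+1%:R.
Proof.
move=> kK mg gC; rewrite pathS [in X in _ - X = _]pathE.
rewrite !(Rintegral_upd_mix _ _ _ _ _ mg gC) ?K01//; last exact: ltnW.
have -> : K_ K k.+1 = K_ K k + K.+1%:R^-1.
  by rewrite /K_ -natr1 mulrDl mul1r.
set a := \int[_]_w _; set b := \int[_]_w _.
by rewrite -/(K_ K k); ring.
Qed.

(** Lets all variance terms of one step be evaluated under the law at the start of the step, where
    [sumV] applies. *)
Let drift K k i j : (k < K.+1)%N ->
  `|\int[prod_law n (path K k i)]_w V j w - \int[prod_law n (path K k 0)]_w V j w|
  <= i%:R * Vm / K.+1%:R.
Proof.
move=> kK; elim: i => [|i IH]; first by rewrite subrr normr0 !mul0r.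
rewrite -natr1 !mulrDl mul1r.
rewrite (le_trans (ler_distD (\int[prod_law n (path K k i)]_w V j w) _ _))//.
rewrite addrC lerD// (step _ kK (mV j) (Vb j)) normrM.
rewrite [X in _ * X]ger0_norm ?invr_ge0//; rewrite ler_wpM2r ?invr_ge0//.
have b lam : 0 <= \int[prod_law n (upd (path K k i) i lam)]_w V j w <= Vm.
  by apply: Rintegral_bound => //; exact: mV.
have := b nu; have := b mu => /andP[? ?] /andP[? ?].
by rewrite ler_norml; apply/andP; split; lra.
Qed.

(** Each of the [n] swaps is bounded by a variance under its own intermediate law; [drift] replaces
    it by [path K k 0] at a cost of at most [n%:R * Vm / K.+1%:R] per swap. The remaining variances
    sum to at most [B]. *)
Let row K k : (k < K.+1)%N ->
  `|\int[prod_law n (path K k n)]_w f w - \int[prod_law n (path K k 0)]_w f w|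
  <= c * (B + n%:R * n%:R * Vm / K.+1%:R) / K.+1%:R.
Proof.
move=> kK.
have Vm0 : 0 <= Vm.
  by have /andP[? ?] := Vb 0 [tuple (0:TR) | _ < n]; apply: le_trans; eauto.
rewrite -(telescope_sumr (fun i => \int[prod_law n (path K k i)]_w f w)) ?leq0n//.
apply: le_trans (ler_norm_sum _ _ _) _.
apply: (@le_trans _ _ (\sum_(0 <= i < n) c / K.+1%:R *
    (\int[prod_law n (path K k 0)]_w V i w + n%:R * Vm / K.+1%:R))).
  rewrite big_nat_cond [leRHS]big_nat_cond; apply: ler_sum => i; rewrite andbT => /andP[_ ni].
  rewrite (step _ kK mf f01) normrM [X in _ * X]ger0_norm ?invr_ge0//.
  rewrite mulrAC ler_wpM2r ?invr_ge0//.
  have := swap_coordinate (path K k i) i (K01 (ltnW kK)).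
  rewrite -pathE => /le_trans; apply; rewrite ler_wpM2l//.
  have := drift i i kK; rewrite ler_distl => /andP[_ /le_trans]; apply.
  rewrite lerD2l ler_wpM2r ?invr_ge0// ler_wpM2r// ler_nat.
  exact: ltnW.
rewrite -mulr_sumr big_split/= mulrAC ler_wpM2r ?invr_ge0// ler_wpM2l//.
apply: lerD; last first.
  by rewrite sumr_const_nat subn0 -[leLHS]mulr_natl !mulrA.
have IV j : (prod_law n (path K k 0)).-integrable [set: vec n] (EFin \o V j).
  apply: (@bounded_integrable _ _ _ _ _ Vm) => // w.
  by have /andP[? ?] := Vb j w; rewrite ger0_norm.
have sE m : (m <= n)%N -> \sum_(0 <= i < m) \int[prod_law n (path K k 0)]_w V i w =
   \int[prod_law n (path K k 0)]_w (\sum_(0 <= i < m) V i w)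
   /\ (prod_law n (path K k 0)).-integrable [set: vec n]
        (EFin \o (fun w => \sum_(0 <= i < m) V i w)).
  elim: m => [_|m IH mn].
    have -> : (fun w : vec n => \sum_(0 <= i < 0) V i w) = cst 0.
      by apply/funext => w; rewrite big_geq.
    rewrite big_geq// Rintegral_cst// mul0r; split=> //.
    by apply: (@bounded_integrable _ _ _ _ _ 0) => // w; rewrite normr0.
  have [E I'] := IH (ltnW mn).
  rewrite big_nat_recr//= E -RintegralD//; split.
    by apply: eq_Rintegral => w _; rewrite big_nat_recr.
  have := integrableD measurableT I' (IV m).
  apply: eq_integrable => //.
  by move=> w _ /=; rewrite big_nat_recr.
have [-> I'] := sE n (leqnn n).
rewrite -[leRHS](Rintegral_prob_cst (prod_law n (path K k 0))).
apply: le_Rintegral => //.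
  by apply: (@bounded_integrable _ _ _ _ _ `|B|).
by move=> w _; rewrite big_mkord; exact: sumV.
Qed.

Lemma replacement_bound :
  `|\int[prod_law n (fun=> nu)]_w f w - \int[prod_law n (fun=> mu)]_w f w| <= c * B.
Proof.
suff H (K : nat) :
  `|\int[prod_law n (fun=> nu)]_w f w - \int[prod_law n (fun=> mu)]_w f w| <=
  c * (B + n%:R * n%:R * Vm / K.+1%:R).
  apply/ler_addgt0Pr => e e0.
  set A := c * (n%:R * n%:R * Vm).
  have [K AK] : exists K : nat, A / K.+1%:R <= e.
    (* The bound holds for every number of steps, and the drift term vanishes as that number
       grows. *)
    exists (Num.truncn (A / e)); rewrite ler_pdivrMr ?ltr0n// mulrC -ler_pdivrMr//.
    by rewrite ltW// truncnS_gt.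
  apply: le_trans (H K) _; rewrite mulrDr lerD2l.
  by move: AK; rewrite /A !mulrA.
have mixE t A : mix mu nu t A = ((1 - Num.min 1 (Num.max 0 t))%:E * mu A +
    (Num.min 1 (Num.max 0 t))%:E * nu A)%E.
  by rewrite [LHS]measure_addE.
have mix0 A : mix mu nu 0 A = mu A.
  rewrite mixE (_ : Num.min 1 (Num.max 0 0) = 0); last by rewrite maxxx min_r.
  by rewrite subr0 mul1e mul0e adde0.
have mix1 A : mix mu nu 1 A = nu A.
  rewrite mixE (_ : Num.min 1 (Num.max 0 1) = 1); last by rewrite max_r// minxx.
  by rewrite subrr mul1e mul0e add0e.
have E0 : \int[prod_law n (path K 0 0)]_w f w = \int[prod_law n (fun=> mu)]_w f w.
  apply: Rintegral_eq_law => i _ A mA; rewrite /path /K_ /= mul0r; exact: mix0.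
have E1 : \int[prod_law n (path K K n)]_w f w = \int[prod_law n (fun=> nu)]_w f w.
  apply: Rintegral_eq_law => i ni A mA.
  by rewrite /path ni /K_ divff ?pnatr_eq0//; exact: mix1.
have ES k : prod_law n (path K k n) = prod_law n (path K k.+1 0).
  by apply: eq_prod_law => i ni; rewrite /path ni.
rewrite -E0 -E1.
pose a k := \int[prod_law n (path K k 0)]_w f w.
have -> : \int[prod_law n (path K K n)]_w f w = a K.+1 by rewrite ES.
rewrite -/(a 0) -(telescope_sumr a)//.
apply: le_trans (ler_norm_sum _ _ _) _.
set b := c * _; have -> : b = \sum_(0 <= k < K.+1) b / K.+1%:R.
  by rewrite sumr_const_nat subn0 -[RHS]mulr_natr divfK// pnatr_eq0.
rewrite big_nat_cond [leRHS]big_nat_cond; apply: ler_sum => k.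
by rewrite andbT /a => /andP[_ kK]; rewrite -ES; exact: row.
Qed.

End replacement.
End lindeberg.

(** * Taylor bounds for the exponential function *)

Section exponential_inequalities.
Context {R : realType}.
Implicit Types x y : R.

Lemma one_le_expR y : 0 <= y -> 1 <= expR y.
Proof. by move=> y0; rewrite -expR0 ler_expR. Qed.

Lemma expR_sub1_le y : `|expR y - 1| <= `|y| * expR `|y|.
Proof.
have [y0|y0] := leP 0 y.
  rewrite !ger0_norm ?subr_ge0 ?one_le_expR//.
  have : (1 - y) * expR y <= 1.
    by rewrite -ler_pdivlMr ?expR_gt0// div1r -expRN expR_ge1Dx.
  lra.
have e1 : expR y - 1 < 0 by rewrite subr_lt0 expR_lt1.
rewrite (ltr0_norm e1) (ltr0_norm y0).
have h : 1 <= expR (- y) by rewrite one_le_expR// oppr_ge0 ltW.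
have := expR_ge1Dx y.
have : - y <= - y * expR (- y) by rewrite ler_peMr// oppr_ge0 ltW.
lra.
Qed.

Lemma expR_sub2_le y : `|expR y - 1 - y| <= y ^+ 2 * expR `|y|.
Proof.
have h : 0 <= expR y - 1 - y by have := expR_ge1Dx y; lra.
rewrite ger0_norm//.
have : expR y - 1 - y <= y * (expR y - 1).
  have : (1 - y) * expR y <= 1.
    by rewrite -ler_pdivlMr ?expR_gt0// div1r -expRN expR_ge1Dx.
  lra.
move=> /le_trans; apply; apply: le_trans (ler_norm _) _.
rewrite normrM (le_trans (ler_wpM2l (normr_ge0 _) (expR_sub1_le y)))//.
by rewrite mulrA -expr2 real_normK// num_real.
Qed.

(** Mean value theorem: the derivative of the remainder is the remainder of one order less, which
    [expR_sub2_le] controls on the whole segment from 0 to [y]. *)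
Lemma expR_sub3_le y :
  `|expR y - 1 - y - y ^+ 2 / 2| <= `|y| ^+ 3 * expR `|y|.
Proof.
pose g z : R := expR z - 1 - z - z ^+ 2 / 2.
pose g' z : R := expR z - 1 - z.
have dg z : is_derive z (1 : R) g (g' z).
  rewrite /g /g'; apply: is_derive_eq.
  by rewrite /GRing.scale/=; field.
have cg : {in `]-oo, +oo[, continuous g}.
  move=> z _; apply: differentiable_continuous; apply/derivable1_diffP.
  exact: (@ex_derive _ _ _ _ _ _ _ (dg z)).
have g0 : g 0 = 0 by rewrite /g expR0; ring.
have bound z : `|z| <= `|y| -> `|g' z| <= `|y| ^+ 2 * expR `|y|.
  move=> zy; apply: le_trans (expR_sub2_le z) _.
  rewrite -[z ^+ 2]real_normK ?num_real// ler_pM ?exprn_ge0 ?expR_ge0//.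
    by rewrite lerXn2r ?nnegrE.
  by rewrite ler_expR.
have cseg a b : {within `[a, b], continuous g}.
  by apply: continuous_subspaceT => z; exact: cg.
rewrite -/(g y) exprSr -mulrA [_ * expR _]mulrC mulrA.
have [y0|y0|<-] := ltgtP 0 y; last by rewrite g0 !normr0 mulr0.
- have [z zy] := MVT_segment (ltW y0) (fun (x : R) _ => dg x) (cseg 0 y).
  rewrite g0 !subr0 => ->; rewrite normrM ler_wpM2r//; apply: bound.
  by move: zy; rewrite in_itv/= => /andP[z0 zy]; rewrite !ger0_norm// ltW.
- have [z zy] := MVT_segment (ltW y0) (fun (x : R) _ => dg x) (cseg y 0).
  rewrite g0 !sub0r => /eqP; rewrite eqr_oppLR => /eqP ->.
  rewrite normrN normrM normrN ler_wpM2r//; apply: bound.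
  move: zy; rewrite in_itv/= => /andP[yz z0].
  by rewrite !ler0_norm ?lerN2// ltW.
Qed.

End exponential_inequalities.

(** * Taylor expansion of the smoothed indicator in one coordinate *)

Section logistic_softmax.
Context {R : realType} (J : finType).
Variables (c lam : J -> R) (L : R).
Hypotheses (L0 : 0 <= L) (c0 : forall j, 0 <= c j) (lamL : forall j, `|lam j| <= L).

(** As a function of a single coordinate [x], the sum of the soft weights has this form: [c j] is
    the weight at [x = 0] and [lam j] is [beta] times the entry of the direction at that
    coordinate. *)
Definition expsum (x : R) : R := \sum_j c j * expR (lam j * x).
Definition expsum2 (x : R) : R := \sum_j c j * lam j ^+ 2 * expR (lam j * x).

Let S0 := \sum_j c j.
Let S1 := \sum_j c j * lam j.
Let S1a := \sum_j c j * `|lam j|.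
Let S2 := \sum_j c j * lam j ^+ 2.

Let S00 : 0 <= S0. Proof. exact: sumr_ge0. Qed.
Let S20 : 0 <= S2.
Proof. by apply: sumr_ge0 => j _; rewrite mulr_ge0// sqr_ge0. Qed.
Let S1a0 : 0 <= S1a.
Proof. by apply: sumr_ge0 => j _; rewrite mulr_ge0. Qed.


Lemma expsum_ge0 x : 0 <= expsum x.
Proof. by apply: sumr_ge0 => j _; rewrite mulr_ge0// expR_ge0. Qed.

Let lamx x j : `|lam j * x| <= L * `|x|.
Proof. by rewrite normrM ler_wpM2r. Qed.

Let expE x j : expR `|lam j * x| <= expR (L * `|x|).
Proof. by rewrite ler_expR. Qed.

Let S1aS0 : S1a <= L * S0.
Proof.
rewrite /S1a /S0 mulr_sumr; apply: ler_sum => j _.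
by rewrite mulrC ler_wpM2r.
Qed.

Let S1_le : `|S1| <= S1a.
Proof.
apply: le_trans (ler_norm_sum _ _ _) _; apply: ler_sum => j _.
by rewrite normrM (ger0_norm (c0 j)).
Qed.

(** Cauchy-Schwarz with weights [c], from the nonnegativity of the second moment around the mean
    [S1a / S0]. It turns squares of first order terms into the second moment [S2], the quantity that
    the final bound has to retain. *)
Let cauchy : S1a ^+ 2 <= S0 * S2.
Proof.
have [S0p|S0n] := ltP 0 S0; last first.
  have S00' : S0 = 0 by apply/eqP; rewrite eq_le S0n S00.
  have cj j : c j = 0.
    move/eqP: S00'; rewrite psumr_eq0// => /allP/(_ j).
    by rewrite mem_index_enum => /(_ isT)/eqP.
  by rewrite /S1a big1 ?expr0n ?S00' ?mul0r// => j _; rewrite cj mul0r.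
pose m := S1a / S0.
have : 0 <= \sum_j c j * (`|lam j| - m) ^+ 2.
  by apply: sumr_ge0 => j _; rewrite mulr_ge0// sqr_ge0.
have -> : \sum_j c j * (`|lam j| - m) ^+ 2 = S2 - 2 * m * S1a + m ^+ 2 * S0.
  rewrite /S2 /S1a /S0 !mulr_sumr -sumrB -big_split/=; apply: eq_bigr => j _.
  by rewrite -[in RHS](real_normK (num_real (lam j))); ring.
have -> : S2 - 2 * m * S1a + m ^+ 2 * S0 = S2 - S1a ^+ 2 / S0.
  by rewrite /m; field; rewrite gt_eqF.
by rewrite subr_ge0 ler_pdivrMr// mulrC.
Qed.

Let d0 x : `|expsum x - S0| <= `|x| * S1a * expR (L * `|x|).
Proof.
rewrite /expsum /S0 -sumrB mulrAC mulr_sumr; apply: le_trans (ler_norm_sum _ _ _) _.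
apply: ler_sum => j _.
rewrite -{2}[c j]mulr1 -mulrBr normrM (ger0_norm (c0 j)).
rewrite [leRHS]mulrC -!mulrA ler_wpM2l//.
apply: le_trans (expR_sub1_le _) _; rewrite normrM -!mulrA ler_wpM2l//.
by rewrite ler_wpM2l// -normrM expE.
Qed.

Let d1 x : `|expsum x - S0 - S1 * x| <= S2 * `|x| ^+ 2 * expR (L * `|x|).
Proof.
rewrite /expsum /S0 /S1 mulr_suml -!sumrB -mulrA mulr_suml.
apply: le_trans (ler_norm_sum _ _ _) _; apply: ler_sum => j _.
have -> : c j * expR (lam j * x) - c j - c j * lam j * x =
  c j * (expR (lam j * x) - 1 - lam j * x) by ring.
have -> : c j * lam j ^+ 2 * (`|x| ^+ 2 * expR (L * `|x|)) =
  c j * ((lam j * x) ^+ 2 * expR (L * `|x|)).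
  by rewrite real_normK ?num_real//; ring.
rewrite normrM (ger0_norm (c0 j)) ler_wpM2l//.
by apply: le_trans (expR_sub2_le _) _; rewrite ler_wpM2l ?sqr_ge0.
Qed.

Let d2 x : `|expsum x - S0 - S1 * x - S2 * x ^+ 2 / 2| <=
  L * S2 * `|x| ^+ 3 * expR (L * `|x|).
Proof.
rewrite /expsum /S0 /S1 /S2 !mulr_suml -!sumrB mulr_sumr !mulr_suml.
apply: le_trans (ler_norm_sum _ _ _) _; apply: ler_sum => j _.
have -> : c j * expR (lam j * x) - c j - c j * lam j * x - c j * lam j ^+ 2 * x ^+ 2 / 2
  = c j * (expR (lam j * x) - 1 - lam j * x - (lam j * x) ^+ 2 / 2) by field.
have -> : L * (c j * lam j ^+ 2) * `|x| ^+ 3 * expR (L * `|x|) =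
  c j * (L * `|lam j| ^+ 2 * `|x| ^+ 3 * expR (L * `|x|)).
  by rewrite (real_normK (num_real (lam j))); ring.
rewrite normrM (ger0_norm (c0 j)) ler_wpM2l//.
apply: le_trans (expR_sub3_le _) _; rewrite ler_pM ?exprn_ge0 ?expR_ge0//.
rewrite normrM exprMn ler_wpM2r ?exprn_ge0// exprS ler_wpM2r ?exprn_ge0//.
Qed.

Let D := 1 + S0.
Let D0 : 0 < D. Proof. by rewrite /D ltr_pwDl. Qed.

Let expN (x : R) j : 1 <= expR (L * `|x|) * expR (lam j * x).
Proof.
rewrite -expRD one_le_expR//.
by have := lamx x j; rewrite ler_norml => /andP[]; lra.
Qed.

Let E_ge1 (x : R) : 1 <= expR (L * `|x|).
Proof.
by rewrite one_le_expR// mulr_ge0.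
Qed.

Let lb (x : R) : D <= expR (L * `|x|) * (1 + expsum x).
Proof.
rewrite mulrDr mulr1 lerD// mulr_sumr; apply: ler_sum => j _.
by rewrite mulrCA -[leLHS]mulr1 ler_wpM2l.
Qed.

Let ub (x : R) : 1 + expsum x <= expR (L * `|x|) * D.
Proof.
rewrite mulrDr mulr1 lerD// mulr_sumr; apply: ler_sum => j _.
by rewrite mulrC ler_wpM2r// (le_trans _ (expE x j))// ler_expR ler_norm.
Qed.

Let lb2 (x : R) : S2 <= expR (L * `|x|) * expsum2 x.
Proof.
rewrite mulr_sumr; apply: ler_sum => j _.
by rewrite [leRHS]mulrCA -[leLHS]mulr1 ler_wpM2l// mulr_ge0 ?sqr_ge0.
Qed.

Let V0 : expsum2 0 / (1 + expsum 0) ^+ 2 = S2 / D ^+ 2.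
Proof.
have -> : expsum2 0 = S2.
  by apply: eq_bigr => j _; rewrite mulr0 expR0 mulr1.
have -> : expsum 0 = S0 by apply: eq_bigr => j _; rewrite mulr0 expR0 mulr1.
by [].
Qed.

(** Every exponential lies between the inverse of [expR (L * |x|)] and that number itself. The
    numerator costs one such factor and the squared denominator two, whence the 3. *)
Lemma logistic_variance_stable (x : R) :
  expsum2 0 / (1 + expsum 0) ^+ 2 <=
  expR (3 * L * `|x|) * (expsum2 x / (1 + expsum x) ^+ 2).
Proof.
rewrite V0; set E := expR (L * `|x|).
have -> : expR (3 * L * `|x|) = E ^+ 3.
  by rewrite -expRM_natl; congr expR; ring.
have Ep : 0 < E by exact: expR_gt0.
have Dx : 0 < 1 + expsum x by rewrite ltr_pwDl// expsum_ge0.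
rewrite mulrA ler_pdivrMr ?exprn_gt0// mulrAC ler_pdivlMr ?exprn_gt0//.
apply: (@le_trans _ _ (E * expsum2 x * (E * D) ^+ 2)).
  by rewrite ler_pM ?exprn_ge0 ?lb2 ?(ltW Dx)// lerXn2r ?nnegrE ?(ltW Dx) ?mulr_ge0 ?ub ?(ltW D0) ?(ltW Ep).
by rewrite (_ : _ * _ ^+ 2 = E ^+ 3 * expsum2 x * D ^+ 2) ?mulrA//; ring.
Qed.

(* The last factor is the second moment of [lam] under the softmax weights; it
   is what keeps the sum over the coordinates bounded. *)
Lemma logistic_taylor : exists h1 h2 : R, forall x : R,
  `|(1 + expsum x)^-1 - ((1 + expsum 0)^-1 + h1 * x + h2 * x ^+ 2)| <=
  4 * L * `|x| ^+ 3 * expR (4 * L * `|x|) * (expsum2 0 / (1 + expsum 0) ^+ 2).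
Proof.
(* The Taylor coefficients of the inverse of [1 + expsum] at 0. *)
exists (- S1 / D ^+ 2), (- S2 / (2 * D ^+ 2) + S1 ^+ 2 / D ^+ 3) => x.
rewrite V0; have -> : expsum 0 = S0.
  by apply: eq_bigr => j _; rewrite mulr0 expR0 mulr1.
rewrite -/D; set E := expR (L * `|x|).
have -> : expR (4 * L * `|x|) = E ^+ 4.
  by rewrite -expRM_natl; congr expR; ring.
have Ep : 0 < E by exact: expR_gt0.
have E1 : 1 <= E by exact: E_ge1.
have Dx : 0 < 1 + expsum x by rewrite ltr_pwDl// expsum_ge0.
pose u := expsum x - S0; pose tau := u - S1 * x.
pose rho := tau - S2 * x ^+ 2 / 2.
have sE : 1 + expsum x = D + u by rewrite /u /D; ring.
(* An exact splitting of the remainder: the inverse of [D + u] is expanded to second order in [u],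
   and [u] is compared with its own expansion. Each of the three terms is of third order in [x] and
   keeps a factor [S2]; they contribute 1, 2 and 1 times [K], whence the constant 4. *)
have -> : (1 + expsum x)^-1 - (D^-1 + - S1 / D ^+ 2 * x +
      (- S2 / (2 * D ^+ 2) + S1 ^+ 2 / D ^+ 3) * x ^+ 2) =
    - rho / D ^+ 2 + tau * (u + S1 * x) / D ^+ 3 - u ^+ 3 / (D ^+ 3 * (1 + expsum x)).
  rewrite /rho /tau sE; field.
  by rewrite -sE !gt_eqF.
have Lx0 : 0 <= L * `|x| by rewrite mulr_ge0.
have SD : S0 <= D by rewrite /D; lra.
have uE : `|u| <= L * `|x| * D * E.
  apply: le_trans (d0 x) _; rewrite ler_wpM2r ?(ltW Ep)//.
  rewrite -mulrA mulrCA ler_wpM2l//.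
  by apply: le_trans S1aS0 _; rewrite ler_wpM2l.
have rhoE : `|rho| <= L * S2 * `|x| ^+ 3 * E by exact: d2.
have tauE : `|tau| <= S2 * `|x| ^+ 2 * E by exact: d1.
have S1E : `|S1 * x| <= L * `|x| * D * E.
  rewrite normrM (@le_trans _ _ (L * D * `|x|))//.
    rewrite ler_wpM2r// (le_trans S1_le)// (le_trans S1aS0)//.
    by rewrite ler_wpM2l.
  by rewrite mulrAC ler_peMr// !mulr_ge0// ltW.
have u2E : u ^+ 2 <= `|x| ^+ 2 * D * S2 * E ^+ 2.
  rewrite -(real_normK (num_real u)) (@le_trans _ _ ((`|x| * S1a * E) ^+ 2))//.
    by rewrite lerXn2r ?nnegrE ?d0// !mulr_ge0// ltW.
  rewrite !exprMn ler_wpM2r ?exprn_ge0 ?(ltW Ep)// -[leRHS]mulrA ler_wpM2l ?exprn_ge0//.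
  by apply: le_trans cauchy _; rewrite ler_wpM2r.
have E4 k : (k <= 4)%N -> E ^+ k <= E ^+ 4 by move=> k4; rewrite ler_weXn2l.
pose K := L * `|x| ^+ 3 * E ^+ 4 * (S2 / D ^+ 2).
have T1 : `|rho / D ^+ 2| <= K.
  rewrite /K mulrA normrM normfV (ger0_norm (exprn_ge0 2 (ltW D0))).
  rewrite ler_wpM2r ?invr_ge0 ?exprn_ge0 ?(ltW D0)//.
  apply: le_trans rhoE _.
  rewrite [leLHS](_ : _ = L * `|x| ^+ 3 * S2 * E ^+ 1); last by ring.
  rewrite [leRHS](_ : _ = L * `|x| ^+ 3 * S2 * E ^+ 4); last by ring.
  by rewrite ler_wpM2l ?E4// !mulr_ge0 ?exprn_ge0.
have T2 : `|tau * (u + S1 * x) / D ^+ 3| <= 2 * K.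
  rewrite /K normrM normfV (ger0_norm (exprn_ge0 3 (ltW D0))) normrM.
  rewrite ler_pdivrMr ?exprn_gt0//.
  apply: (@le_trans _ _ (S2 * `|x| ^+ 2 * E * (2 * (L * `|x| * D * E)))).
    rewrite ler_pM//; apply: le_trans (ler_normD _ _) _.
    by move: uE S1E; lra.
  rewrite [leLHS](_ : _ = 2 * L * `|x| ^+ 3 * S2 * D * E ^+ 2); last by ring.
  rewrite [leRHS](_ : _ = 2 * L * `|x| ^+ 3 * S2 * D * E ^+ 4); last first.
    by field; rewrite gt_eqF.
  by rewrite ler_wpM2l ?E4// !mulr_ge0 ?exprn_ge0// ltW.
have T3 : `|u ^+ 3 / (D ^+ 3 * (1 + expsum x))| <= K.
  have P0 : 0 < D ^+ 3 * (1 + expsum x) by rewrite mulr_gt0 ?exprn_gt0.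
  rewrite /K normrM normfV (ger0_norm (ltW P0)) ler_pdivrMr//.
  rewrite exprS normrM (ger0_norm (sqr_ge0 u)).
  apply: (@le_trans _ _ (L * `|x| * D * E * (`|x| ^+ 2 * D * S2 * E ^+ 2))).
    by rewrite ler_pM// sqr_ge0.
  rewrite [leRHS](_ : _ =
      L * `|x| ^+ 3 * S2 * D * E ^+ 3 * (E * (1 + expsum x))); last first.
    by field; rewrite gt_eqF.
  rewrite [leLHS](_ : _ = L * `|x| ^+ 3 * S2 * D * E ^+ 3 * D); last by ring.
  by rewrite ler_wpM2l ?lb// !mulr_ge0 ?exprn_ge0// ltW.
have -> : 4 * L * `|x| ^+ 3 * E ^+ 4 * (S2 / D ^+ 2) = K + 2 * K + K by rewrite /K; ring.
apply: le_trans (ler_normB _ _) _; rewrite lerD//.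
apply: le_trans (ler_normD _ _) _; rewrite lerD//.
by rewrite mulNr normrN.
Qed.
End logistic_softmax.

(** * Standardized laws and the integration of Taylor remainders *)

Section standardized_laws.
Context {R : realType}.
Local Notation TR := (measurableTypeR R).
Local Notation law := (probability TR R).

(** The last clause is the integrated shape of the remainder in [logistic_taylor], with [rho] an
    upper bound for [4 * L]. *)
Definition standardized (mu : law) (rho m : R) :=
  [/\ mu.-integrable setT (EFin \o (fun x : TR => x : R)),
      mu.-integrable setT (EFin \o (fun x : TR => (x : R) ^+ 2)),
      \int[mu]_x (x : R) = 0, \int[mu]_x ((x : R) ^+ 2) = 1 &
      (\int[mu]_x (`|x : R| ^+ 3 * expR (rho * `|x : R|))%:E <= m%:E)%E].

Lemma measurable_cubexp rho :
  measurable_fun [set: TR] (fun x : TR => `|x : R| ^+ 3 * expR (rho * `|x : R|)).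
Proof.
apply: measurable_funM; first by apply: measurable_funX; exact: normr_measurable.
apply: measurableT_comp => //; apply: measurable_funM => //.
Qed.

Lemma standardized_integrable mu rho m : standardized mu rho m ->
  mu.-integrable setT
    (EFin \o (fun x : TR => `|x : R| ^+ 3 * expR (rho * `|x : R|))).
Proof.
move=> [_ _ _ _ h]; apply/integrableP; split.
  by apply/measurable_EFinP; exact: measurable_cubexp.
apply: le_lt_trans (ltry m); apply: le_trans h.
rewrite le_eqVlt; apply/orP; left; apply/eqP; apply: eq_integral => x _ /=.
by rewrite ger0_norm// mulr_ge0 ?exprn_ge0 ?expR_ge0.
Qed.

Lemma standardized_quadratic mu rho m (h0 h1 h2 : R) : standardized mu rho m ->
  let p := fun x : TR => h0 + h1 * (x : R) + h2 * (x : R) ^+ 2 in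
  mu.-integrable setT (EFin \o p) /\ \int[mu]_x p x = h0 + h2.
Proof.
move=> [I1 I2 E1 E2 _] p.
have i0 : mu.-integrable [set: TR] (EFin \o (fun _ : TR => h0)).
  exact: (@bounded_integrable _ _ _ _ _ `|h0|).
have i1 : mu.-integrable [set: TR] (EFin \o (fun x : TR => h1 * (x : R))).
  exact: (integrableZl measurableT h1 I1).
have i2 : mu.-integrable [set: TR] (EFin \o (fun x : TR => h2 * (x : R) ^+ 2)).
  exact: (integrableZl measurableT h2 I2).
have i01 : mu.-integrable [set: TR] (EFin \o (fun x : TR => h0 + h1 * (x : R))).
  exact: (integrableD measurableT i0 i1).
split; first exact: (integrableD measurableT i01 i2).
rewrite /p RintegralD// RintegralD// !RintegralZl// E1 E2 mulr0 mulr1 addr0.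
by rewrite Rintegral_prob_cst.
Qed.

(** Mean 0 and variance 1 fix the integral of the quadratic part as [h0 + h2], whatever the law. Two
    standardized laws therefore integrate [g] to nearly the same value. *)
Lemma standardized_taylor mu rho m (g : TR -> R) (h0 h1 h2 K : R) :
  standardized mu rho m -> 0 <= K ->
  measurable_fun [set: TR] g -> (forall x, 0 <= g x <= 1) ->
  (forall x : R, `|g x - (h0 + h1 * x + h2 * x ^+ 2)| <=
     K * (`|x| ^+ 3 * expR (rho * `|x|))) ->
  `|\int[mu]_x g x - (h0 + h2)| <= K * m.
Proof.
move=> smu K0 mg g01 gT.
have [Ip <-] := standardized_quadratic h0 h1 h2 smu.
have I3 := standardized_integrable smu.
have Ig : mu.-integrable [set: TR] (EFin \o g).
  apply: (@bounded_integrable _ _ _ _ _ 1) => // x.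
  by have /andP[? ?] := g01 x; rewrite ger0_norm.
rewrite -RintegralB//.
apply: le_trans (le_normr_Rintegral measurableT (integrableB measurableT Ig Ip)) _.
apply: (@le_trans _ _ (\int[mu]_x (K * (`|x : R| ^+ 3 * expR (rho * `|x : R|))))).
  apply: le_Rintegral => //.
  - exact: (integrable_norm (integrableB measurableT Ig Ip)).
  - exact: (integrableZl measurableT K I3).
rewrite RintegralZl// ler_wpM2l//.
have [_ _ _ _ h] := smu.
rewrite -lee_fin /Rintegral fineK//.
exact: integrable_fin_num.
Qed.

(** From [expR (- 3 * L * |x|) >= 1 - 3 * L * |x|] and [2 * |x| <= 1 + x ^+ 2], integration against
    a law of variance 1 leaves the factor [1 - 3 * L], which is at least 1/2 for [L <= 6^-1]. *)
Lemma standardized_expN mu rho m (L : R) (g : TR -> R) (v : R) :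
  standardized mu rho m -> 0 <= L -> L <= 6^-1 -> 0 <= v ->
  measurable_fun [set: TR] g -> (exists C, forall x, 0 <= g x <= C) ->
  (forall x : R, v <= expR (3 * L * `|x|) * g x) ->
  v <= 2 * \int[mu]_x g x.
Proof.
move=> smu L0 L6 v0 mg [C gC] vg.
pose p := fun x : TR => v * (1 - 3 * L / 2) + 0 * (x : R) + (- v * 3 * L / 2) * (x : R) ^+ 2.
have [Ip Ep] := standardized_quadratic (v * (1 - 3 * L / 2)) 0 (- v * 3 * L / 2) smu.
suff : \int[mu]_x p x <= \int[mu]_x g x.
  rewrite Ep; have : v * L <= v * 6^-1 by rewrite ler_wpM2l.
  lra.
apply: le_Rintegral => //.
  apply: (@bounded_integrable _ _ _ _ _ C) => // x.
  by have /andP[? ?] := gC x; rewrite ger0_norm.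
move=> x _; rewrite /p.
apply: (@le_trans _ _ (v * expR (- (3 * L * `|x : R|)))); last first.
  by rewrite expRN ler_pdivrMr ?expR_gt0// mulrC vg.
have := expR_ge1Dx (- (3 * L * `|x : R|)).
have : 0 <= (`|x : R| - 1) ^+ 2 by exact: sqr_ge0.
rewrite sqrrB1 (real_normK (num_real (x : R))) => sq e1.
apply: (@le_trans _ _ (v * (1 - (3 * L * `|x : R|)))); last by rewrite ler_wpM2l.
have : 0 <= (v * L) * ((x : R) ^+ 2 - `|x : R| *+ 2 + 1) by rewrite !mulr_ge0.
lra.
Qed.

End standardized_laws.

(** * The smoothed indicator of a polyhedron *)

Section smoothed_maximum.
Context {R : realType}.
Local Notation TR := (measurableTypeR R).
Local Notation law := (probability TR R).
Local Notation vec n := (n.-tuple TR).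
Variables (n : nat) (J : finType) (a : J -> nat -> R) (b : J -> R).
Variables (kappa beta q : R).
Hypotheses (kappa0 : 0 <= kappa) (beta0 : 0 <= beta).
Hypothesis a_kappa : forall j k, `|a j k| <= kappa.
Hypothesis a_unit : forall j, \sum_(k < n) a j k ^+ 2 <= 1.

Definition linform j (w : vec n) : R := \sum_(k < n) a j k * (tnth w k : R).

Definition softweight j w : R := expR (beta * (linform j w - b j - q)).

Definition softmax_below w : R := (1 + \sum_j softweight j w)^-1.

(** The quotient of [expsum2] by the squared [1 + expsum] that bounds the Taylor remainder. It is
    [softmax_below w] times the uncentred second moment of [beta * a j k] under the weights
    [softweight j w * softmax_below w], whose total is at most 1. *)
Definition coord_variance (k : nat) w : R :=
  (\sum_j softweight j w * (beta * a j k) ^+ 2) * softmax_below w ^+ 2.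

Lemma measurable_linform j : measurable_fun [set: vec n] (linform j).
Proof.
apply: measurable_sum => k; apply: measurable_funM => //.
exact: (@measurable_tnth _ TR n k).
Qed.

Lemma measurable_softweight j : measurable_fun [set: vec n] (softweight j).
Proof.
apply: measurableT_comp => //; apply: measurable_funM => //.
by do 2 apply: measurable_funB => //; exact: measurable_linform.
Qed.

Lemma softweight_ge0 j w : 0 <= softweight j w.
Proof. exact: expR_ge0. Qed.

Let S0 w : 0 <= \sum_j softweight j w.
Proof. by apply: sumr_ge0 => j _; exact: softweight_ge0. Qed.

Lemma softmax_below01 w : 0 <= softmax_below w <= 1.
Proof. by rewrite invr_ge0 addr_ge0//= invf_le1 ?ltr_pwDl// lerDl. Qed.

Lemma measurable_softmax_below : measurable_fun [set: vec n] softmax_below.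
Proof.
(* Truncation at 0 makes [h] monotone on the whole line, hence measurable, without changing it on
   sums of weights. *)
pose h := fun s : R => (1 + Num.max 0 s)^-1.
apply: (eq_measurable_fun (h \o (fun w => \sum_j softweight j w))).
  by move=> w _ /=; rewrite /h max_r.
apply: measurableT_comp; last first.
  by apply: measurable_sum => j; exact: measurable_softweight.
have hle (s t : R) : 0 <= s -> 0 <= t -> s <= t -> (1 + t)^-1 <= (1 + s)^-1.
  by move=> s0 t0 st; rewrite lef_pV2 ?posrE ?ltr_pwDl// lerD2l.
apply: nonincreasing_measurable => // s t st.
by apply: hle; [rewrite le_max lexx|rewrite le_max lexx|rewrite ge_max !le_max lexx st orbT].
Qed.

Lemma linform_tset j w (i : 'I_n) x :
  linform j (tset w i x) = linform j (tset w i 0) + a j i * (x : R).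
Proof.
rewrite /linform (bigD1 i)//= [in RHS](bigD1 i)//= !tnth_mktuple eqxx mulr0 add0r addrC.
congr +%R; apply: eq_bigr => k ki; rewrite !tnth_mktuple.
by rewrite -val_eqE /= in ki; rewrite (negbTE ki).
Qed.

Lemma measurable_coord_variance k : measurable_fun [set: vec n] (coord_variance k).
Proof.
apply: measurable_funM.
  apply: measurable_sum => j; apply: measurable_funM => //.
  exact: measurable_softweight.
by apply: measurable_funX; exact: measurable_softmax_below.
Qed.

Let sum_softmax w : (\sum_j softweight j w) * softmax_below w ^+ 2 <= 1.
Proof.
have /andP[f0 f1] := softmax_below01 w.
rewrite expr2 mulrA mulr_ile1// ?mulr_ge0//.
by rewrite ler_pdivrMr ?ltr_pwDl// mul1r lerDr.
Qed.

Lemma coord_variance_bound k w : 0 <= coord_variance k w <= (beta * kappa) ^+ 2.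
Proof.
rewrite mulr_ge0 ?exprn_ge0 ?(andP (softmax_below01 w)).1//=; last first.
  by apply: sumr_ge0 => j _; rewrite mulr_ge0 ?softweight_ge0 ?sqr_ge0.
rewrite -[leRHS]mulr1 (le_trans _ (ler_wpM2l (sqr_ge0 _) (sum_softmax w)))//.
rewrite [leRHS]mulrA ler_wpM2r ?sqr_ge0// mulr_sumr; apply: ler_sum => j _.
rewrite mulrC ler_wpM2r ?softweight_ge0// -(real_normK (num_real (beta * a j k))).
rewrite lerXn2r ?nnegrE ?mulr_ge0// normrM (ger0_norm beta0) ler_wpM2l//.
Qed.

Lemma sum_coord_variance w : \sum_(i < n) coord_variance i w <= beta ^+ 2.
Proof.
rewrite -mulr_suml exchange_big/=.
rewrite -[leRHS]mulr1 (le_trans _ (ler_wpM2l (sqr_ge0 _) (sum_softmax w)))//.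
rewrite [leRHS]mulrA ler_wpM2r ?sqr_ge0// mulr_sumr; apply: ler_sum => j _.
rewrite -mulr_sumr mulrC ler_wpM2r ?softweight_ge0//.
under eq_bigr do rewrite exprMn.
by rewrite -mulr_sumr -[leRHS]mulr1 ler_wpM2l ?sqr_ge0.
Qed.

Section one_coordinate.
Variables (w : vec n) (i : 'I_n).
Let c j := softweight j (tset w i 0).
Let lam j := beta * a j i.
Let L := beta * kappa.

Let L0 : 0 <= L. Proof. exact: mulr_ge0. Qed.
Let c0 j : 0 <= c j. Proof. exact: softweight_ge0. Qed.
Let lamL j : `|lam j| <= L.
Proof. by rewrite /lam normrM (ger0_norm beta0) ler_wpM2l. Qed.

Lemma softweight_tset j x :
  softweight j (tset w i x) = c j * expR (lam j * (x : R)).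
Proof.
by rewrite /c /softweight -expRD linform_tset; congr expR; rewrite /lam; ring.
Qed.

Lemma softmax_below_tset x :
  softmax_below (tset w i x) = (1 + expsum c lam (x : R))^-1.
Proof.
by rewrite /softmax_below; under eq_bigr do rewrite softweight_tset.
Qed.

Lemma coord_variance_tset x : coord_variance i (tset w i x) =
  expsum2 c lam (x : R) / (1 + expsum c lam (x : R)) ^+ 2.
Proof.
rewrite /coord_variance softmax_below_tset exprVn; congr (_ / _).
by apply: eq_bigr => j _; rewrite softweight_tset mulrAC.
Qed.

(** Both integrals lie within [4 * L * v * m] of the same number, where [v] is the variance at the
    value 0 of the coordinate. By stability, [v] is at most twice the mean variance under any
    standardized law; the constants multiply to 16. Taking [lambda] to be [mu] or [nu] gives the two
    swap hypotheses of the replacement scheme. *)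
Lemma swap_softmax mu nu lambda rho m : L <= 6^-1 -> 4 * L <= rho -> 0 <= m ->
  standardized mu rho m -> standardized nu rho m -> standardized lambda rho m ->
  `|\int[nu]_x softmax_below (tset w i x) - \int[mu]_x softmax_below (tset w i x)|
  <= 16 * L * m * \int[lambda]_x coord_variance i (tset w i x).
Proof.
move=> L6 Lrho m0 smu snu sla.
have [h1 [h2 T]] := logistic_taylor L0 c0 lamL.
set v := expsum2 c lam 0 / (1 + expsum c lam 0) ^+ 2 in T.
have v0 : 0 <= v.
  by have /andP[] := coord_variance_bound i (tset w i 0); rewrite coord_variance_tset.
have K0 : 0 <= 4 * L * v by rewrite mulr_ge0// mulr_ge0.
have bd (mu' : law) : standardized mu' rho m ->
    `|\int[mu']_x softmax_below (tset w i x) - ((1 + expsum c lam 0)^-1 + h2)|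
    <= 4 * L * v * m.
  move=> smu'; apply: (standardized_taylor (h1 := h1) smu' K0).
  - exact: (measurable_tset_comp measurable_softmax_below).
  - by move=> x; exact: softmax_below01.
  - move=> x; rewrite softmax_below_tset; apply: le_trans (T x) _.
    rewrite (_ : _ * v = 4 * L * v * (`|x| ^+ 3 * expR (4 * L * `|x|))); last by ring.
    by rewrite ler_wpM2l// ler_wpM2l ?exprn_ge0// ler_expR ler_wpM2r.
have vE : v <= 2 * \int[lambda]_x coord_variance i (tset w i x).
  apply: (standardized_expN sla L0 L6 v0).
  - exact: (measurable_tset_comp (measurable_coord_variance i)).
  - by exists ((beta * kappa) ^+ 2) => x; exact: coord_variance_bound.
  - by move=> x; rewrite coord_variance_tset; exact: logistic_variance_stable.
apply: le_trans (ler_distD ((1 + expsum c lam 0)^-1 + h2) _ _) _.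
have := lerD (bd nu snu) (bd mu smu); rewrite [X in _ + X <= _]distrC.
move=> /le_trans; apply.
have -> : 4 * L * v * m + 4 * L * v * m = 8 * L * m * v by ring.
rewrite (_ : 16 * L * m * _ =
  8 * L * m * (2 * \int[lambda]_x coord_variance i (tset w i x))); last by ring.
by rewrite ler_wpM2l// !mulr_ge0.
Qed.

End one_coordinate.

Lemma softmax_comparison mu nu rho m : beta * kappa <= 6^-1 ->
  4 * (beta * kappa) <= rho -> 0 <= m ->
  standardized mu rho m -> standardized nu rho m ->
  `|\int[prod_law n (fun=> nu)]_w softmax_below w -
    \int[prod_law n (fun=> mu)]_w softmax_below w| <=
  16 * m * beta ^+ 3 * kappa.
Proof.
move=> L6 Lrho m0 smu snu.
have swap0 i w : ~~ (i < n)%N ->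
  `|\int[nu]_x softmax_below (tset w i x) - \int[mu]_x softmax_below (tset w i x)| = 0.
  move=> ni.
  have E x : softmax_below (tset w i x) = softmax_below w.
    congr softmax_below; apply: eq_from_tnth => k; rewrite tnth_mktuple.
    by case: eqP => // ki; move: ni; rewrite -ki ltn_ord.
  under eq_Rintegral do rewrite E.
  under [X in _ - X]eq_Rintegral do rewrite E.
  by rewrite !Rintegral_prob_cst subrr normr0.
have -> : 16 * m * beta ^+ 3 * kappa = 16 * (beta * kappa) * m * beta ^+ 2 by ring.
(* Beyond the last coordinate a swap has no effect, so the variance is set to 0 there. *)
apply: (@replacement_bound _ n mu nu softmax_below
  (fun k w => if (k < n)%N then coord_variance k w else 0) _ _
  ((beta * kappa) ^+ 2)) => //.
- exact: measurable_softmax_below.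
- exact: softmax_below01.
- by move=> i; case: (i < n)%N => //; exact: measurable_coord_variance.
- by move=> i w; case: ifP => _; rewrite ?coord_variance_bound// lexx sqr_ge0.
- by rewrite !mulr_ge0.
- move=> i w; have [ni|ni] := boolP (i < n)%N; last by rewrite swap0// !mulr_ge0// Rintegral_ge0.
  exact: (swap_softmax w (Ordinal ni) L6 Lrho m0 smu snu smu).
- move=> i w; have [ni|ni] := boolP (i < n)%N; last by rewrite swap0// !mulr_ge0// Rintegral_ge0.
  exact: (swap_softmax w (Ordinal ni) L6 Lrho m0 smu snu snu).
- move=> w; rewrite (le_trans _ (sum_coord_variance w))//; apply: ler_sum => i _.
  by rewrite ltn_ord.
Qed.

End smoothed_maximum.

(** * Comparison of the probabilities of polyhedra *)

Section below_events.
Context {R : realType}.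
Local Notation TR := (measurableTypeR R).
Local Notation law := (probability TR R).
Local Notation vec n := (n.-tuple TR).

Definition below n (J : finType) (a : J -> nat -> R) (b : J -> R) (q : R)
    : set (vec n) := [set w | forall j, linform a j w - b j <= q].

Lemma measurable_below n J a b q : measurable (@below n J a b q).
Proof.
have -> : @below n J a b q =
    \bigcap_(j in [set: J]) ((@linform R n J a j) @^-1` `]-oo, q + b j]).
  apply/seteqP; split=> [w h j _|w h j]; have := h j;
    rewrite /= in_itv/= lerBlDr//; exact.
apply: fin_bigcap_measurable => // j _; rewrite -[X in measurable X]setTI.
exact: (@measurable_linform R n J a j measurableT _ (measurable_itv `]-oo, q + b j])).

Qed.

Lemma Rintegral_indic_prob d (T : measurableType d) (P : probability T R) A :
  measurable A -> \int[P]_x (\1_A x : R) = fine (P A).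
Proof.
by move=> mA; rewrite /Rintegral integral_indic// setIT.
Qed.

Lemma bounded_le_Rintegral d (T : measurableType d) (P : probability T R)
    (f g : T -> R) (C : R) :
  measurable_fun [set: T] f -> (forall x, 0 <= f x <= C) ->
  measurable_fun [set: T] g -> (forall x, 0 <= g x <= C) ->
  forall e, (forall x, f x <= g x + e) -> \int[P]_x f x <= \int[P]_x g x + e.
Proof.
move=> mf fC mg gC e fg.
have I (h : T -> R) : measurable_fun [set: T] h -> (forall x, 0 <= h x <= C) ->
    P.-integrable [set: T] (EFin \o h).
  move=> mh hC; apply: (@bounded_integrable _ _ _ _ _ C) => // x.
  by have /andP[? ?] := hC x; rewrite ger0_norm.
have Ie : P.-integrable [set: T] (EFin \o (fun _ : T => e)).
  exact: (@bounded_integrable _ _ _ _ _ `|e|).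
rewrite -[X in _ + X](Rintegral_prob_cst P) -RintegralD//; [|exact: (I _ mg gC)].
apply: le_Rintegral => //; [exact: (I _ mf fC)|].
exact: (integrableD measurableT (I _ mg gC) Ie).
Qed.

(** The smooth function is centred at the level [q + e / 2]. Where all values are at most [q], each
    weight is at most [expR (- (beta * e / 2))], so the function is within [#|J|] such terms of 1.
    Where some value exceeds [q + e], one weight is at least the inverse, so the function is at most
    one such term. The opposite inequality follows by exchanging [mu] and [nu]. *)
Lemma below_comparison n (J : finType) (a : J -> nat -> R) (b : J -> R)
    (kappa beta q e rho m : R) (mu nu : law) :
  0 <= kappa -> 0 <= beta -> (forall j k, `|a j k| <= kappa) ->
  (forall j, \sum_(k < n) a j k ^+ 2 <= 1) ->
  beta * kappa <= 6^-1 -> 4 * (beta * kappa) <= rho -> 0 <= m -> 0 <= e ->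
  standardized mu rho m -> standardized nu rho m ->
  fine (prod_law n (fun=> nu) (below a b q)) <=
  fine (prod_law n (fun=> mu) (below a b (q + e))) +
    (16 * m * beta ^+ 3 * kappa + #|J|.+1%:R * expR (- (beta * e / 2))).
Proof.
move=> k0 b0 ak au L6 Lr m0 e0 smu snu.
pose f := @softmax_below R n J a b beta (q + e / 2).
have mf : measurable_fun [set: vec n] f by exact: measurable_softmax_below.
have f01 w : 0 <= f w <= 1 by exact: softmax_below01.
have mB t := @measurable_below n J a b t.
have i01 t w : 0 <= (\1_(@below n J a b t) w : R) <= 1.
  by rewrite indicE; case: (_ \in _); rewrite ?lexx ler01.
have := softmax_comparison b (q + e / 2) k0 b0 ak au L6 Lr m0 smu snu.
rewrite -/f ler_distl => /andP[_ cmp].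
set E := expR (- (beta * e / 2)).
have E0 : 0 <= E by exact: expR_ge0.
have S0 w : 0 <= \sum_j @softweight R n J a b beta (q + e / 2) j w.
  by apply: sumr_ge0 => j _; exact: expR_ge0.
have low : fine (prod_law n (fun=> nu) (below a b q)) <=
    \int[prod_law n (fun=> nu)]_w f w + #|J|%:R * E.
  rewrite -Rintegral_indic_prob//.
  apply: (@bounded_le_Rintegral _ _ _ _ _ 1) => // w.
  rewrite indicE; have [/set_mem wq|_] := boolP (w \in _); last first.
    by rewrite addr_ge0 ?mulr_ge0//; have /andP[] := f01 w.
  have SE : \sum_j @softweight R n J a b beta (q + e / 2) j w <= #|J|%:R * E.
    rewrite mulr_natl -sumr_const; apply: ler_sum => j _.
    rewrite ler_expR -mulrA -mulrN ler_wpM2l//.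
    by have := wq j; lra.
  rewrite -lerBlDr /f /softmax_below -[leRHS]div1r ler_pdivlMr ?ltr_pwDl//.
  have := mulr_ge0 (S0 w) (S0 w); set s := \sum_j _ in SE *; move=> _.
  have s0 : 0 <= s by exact: S0.
  have : 0 <= (#|J|%:R * E) * s by rewrite !mulr_ge0.
  by rewrite -[true%:R]/(1 : R); lra.
have up : \int[prod_law n (fun=> mu)]_w f w <=
    fine (prod_law n (fun=> mu) (below a b (q + e))) + E.
  rewrite -Rintegral_indic_prob//.
  apply: (@bounded_le_Rintegral _ _ _ _ _ 1) => // w.
  rewrite indicE; have [_|/negP wq] := boolP (w \in _).
    by have /andP[_ f1] := f01 w; rewrite (le_trans f1)// lerDl.
  have [j wj] : exists j, q + e < linform a j w - b j.
    apply: contrapT => h; apply: wq; rewrite inE => j; rewrite leNgt.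
    by apply/negP => hj; apply: h; exists j.
  rewrite add0r /f /softmax_below /E expRN lef_pV2 ?posrE ?expR_gt0 ?ltr_pwDl//.
  rewrite ler_wpDl// (bigD1 j)//= ler_wpDr//.
    by apply: sumr_ge0 => k _; exact: expR_ge0.
  by rewrite ler_expR -mulrA ler_wpM2l//; lra.
rewrite -natr1 mulrDl mul1r; lra.
Qed.

End below_events.

(** * Gaussian and exponential moments *)

Section densities.
Local Open Scope ereal_scope.
Context d (T : measurableType d) (R : realType).
Variables (mu P : {measure set T -> \bar R}) (p : T -> R).
Hypotheses (mp : measurable_fun [set: T] p) (p0 : forall x, (0 <= p x)%R).
Hypothesis PE : forall A, measurable A -> P A = \int[mu]_(x in A) (p x)%:E.

Import HBNNSimple.

Let density_nnsfun (h : {nnsfun T >-> R}) :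
  \int[P]_x (h x)%:E = \int[mu]_x ((h x)%:E * (p x)%:E).
Proof.
under [LHS]eq_integral do rewrite fimfunE -fsumEFin//.
rewrite [LHS]ge0_integral_fsum//; last 2 first.
  - by move=> r; exact/measurable_EFinP/measurableT_comp.
  - by move=> n x _; rewrite EFinM nnfun_muleindic_ge0.
under [RHS]eq_integral.
  move=> x xD; rewrite fimfunE -fsumEFin// muleC ge0_mule_fsumr; last first.
    by move=> r; rewrite EFinM nnfun_muleindic_ge0.
  over.
rewrite [RHS]ge0_integral_fsum//; last 2 first.
  - move=> r; apply: emeasurable_funM; first exact/measurable_EFinP.
    exact/measurable_EFinP/measurableT_comp.
  - move=> n x _; apply: mule_ge0; first by rewrite lee_fin.
    by rewrite EFinM nnfun_muleindic_ge0.
apply: eq_fsbigr => r _.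
have mr : measurable (h @^-1` [set r]) by [].
rewrite integralZl_indic_nnsfun// integral_indic// setIT PE//.
have -> : (fun x => (p x)%:E * (r * \1_(h @^-1` [set r]) x)%:E) =
    (fun x => r%:E * ((p x)%:E * (\1_(h @^-1` [set r]) x)%:E)).
  by apply/funext => x; rewrite EFinM muleCA.
have E : \int[mu]_x ((p x)%:E * (\1_(h @^-1` [set r]) x)%:E) =
    \int[mu]_(x in h @^-1` [set r]) (p x)%:E.
  by rewrite [RHS]integral_mkcond; apply: eq_integral => x _;
    rewrite epatch_indic.
have m1 : measurable_fun [set: T] (fun x => (p x)%:E * (\1_(h @^-1` [set r]) x)%:E).
  by apply: emeasurable_funM; apply/measurable_EFinP => //; exact: measurable_indic.
have [r0|r0] := leP 0%R r.
  rewrite ge0_integralZl// ?E ?lee_fin// => x _.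
  by rewrite mule_ge0 ?lee_fin.
have e0 : h @^-1` [set r] = set0.
  by apply/seteqP; split=> // x /= hx; move: r0; rewrite -hx ltNge fun_ge0.
rewrite e0 integral_set0 mule0 integral0_eq// => x _.
by rewrite indic0 mule0 mule0.
Qed.

(** The model describes [F theta] through its values on measurable sets; this passes to integrals,
    by simple functions and monotone convergence. *)
Lemma ge0_integral_density (f : T -> \bar R) : measurable_fun [set: T] f ->
  (forall x, 0 <= f x) -> \int[P]_x f x = \int[mu]_x (f x * (p x)%:E).
Proof.
move=> mf f0; pose f_ := nnsfun_approx measurableT mf.
transitivity (limn (fun n => \int[P]_x (f_ n x)%:E)).
  rewrite -monotone_convergence//=.
  - apply: eq_integral => x _; apply/esym/cvg_lim => //=.
    exact: cvg_nnsfun_approx.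
  - by move=> n; apply: measurableT_comp => //; exact: measurable_funTS.
  - by move=> n x _; rewrite lee_fin.
  - by move=> x _ a b ab; rewrite lee_fin//; exact/lefP/nd_nnsfun_approx.
rewrite (_ : \int[mu]_x _ = limn (fun n => \int[mu]_x ((f_ n x)%:E * (p x)%:E))).
  by congr (limn _); apply/funext => n; exact: density_nnsfun.
rewrite -monotone_convergence//=.
- apply: eq_integral => x _; apply/esym/cvg_lim => //=.
  by apply: cvgeZr => //; exact: cvg_nnsfun_approx.
- move=> n; apply: emeasurable_funM; exact/measurable_EFinP.
- by move=> n x _; rewrite mule_ge0 ?lee_fin.
- move=> x _ a b ab; rewrite lee_wpmul2r ?lee_fin//.
  exact/lefP/nd_nnsfun_approx.
Qed.

End densities.

(** * Translation of the standard normal law *)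

Section gaussian.
Context {R : realType}.
Local Notation TR := (measurableTypeR R).
Local Notation law := (probability TR R).
Local Notation gauss := (normal_prob (0 : R) 1).
Local Notation leb := (@lebesgue_measure R).

Lemma lebesgue_shift (c : R) (A : set R) : measurable A ->
  pushforward leb (fun x : TR => (x + c : TR)) A = leb A.
Proof.
have mc : measurable_fun [set: TR] (fun x : TR => (x + c : TR)).
  exact: measurable_funD.
move=> mA; apply/esym.
pose hc := isMeasurableFun.Build _ _ _ _ _ mc.
pose fc : {mfun TR >-> TR} := HB.pack (fun x : TR => (x + c : TR)) hc.
apply: (@lebesgue_measure_unique R (pushforward leb fc)) => //= _ [[a b]] _ <-.
rewrite /pushforward.
have -> : fc @^-1` `]a, b] = `](a - c)%R, (b - c)%R]%classic.
  by apply/seteqP; split=> x /=; rewrite !in_itv/= ltrBlDr lerBrDr.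
rewrite !lebesgue_measure_itv/= !lte_fin ltrD2r.
by case: ifP => // _; rewrite -EFinB -EFinB; congr EFin; ring.
Qed.

Lemma ge0_integral_shift (c : R) (f : R -> \bar R) :
  measurable_fun [set: R] f -> (forall x, 0 <= f x)%E ->
  (\int[leb]_x f (x + c)%R = \int[leb]_x f x)%E.
Proof.
move=> mf f0.
have mc : measurable_fun [set: TR] (fun x : TR => (x + c : TR)).
  exact: measurable_funD.
transitivity (\int[pushforward leb (fun x : TR => (x + c : TR)%R)]_x f x)%E.
  by rewrite (ge0_integral_pushforward mc)//.
by apply: eq_measure_integral => A mA _; exact: lebesgue_shift.
Qed.

Lemma ge0_integral_gauss (f : TR -> \bar R) :
  measurable_fun [set: TR] f -> (forall x, 0 <= f x)%E ->
  (\int[gauss]_x f x = \int[leb]_x (f x * (normal_pdf 0 1 x)%:E))%E.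
Proof.
move=> mf f0; apply: ge0_integral_density => //.
- exact: measurable_normal_pdf.
- by move=> x; exact: normal_pdf_ge0.
Qed.

(** The Cameron-Martin formula in dimension one: the exponential is the quotient of the normal
    densities at [x + c] and [x]. *)
Lemma gauss_shift (c : R) (f : TR -> \bar R) :
  measurable_fun [set: TR] f -> (forall x, 0 <= f x)%E ->
  (\int[gauss]_x f ((x : R) - c)%R =
   \int[gauss]_x (f x * (expR (- c * (x : R) - c ^+ 2 / 2))%:E))%E.
Proof.
move=> mf f0.
have mfc : measurable_fun [set: TR] (fun x : TR => f ((x : R) - c)%R).
  apply: measurableT_comp => //; exact: measurable_funB.
have mE : measurable_fun [set: TR] (fun x : TR => expR (- c * (x : R) - c ^+ 2 / 2)).
  apply: measurableT_comp => //; apply: measurable_funB => //; exact: measurable_funM.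
rewrite ge0_integral_gauss// ge0_integral_gauss; last 2 first.
- by apply: emeasurable_funM => //; exact/measurable_EFinP.
- by move=> x; rewrite mule_ge0// lee_fin expR_ge0.
pose g (x : R) := (f (x - c)%R * (normal_pdf 0 1 x)%:E)%E.
rewrite -[LHS](@ge0_integral_shift c g); last 2 first.
- by apply: emeasurable_funM => //; apply/measurable_EFinP; exact: measurable_normal_pdf.
- by move=> x; rewrite mule_ge0// lee_fin normal_pdf_ge0.
rewrite /g.
apply: eq_integral => x _; rewrite addrK -muleA -EFinM.
congr (_ * _%:E)%E; rewrite !normal_pdfE ?oner_neq0// mulrCA; congr (_ * _).
rewrite /normal_fun -expRD; congr expR.
by rewrite !expr1n; field.
Qed.
End gaussian.

(** * Laws with exponential moments *)

Section exponential_moments.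
Context {R : realType}.
Local Notation TR := (measurableTypeR R).
Local Notation law := (probability TR R).
Local Notation vec n := (n.-tuple TR).

Lemma ge0_integrable d (T : measurableType d) (P : {measure set T -> \bar R})
    (f : T -> R) : measurable_fun [set: T] f -> (forall x, 0 <= f x) ->
  (\int[P]_x (f x)%:E < +oo)%E -> P.-integrable [set: T] (EFin \o f).
Proof.
move=> mf f0 h; apply/integrableP; split; first exact/measurable_EFinP.
rewrite (eq_integral (fun x => (f x)%:E))// => x _ /=.
by rewrite ger0_norm.
Qed.

Lemma integrable_dominated d (T : measurableType d) (P : {measure set T -> \bar R})
    (f g : T -> R) : measurable_fun [set: T] f -> (forall x, `|f x| <= g x) ->
  P.-integrable [set: T] (EFin \o g) -> P.-integrable [set: T] (EFin \o f).
Proof.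
move=> mf fg Ig; apply: (le_integrable measurableT _ _ Ig).
  exact/measurable_EFinP.
by move=> x _ /=; rewrite lee_fin (le_trans (fg x))// ler_norm.
Qed.

Definition exp_moment (mu : law) (h : R) : \bar R := (\int[mu]_x (expR (h * (x : R)))%:E)%E.

Lemma measurable_expRM (h : R) : measurable_fun [set: TR] (fun x : TR => expR (h * (x : R))).
Proof. by apply: measurableT_comp => //; exact: measurable_funM. Qed.

Variables (mu : law) (rho : R).
Hypothesis rho0 : 0 < rho.
Hypotheses (Ep : (exp_moment mu (2 * rho) < +oo)%E)
  (En : (exp_moment mu (- (2 * rho)) < +oo)%E).

Lemma integrable_cosh :
  mu.-integrable [set: TR] (EFin \o (fun x : TR => expR (2 * rho * (x : R)) + expR (- (2 * rho) * (x : R)))).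
Proof.
have I h : (exp_moment mu h < +oo)%E ->
    mu.-integrable [set: TR] (EFin \o (fun x : TR => expR (h * (x : R)))).
  move=> ?; apply: ge0_integrable => //; first exact: measurable_expRM.
exact: (integrableD measurableT (I _ Ep) (I _ En)).
Qed.

Lemma cosh_ge (x : R) : expR (2 * rho * `|x|) <= expR (2 * rho * x) + expR (- (2 * rho) * x).
Proof.
have [x0|x0] := leP 0 x; first by rewrite ger0_norm// lerDl expR_ge0.
by rewrite ltr0_norm// mulrN -mulNr lerDr expR_ge0.
Qed.

(** The [k]-th power of [z <= expR z] at [z = y / k]. *)
Lemma pow_le_expR (k : nat) (y : R) : 0 <= y -> y ^+ k <= k%:R ^+ k * expR y.
Proof.
case: k => [|k] y0; first by rewrite !expr0 mul1r one_le_expR.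
have -> : y = k.+1%:R * (y / k.+1%:R) by rewrite mulrC divfK// pnatr_eq0.
rewrite exprMn ler_wpM2l ?exprn_ge0// expRM_natl lerXn2r ?nnegrE ?divr_ge0 ?expR_ge0//.
by move: (y / _) => z; have := expR_ge1Dx z; lra.
Qed.

(** One half of the exponent [2 * rho] absorbs the power, the other half is the exponential
    factor. *)
Lemma integrable_powexp (k : nat) :
  mu.-integrable [set: TR] (EFin \o (fun x : TR => `|x : R| ^+ k * expR (rho * `|x : R|))).
Proof.
apply: (@integrable_dominated _ _ _ _ (fun x : TR => (k%:R ^+ k / rho ^+ k) *
    (expR (2 * rho * (x : R)) + expR (- (2 * rho) * (x : R))))); last first.
- exact: (integrableZl measurableT _ integrable_cosh).
- move=> x; rewrite ger0_norm ?mulr_ge0 ?exprn_ge0 ?expR_ge0//.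
  apply: (@le_trans _ _ (k%:R ^+ k / rho ^+ k * expR (2 * rho * `|x : R|))); last first.
    by rewrite ler_wpM2l ?cosh_ge// divr_ge0// exprn_ge0// ltW.
  rewrite (_ : 2 * rho * _ = rho * `|x : R| + rho * `|x : R|); last by ring.
  rewrite expRD mulrA ler_wpM2r ?expR_ge0// mulrAC ler_pdivlMr ?exprn_gt0//.
  by rewrite -exprMn mulrC pow_le_expR// mulr_ge0// ltW.
apply: measurable_funM; first by apply: measurable_funX; exact: normr_measurable.
by apply: measurableT_comp => //; apply: measurable_funM.
Qed.

Lemma integrable_pow (k : nat) :
  mu.-integrable [set: TR] (EFin \o (fun x : TR => (x : R) ^+ k)).
Proof.
apply: integrable_dominated (integrable_powexp k); first exact: measurable_funX.
move=> x; rewrite normrX -[leLHS]mulr1 ler_wpM2l ?exprn_ge0//.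
by rewrite one_le_expR// mulr_ge0// ltW.
Qed.

Definition cubexp_moment : R := \int[mu]_x (`|x : R| ^+ 3 * expR (rho * `|x : R|)).

Lemma cubexp_moment_ge0 : 0 <= cubexp_moment.
Proof. by apply: Rintegral_ge0 => x _; rewrite mulr_ge0 ?exprn_ge0 ?expR_ge0. Qed.

Lemma integrable_expRM (h : R) : `|h| <= rho ->
  mu.-integrable [set: TR] (EFin \o (fun x : TR => expR (h * (x : R)))).
Proof.
move=> hr; apply: integrable_dominated (integrable_powexp 0).
  exact: measurable_expRM.
move=> x; rewrite expr0 mul1r ger0_norm ?expR_ge0// ler_expR.
by rewrite (le_trans (ler_norm _))// normrM ler_wpM2r.
Qed.

Lemma mgf_taylor (h : R) : `|h| <= rho ->
  `|\int[mu]_x expR (h * (x : R)) -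
    (1 + h * \int[mu]_x (x : R) + h ^+ 2 / 2 * \int[mu]_x ((x : R) ^+ 2))|
  <= `|h| ^+ 3 * cubexp_moment.
Proof.
move=> hr.
have I0 := integrable_expRM hr.
have I1 : mu.-integrable [set: TR] (EFin \o (fun x : TR => h * (x : R))).
  have /(integrableZl measurableT h) := integrable_pow 1.
  by apply: eq_integrable => // x _ /=; rewrite expr1.
have I2 : mu.-integrable [set: TR] (EFin \o (fun x : TR => h ^+ 2 / 2 * (x : R) ^+ 2)).
  exact: (integrableZl measurableT (h ^+ 2 / 2) (integrable_pow 2)).
have I3 : mu.-integrable [set: TR] (EFin \o (fun x : TR => `|h| ^+ 3 *
    (`|x : R| ^+ 3 * expR (rho * `|x : R|)))).
  exact: (integrableZl measurableT (`|h| ^+ 3) (integrable_powexp 3)).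
have Ic : mu.-integrable [set: TR] (EFin \o (fun _ : TR => 1 : R)).
  exact: (@bounded_integrable _ _ _ _ _ `|1|).
have I01 : mu.-integrable [set: TR] (EFin \o (fun x : TR => 1 + h * (x : R))).
  exact: (integrableD measurableT Ic I1).
have I012 : mu.-integrable [set: TR] (EFin \o
    (fun x : TR => 1 + h * (x : R) + h ^+ 2 / 2 * (x : R) ^+ 2)).
  exact: (integrableD measurableT I01 I2).
have ID : mu.-integrable [set: TR] (EFin \o (fun x : TR => expR (h * (x : R)) -
    (1 + h * (x : R) + h ^+ 2 / 2 * (x : R) ^+ 2))).
  exact: (integrableB measurableT I0 I012).
have -> : 1 + h * \int[mu]_x (x : R) + h ^+ 2 / 2 * \int[mu]_x ((x : R) ^+ 2) =
    \int[mu]_x (1 + h * (x : R) + h ^+ 2 / 2 * (x : R) ^+ 2).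
  rewrite RintegralD// RintegralD// !RintegralZl//; last 2 first.
  - exact: integrable_pow.
  - have := integrable_pow 1.
    by apply: eq_integrable => // x _ /=; rewrite expr1.
  by rewrite Rintegral_prob_cst.
rewrite -RintegralB//; apply: le_trans (le_normr_Rintegral measurableT ID) _.
rewrite /cubexp_moment -RintegralZl//; last exact: integrable_powexp.
apply: le_Rintegral => //; first exact: (integrable_norm ID).
move=> x _.
rewrite (_ : _ - _ = expR (h * (x : R)) - 1 - h * (x : R) - (h * (x : R)) ^+ 2 / 2); last first.
  by rewrite exprMn; field.
apply: le_trans (expR_sub3_le _) _.
rewrite normrM exprMn -mulrA ler_wpM2l ?exprn_ge0// ler_wpM2l ?exprn_ge0//.
by rewrite ler_expR ler_wpM2r.
Qed.

Lemma exp_moments_standardized : \int[mu]_x (x : R) = 0 ->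
  \int[mu]_x ((x : R) ^+ 2) = 1 -> standardized mu rho cubexp_moment.
Proof.
move=> E1 E2; split => //.
- have := integrable_pow 1.
  by apply: eq_integrable => // x _ /=; rewrite expr1.
- exact: integrable_pow.
- rewrite /cubexp_moment /Rintegral fineK//.
  by apply: integrable_fin_num => //; exact: integrable_powexp.
Qed.

End exponential_moments.

(** * Moments of the standard normal law *)

Section gaussian_moments.
Context {R : realType}.
Local Notation TR := (measurableTypeR R).
Local Notation law := (probability TR R).
Local Notation gauss := (normal_prob (0 : R) 1 : law).

(** The shift formula for the constant function 1. *)
Lemma gauss_exp_moment (h : R) : exp_moment gauss h = (expR (h ^+ 2 / 2))%:E.
Proof.
have := @gauss_shift R (- h) (cst 1%E) (measurable_cst _) (fun=> lee01).
rewrite integral_cst// mul1e (_ : _ setT = 1%E); last exact: probability_setT.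
under eq_integral do rewrite mul1e opprK sqrrN expRD EFinM.
have mE : measurable_fun [set: TR] (fun x : TR => (expR (h * (x : R)))%:E).
  by apply/measurable_EFinP; exact: measurable_expRM.
have E0 (y : R) : (0 <= (expR y)%:E)%E by rewrite lee_fin expR_ge0.
rewrite (ge0_integralZr _ _ mE)//.
rewrite -/(exp_moment gauss h) expRN => E.
have -> : exp_moment gauss h =
    (exp_moment gauss h * (expR (h ^+ 2 / 2))^-1%:E * (expR (h ^+ 2 / 2))%:E)%E.
  by rewrite -muleA -EFinM mulVf ?mule1// gt_eqF// expR_gt0.
by rewrite -E mul1e.
Qed.

Lemma le_scale_eq0 (x D h0 : R) : 0 < h0 -> 0 <= D ->
  (forall h, 0 < h <= h0 -> x <= h * D) -> x <= 0.
Proof.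
move=> h00 D0 H; rewrite leNgt; apply/negP => x0.
pose h := Num.min h0 (x / (2 * (D + 1))).
have D1 : 0 < 2 * (D + 1) by rewrite mulr_gt0// ltr_wpDl.
have hp : 0 < h by rewrite lt_min h00 divr_gt0.
have /H : 0 < h <= h0 by rewrite hp ge_min lexx.
have hx : h <= x / (2 * (D + 1)) by rewrite ge_min lexx orbT.
have : h * (2 * (D + 1)) <= x by rewrite -ler_pdivlMr.
lra.
Qed.

Lemma quadratic_coef_eq0 (A B C h0 : R) : 0 < h0 -> 0 <= C ->
  (forall h, 0 < h <= h0 -> `|h * A + h ^+ 2 * B| <= C * h ^+ 3) -> A = 0 /\ B = 0.
Proof.
move=> h00 C0 H.
have A0 : A = 0.
  apply/eqP; rewrite -normr_le0; apply: (@le_scale_eq0 _ (`|B| + C * h0) h0) => //.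
    by rewrite addr_ge0// mulr_ge0// ltW.
  move=> h /[dup] /H + /andP[hp hh].
  rewrite (_ : h * A + h ^+ 2 * B = h * (A + h * B)); last by ring.
  rewrite (_ : C * h ^+ 3 = h * (C * h * h)); last by ring.
  rewrite normrM (gtr0_norm hp) ler_pM2l// => E.
  have -> : A = (A + h * B) - h * B by ring.
  apply: le_trans (ler_normB _ _) _.
  rewrite normrM (gtr0_norm hp) mulrDr addrC lerD2l (le_trans E)//.
  by rewrite mulrC ler_pM2l// ler_wpM2l.
split=> //; apply/eqP; rewrite -normr_le0; apply: (@le_scale_eq0 _ C h0) => //.
move=> h /[dup] /H + /andP[hp hh].
rewrite A0 mulr0 add0r normrM (ger0_norm (sqr_ge0 h)).
rewrite (_ : C * h ^+ 3 = h ^+ 2 * (h * C)); last by ring.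
by rewrite ler_pM2l// exprn_gt0.
Qed.

(** Mean and variance are read off the moment generating function: the expansion of
    [expR (h ^+ 2 / 2)] and that of [mgf_taylor] agree up to third order in [h], so their
    coefficients coincide. *)
Lemma gauss_standardized : standardized gauss 1 (cubexp_moment gauss 1).
Proof.
have E2 h : (exp_moment gauss h < +oo)%E by rewrite gauss_exp_moment ltry.
have T h := @mgf_taylor R gauss 1 ltr01 (E2 _) (E2 _) h.
set m1 := \int[gauss]_x (x : R); set m2 := \int[gauss]_x ((x : R) ^+ 2).
have [m1E m2E] : m1 = 0 /\ (m2 - 1) / 2 = 0.
  apply: (@quadratic_coef_eq0 _ _ (cubexp_moment gauss 1 + 1) 1) => //.
    by rewrite addr_ge0// cubexp_moment_ge0.
  move=> h /andP[h0 h1].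
  have := T h; rewrite (gtr0_norm h0) => /(_ h1).
  rewrite -/m1 -/m2 (_ : \int[_]_x expR _ = expR (h ^+ 2 / 2)); last first.
    by rewrite /Rintegral -/(exp_moment gauss h) gauss_exp_moment.
  have := expR_sub2_le (h ^+ 2 / 2).
  have h20 : 0 <= h ^+ 2 / 2 by rewrite divr_ge0// sqr_ge0.
  rewrite (ger0_norm h20).
  have h2 : h ^+ 2 / 2 <= 2^-1.
    by rewrite ler_pdivrMr// mulVf// exprn_ile1// ltW.
  have e2 : expR (h ^+ 2 / 2) <= 4.
    apply: (@le_trans _ _ (expR 2^-1)); first by rewrite ler_expR.
    have : (1 + - 2^-1 : R) <= expR (- 2^-1) by exact: expR_ge1Dx.
    rewrite expRN => e.
    have ep : 0 < expR (2^-1 : R) by exact: expR_gt0.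
    have : (1 - 2^-1) * expR 2^-1 <= 1 :> R by rewrite -ler_pdivlMr// div1r.
    lra.
  set e := expR _ in e2 *.
  have h4 : h ^+ 4 <= h ^+ 3 by rewrite ler_wiXn2l// ltW.
  have h40 : 0 <= h ^+ 4 by rewrite exprn_ge0// ltW.
  have : (h ^+ 2 / 2) ^+ 2 * e <= h ^+ 3.
    rewrite (_ : _ ^+ 2 * e = h ^+ 4 * (e / 4)); last by field.
    rewrite (le_trans _ h4)// ler_piMr//; lra.
  move=> b /le_trans /(_ b); rewrite !ler_norml.
  by move=> /andP[p1 p2] /andP[p3 p4]; apply/andP; split; lra.
apply: exp_moments_standardized; [exact: ltr01|exact: E2|exact: E2|exact: m1E|].
by rewrite -/m2; move: m2E; lra.
Qed.

End gaussian_moments.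

(** * Chernoff bounds for linear forms *)

Section chernoff.
Context {R : realType}.
Local Notation TR := (measurableTypeR R).
Local Notation law := (probability TR R).
Local Notation vec n := (n.-tuple TR).

Lemma integral_prod_coords n (mus : nat -> law) (g : nat -> TR -> R) :
  (forall k, measurable_fun [set: TR] (g k)) -> (forall k x, 0 <= g k x) ->
  (\int[prod_law n mus]_w (\prod_(k < n) g k (tnth w k))%:E =
   \prod_(k < n) \int[mus k]_x (g k x)%:E)%E.
Proof.
elim: n mus g => [|n IH] mus g mg g0.
  under eq_integral do rewrite big_ord0.
  rewrite big_ord0 integral_cst// mul1e; exact: probability_setT.
have mP m (h : nat -> TR -> R) : (forall k, measurable_fun [set: TR] (h k)) ->
    measurable_fun [set: vec m] (fun w : vec m => \prod_(k < m) h k (tnth w k)).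
  move=> mh; apply: measurable_prod => k.
  by move=> _; apply: (measurableT_comp (mh k)); exact: measurable_tnth.
rewrite big_ord_recl /=.
have mf : measurable_fun [set: vec n.+1]
    (fun w : vec n.+1 => (\prod_(k < n.+1) g k (tnth w k))%:E).
  by apply/measurable_EFinP; exact: mP.
have f0 (w : vec n.+1) : (0 <= (\prod_(k < n.+1) g k (tnth w k))%:E)%E.
  by rewrite lee_fin prodr_ge0.
rewrite (ge0_integral_distribution _ mf f0).
rewrite fubini_tonelli1; last 2 first.
- by apply: measurableT_comp => //; exact: measurable_tcons.
- by move=> z; exact: f0.
rewrite /fubini_F /=.
transitivity (\int[mus 0%N]_x ((g 0%N x)%:E *
    \prod_(k < n) \int[mus k.+1]_y (g k.+1 y)%:E))%E.
  apply: eq_integral => x _.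
  rewrite -(IH (fun k => mus k.+1) (fun k => g k.+1))// -ge0_integralZl//.
  - apply: eq_integral => w _; rewrite big_ord_recl /= EFinM; congr (_ * _%:E)%E.
    by apply: eq_bigr => k _; rewrite tnthS.
  - apply/measurable_EFinP; exact: (mP _ (fun k => g k.+1)).
  - by move=> w _; rewrite lee_fin prodr_ge0.
  - by rewrite lee_fin.
pose K := (\prod_(k < n) \int[mus k.+1]_y (g k.+1 y)%:E)%E.
have K0 : (0 <= K)%E.
  by apply: prode_ge0 => k _; apply: integral_ge0 => z _; rewrite lee_fin; exact: g0.
have mg0 : measurable_fun [set: TR] (fun x : TR => (g 0%N x)%:E).
  exact/measurable_EFinP.
rewrite -/K (ge0_integralZr _ _ mg0)// => z _; rewrite lee_fin; exact: g0.
Qed.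

(** The cubic remainder integrates to at most [rho * m * h ^+ 2] because [|h| <= rho]; this is the
    origin of the factor [1 + rho * m]. *)
Lemma standardized_mgf (mu : law) rho m (h : R) : standardized mu rho m ->
  0 <= m -> 0 < rho -> `|h| <= rho ->
  (exp_moment mu h <= (expR ((1 + rho * m) * h ^+ 2))%:E)%E.
Proof.
move=> smu m0 rho0 hr.
have [I2 E2] := standardized_quadratic 1 h (h ^+ 2 / 2) smu.
have I3 := standardized_integrable smu.
have Ig : mu.-integrable [set: TR] (EFin \o
    (fun x : TR => 1 + h * (x : R) + h ^+ 2 / 2 * (x : R) ^+ 2 +
      `|h| ^+ 3 * (`|x : R| ^+ 3 * expR (rho * `|x : R|)))).
  exact: (integrableD measurableT I2 (integrableZl measurableT (`|h| ^+ 3) I3)).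
have Ie : mu.-integrable [set: TR] (EFin \o (fun x : TR => expR (h * (x : R)))).
  apply: (@integrable_dominated _ _ _ _ _ (fun x : TR => expR rho +
      `|x : R| ^+ 3 * expR (rho * `|x : R|))).
  - exact: measurable_expRM.
  - move=> x; rewrite ger0_norm ?expR_ge0//.
    apply: (@le_trans _ _ (expR (rho * `|x : R|))).
      by rewrite ler_expR (le_trans (ler_norm _))// normrM ler_wpM2r.
    have [x1|x1] := leP `|x : R| 1.
      rewrite ler_wpDr ?mulr_ge0 ?exprn_ge0 ?expR_ge0// ler_expR.
      by rewrite -[leRHS]mulr1 ler_wpM2l// ltW.
    rewrite ler_wpDl ?expR_ge0// ler_peMl ?expR_ge0// exprn_ege1//.
    exact: ltW.
  - have Ic : mu.-integrable [set: TR] (EFin \o (fun _ : TR => expR rho)).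
      exact: (@bounded_integrable _ _ _ _ _ `|expR rho|).
    exact: (integrableD measurableT Ic I3).
rewrite /exp_moment (_ : integral _ _ _ = (\int[mu]_x expR (h * (x : R)))%:E); last first.
  by rewrite /Rintegral fineK//; exact: integrable_fin_num Ie.
rewrite lee_fin.
apply: (@le_trans _ _ (\int[mu]_x (1 + h * (x : R) + h ^+ 2 / 2 * (x : R) ^+ 2 +
      `|h| ^+ 3 * (`|x : R| ^+ 3 * expR (rho * `|x : R|))))).
  apply: le_Rintegral => // x _.
  have := expR_sub3_le (h * (x : R)); rewrite ler_norml => /andP[_].
  have : `|h * (x : R)| ^+ 3 * expR `|h * (x : R)| <=
      `|h| ^+ 3 * (`|x : R| ^+ 3 * expR (rho * `|x : R|)).
    rewrite normrM exprMn -mulrA ler_wpM2l ?exprn_ge0// ler_wpM2l ?exprn_ge0//.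
    by rewrite ler_expR ler_wpM2r.
  rewrite exprMn; move: (_ * expR _) => u; move: (_ * (_ * expR _)) => u'; lra.
rewrite RintegralD//; last exact: (integrableZl measurableT (`|h| ^+ 3) I3).
rewrite E2 RintegralZl//.
have m3 : \int[mu]_x (`|x : R| ^+ 3 * expR (rho * `|x : R|)) <= m.
  have [_ _ _ _ b] := smu; rewrite -lee_fin /Rintegral fineK//.
  exact: integrable_fin_num I3.
apply: le_trans (expR_ge1Dx _).
have h3 : `|h| ^+ 3 <= rho * h ^+ 2.
  by rewrite exprS -(real_normK (num_real h)) ler_wpM2r ?exprn_ge0.
have : `|h| ^+ 3 * (\int[mu]_x (`|x : R| ^+ 3 * expR (rho * `|x : R|))) <= rho * h ^+ 2 * m.
  apply: ler_pM => //.
  by apply: Rintegral_ge0 => x _; rewrite mulr_ge0 ?exprn_ge0 ?expR_ge0.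
have := sqr_ge0 h; lra.
Qed.

(** Markov's inequality for [expR (lambda * l)], whose integral factorizes over the coordinates. The
    condition [lambda * kappa <= rho] keeps each exponent [lambda * a k] in the range of
    [standardized_mgf]. *)
Lemma linform_tail n (mu : law) rho m (a : nat -> R) kappa lambda t :
  standardized mu rho m -> 0 <= m -> 0 < rho ->
  0 <= lambda -> (forall k, `|a k| <= kappa) -> lambda * kappa <= rho ->
  \sum_(k < n) a k ^+ 2 <= 1 ->
  (prod_law n (fun=> mu) [set w | (t < \sum_(k < n) a k * (tnth w k : R))%R] <=
   (expR ((1 + rho * m) * lambda ^+ 2 - lambda * t))%:E)%E.
Proof.
move=> smu m0 rho0 l0 ak lk a1.
pose g k (x : TR) := expR (lambda * a k * (x : R)).
have mg k : measurable_fun [set: TR] (g k) by exact: measurable_expRM.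
have g0 k x : 0 <= g k x by exact: expR_ge0.
have := @integral_prod_coords n (fun=> mu) g mg g0.
pose l (w : vec n) := \sum_(k < n) a k * (tnth w k : R).
have ml : measurable_fun [set: vec n] l.
  exact: (@measurable_linform R n unit (fun=> a) tt).
have -> : (fun w : vec n => (\prod_(k < n) g k (tnth w k))%:E) =
    (fun w => (expR (lambda * l w))%:E).
  apply/funext => w; rewrite /g -expR_sum; congr (expR _)%:E.
  by rewrite /l mulr_sumr; apply: eq_bigr => k _; rewrite mulrA.
move=> E.
pose A := [set w : vec n | t < l w].
have mA : measurable A.
  rewrite -[A]setTI; have := ml measurableT _ (measurable_itv `]t, +oo[).
  by congr (measurable (_ `&` _)); apply/seteqP; split=> w /=; rewrite in_itv/= andbT.
rewrite -/A expRD EFinM.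
have EA : (prod_law n (fun=> mu) A * (expR (lambda * t))%:E <=
    \int[prod_law n (fun=> mu)]_w (expR (lambda * l w))%:E)%E.
  have m1 : measurable_fun [set: vec n] (fun w => (\1_A w : R)%:E).
    by apply/measurable_EFinP; exact: measurable_indic.
  have i0 w : setT w -> (0 <= (\1_A w : R)%:E)%E by rewrite lee_fin.
  have e0 : (0 <= (expR (lambda * t))%:E)%E by rewrite lee_fin expR_ge0.
  rewrite -[A in X in (X <= _)%E]setIT -integral_indic// -(ge0_integralZr _ _ m1)//.
  apply: ge0_le_integral; [exact: measurableT| | | | ].
  - by move=> w _; rewrite mule_ge0 ?lee_fin ?expR_ge0.
  - by apply: emeasurable_funM => //; apply/measurable_EFinP.
  - apply/measurable_EFinP; apply: measurableT_comp => //; exact: measurable_funM.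
  - move=> w _; rewrite -EFinM lee_fin indicE.
    have [/set_mem wA|_] := boolP (w \in A); last by rewrite mul0r expR_ge0.
    by rewrite mul1r ler_expR ler_wpM2l// ltW.
pose C := 1 + rho * m.
have PE : (\prod_(k < n) \int[mu]_x (g k x)%:E <= (expR (C * lambda ^+ 2))%:E)%E.
  apply: (@le_trans _ _ (\prod_(k < n) (expR (C * (lambda * a k) ^+ 2))%:E)%E).
    suff : (0 <= \prod_(k < n) \int[mu]_x (g k x)%:E <=
      \prod_(k < n) (expR (C * (lambda * a k) ^+ 2))%:E)%E by move=> /andP[].
    apply: (big_ind2 (fun x y : \bar R => (0 <= x <= y)%E)).
    - by rewrite lexx lee01.
    - move=> x1 x2 y1 y2 /andP[? ?] /andP[? ?].
      by rewrite mule_ge0//= lee_pmul.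
    - move=> k _; rewrite integral_ge0/=; last first.
        by move=> x _; rewrite lee_fin.
      apply: (standardized_mgf smu m0 rho0).
      rewrite normrM (ger0_norm l0) (le_trans _ lk)// ler_wpM2l//.
  rewrite prodEFin -expR_sum lee_fin ler_expR.
  under eq_bigr do rewrite exprMn mulrA.
  rewrite -mulr_sumr ler_piMr// mulr_ge0 ?sqr_ge0// addr_ge0// mulr_ge0//.
  exact: ltW.
have := le_trans EA (le_trans (eq_ind _ (fun y => (y <= _)%E) (lexx _) _ (esym E)) PE).
move=> /(lee_wpmul2r (_ : (0 <= (expR (- (lambda * t)))%:E)%E)).
rewrite lee_fin expR_ge0 => /(_ isT).
by rewrite -muleA -!EFinM -!expRD subrr expR0 mule1.
Qed.
End chernoff.

(** * Gaussian anti-concentration *)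

Section gaussian_translation.
Context {R : realType}.
Local Notation TR := (measurableTypeR R).
Local Notation law := (probability TR R).
Local Notation vec n := (n.-tuple TR).
Local Notation gauss := (normal_prob (0 : R) 1 : law).
Variable n : nat.
Local Notation Q := (prod_law n (fun=> gauss)).
Variable u : nat -> R.

Definition shift_upto (k : nat) (w : vec n) : vec n :=
  [tuple (if (j < k)%N then (tnth w j : R) - u j else tnth w j) | j < n].

Definition tilt_upto (k : nat) (w : vec n) : R :=
  \prod_(j < n | (j < k)%N) expR (- u j * (tnth w j : R) - u j ^+ 2 / 2).

Lemma measurable_shift_upto k : measurable_fun [set: vec n] (shift_upto k).
Proof.
apply: (proj2 (@measurable_fun_tnthP _ _ _ TR n _)) => j.
apply: (eq_measurable_fun (fun w : vec n =>
  if (j < k)%N then (tnth w j : R) - u j else tnth w j)) => [w _|].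
  by rewrite /= tnth_mktuple.
case: (j < k)%N; last exact: measurable_tnth.
apply: measurable_funB => //; exact: (@measurable_tnth _ TR n j).
Qed.

Lemma measurable_tilt_upto k : measurable_fun [set: vec n] (tilt_upto k).
Proof.
apply: (eq_measurable_fun (fun w : vec n => \prod_(j < n)
    (if (j < k)%N then expR (- u j * (tnth w j : R) - u j ^+ 2 / 2) else 1))).
  by move=> w _; rewrite /tilt_upto [RHS]big_mkcond.
apply: measurable_prod => j _; case: (j < k)%N => //.
apply: measurableT_comp => //; apply: measurable_funB => //.
by apply: measurable_funM => //; exact: (@measurable_tnth _ TR n j).
Qed.

Lemma tilt_upto_ge0 k w : 0 <= tilt_upto k w.
Proof. by apply: prodr_ge0 => j _; exact: expR_ge0. Qed.

(** Induction over the shifted coordinates: coordinate [k] is resampled and moved by the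
    one-dimensional formula, while the density accumulated so far involves only the earlier
    coordinates. *)
Lemma shift_upto_integral k (f : vec n -> \bar R) : (k <= n)%N ->
  measurable_fun [set: vec n] f -> (forall w, 0 <= f w)%E ->
  (\int[Q]_w f (shift_upto k w) = \int[Q]_w (f w * (tilt_upto k w)%:E))%E.
Proof.
elim: k f => [|k IH] f kn mf f0.
  apply: eq_integral => w _; rewrite /tilt_upto big_pred0// mule1.
  by congr f; apply: eq_from_tnth => j; rewrite tnth_mktuple.
pose i := Ordinal kn.
pose sh w : vec n := tset w k ((tnth w i : R) - u k).
have sh_tset w x : sh (tset w k x) = tset w k ((x : R) - u k).
  rewrite /sh [tnth _ i]tnth_mktuple /= eqxx.
  apply: eq_from_tnth => j; rewrite !tnth_mktuple.
  by case: eqP => // ->.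
have mtn j : measurable_fun [set: vec n] (fun w : vec n => (tnth w j : R)).
  exact: (@measurable_tnth _ TR n j).
have msh : measurable_fun [set: vec n] sh.
  apply: (proj2 (@measurable_fun_tnthP _ _ _ TR n _)) => j.
  apply: (eq_measurable_fun (fun w : vec n =>
    if val j == k then (tnth w i : R) - u k else tnth w j)) => [w _|].
    by rewrite /= tnth_mktuple.
  by case: (_ == k) => //; apply: measurable_funB.
have E1 w : shift_upto k.+1 w = sh (shift_upto k w).
  apply: eq_from_tnth => j; rewrite !tnth_mktuple /= ltnn ltnS leq_eqVlt.
  case: eqP => [jk|_] //=; rewrite (_ : i = j) //.
    by rewrite jk.
  exact: val_inj.
under eq_integral do rewrite E1.
rewrite (IH (f \o sh) (ltnW kn) (measurableT_comp mf msh) (fun w => f0 (sh w))).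
have tilt_tset w x : tilt_upto k (tset w k x) = tilt_upto k w.
  apply: eq_bigr => j jk; rewrite tnth_mktuple.
  by rewrite (ltn_eqF jk).
have updE : upd (fun=> gauss) k gauss = (fun=> gauss).
  by apply/funext => j; rewrite /upd; case: ifP.
have res (F : vec n -> \bar R) : measurable_fun [set: vec n] F ->
    (forall w, 0 <= F w)%E ->
    (\int[Q]_w F w = \int[Q]_w \int[gauss]_x F (tset w k x))%E.
  by move=> mF F0; rewrite -[in LHS]updE ge0_integral_prod_law_upd.
rewrite res; last 2 first.
- apply: emeasurable_funM; first exact: (measurableT_comp mf msh).
  by apply/measurable_EFinP; exact: measurable_tilt_upto.
- by move=> w; rewrite mule_ge0 ?lee_fin ?tilt_upto_ge0//=.
rewrite [RHS]res; last 2 first.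
- apply: emeasurable_funM => //.
  by apply/measurable_EFinP; exact: measurable_tilt_upto.
- by move=> w; rewrite mule_ge0 ?lee_fin ?tilt_upto_ge0.
apply: eq_integral => w _ /=.
have mft : measurable_fun [set: TR] (fun x => f (tset w k x)).
  by apply: measurableT_comp => //; exact: measurable_tset1.
under eq_integral do rewrite tilt_tset sh_tset.
rewrite ge0_integralZr//; last 2 first.
- apply: (measurableT_comp (g := fun x : TR => (x : R) - u k : TR) mft).
  exact: measurable_funB.
- by rewrite lee_fin tilt_upto_ge0.
rewrite (@gauss_shift R (u k) (fun x => f (tset w k x)))//.
have mE : measurable_fun [set: TR] (fun x : TR => expR (- u k * (x : R) - u k ^+ 2 / 2)).
  apply: measurableT_comp => //; apply: measurable_funB => //; exact: measurable_funM.
rewrite -ge0_integralZr//; last 3 first.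
- by apply: emeasurable_funM => //; exact/measurable_EFinP.
- by move=> x _; rewrite mule_ge0 ?lee_fin ?expR_ge0.
- by rewrite lee_fin tilt_upto_ge0.
apply: eq_integral => x _; rewrite -muleA; congr (_ * _)%E.
rewrite -EFinM; congr EFin; rewrite /tilt_upto [RHS](bigD1 i)//=.
congr (_ * _); first by rewrite tnth_mktuple eqxx.
apply: eq_big => [j|j jk].
  by rewrite ltnS ltn_neqAle andbC -val_eqE.
by rewrite tnth_mktuple (ltn_eqF jk).
Qed.

Definition shift (w : vec n) : vec n := [tuple (tnth w j : R) - u j | j < n].

(** On [E] the density of the translated law is at least the exponential on the left. *)
Lemma gauss_translate (E : set (vec n)) h : measurable E ->
  (forall w, E w -> \sum_(k < n) u k * (tnth w k : R) <= h) ->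
  expR (- h - (\sum_(k < n) u k ^+ 2) / 2) * fine (Q E) <=
  fine (Q (shift @^-1` E)).
Proof.
move=> mE Eh.
have shE : shift = shift_upto n.
  apply/funext => w; apply: eq_from_tnth => j.
  by rewrite !tnth_mktuple ltn_ord.
have msh : measurable (shift @^-1` E).
  by rewrite shE -[X in measurable X]setTI; exact: measurable_shift_upto.
have fin A : measurable A -> Q A = (fine (Q A))%:E.
  by move=> mA; rewrite fineK// fin_num_measure.
rewrite -lee_fin EFinM -!fin//.
set c := expR _.
have i0 A w : (0 <= (\1_A w : R)%:E)%E by rewrite lee_fin.
have mi A : measurable A -> measurable_fun [set: vec n] (fun w => (\1_A w : R)%:E).
  by move=> mA; apply/measurable_EFinP; exact: measurable_indic.
have -> : Q (shift @^-1` E) = (\int[Q]_w (\1_E w * tilt_upto n w)%:E)%E.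
  have -> : Q (shift @^-1` E) = (\int[Q]_w (\1_(shift @^-1` E) w : R)%:E)%E.
    by rewrite integral_indic// setIT.
  transitivity (\int[Q]_w (\1_E (shift_upto n w) : R)%:E)%E.
    by apply: eq_integral => w _; rewrite -shE.
  rewrite (@shift_upto_integral n (fun w => (\1_E w : R)%:E))//.
  exact: mi.
have -> : Q E = (\int[Q]_w (\1_E w : R)%:E)%E by rewrite integral_indic// setIT.
rewrite -ge0_integralZl//; last 2 first.
- exact: mi.
- by rewrite lee_fin expR_ge0.
apply: ge0_le_integral; [exact: measurableT| | | | ].
- by move=> w _; rewrite mule_ge0// lee_fin expR_ge0.
- by apply: emeasurable_funM => //; exact: mi.
- apply/measurable_EFinP; apply: measurable_funM; first exact: measurable_indic.
  exact: measurable_tilt_upto.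
- move=> w _; rewrite -EFinM lee_fin indicE.
  have [/set_mem wE|_] := boolP (w \in E); last by rewrite mulr0 mul0r.
  have -> : tilt_upto n w = \prod_(j < n) expR (- u j * (tnth w j : R) - u j ^+ 2 / 2).
    by apply: eq_bigl => j; rewrite ltn_ord.
  rewrite mulr1 mul1r /c.
  rewrite -expR_sum ler_expR sumrB lerB//.
    by rewrite (eq_bigr _ (fun j _ => mulNr _ _)) sumrN lerN2 Eh.
  by rewrite mulr_suml.
Qed.

End gaussian_translation.

Section anticoncentration.
Context {R : realType}.
Local Notation TR := (measurableTypeR R).
Local Notation law := (probability TR R).
Local Notation vec n := (n.-tuple TR).
Local Notation gauss := (normal_prob (0 : R) 1 : law).
Variables (n : nat) (J : finType) (a : J -> nat -> R) (b : J -> R).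
Hypothesis a_unit : forall j, \sum_(k < n) a j k ^+ 2 = 1.
Local Notation Q := (prod_law n (fun=> gauss)).
Local Notation below := (@below R n J a b).
Local Notation val_ j w := (@linform R n J a j w - b j).

(* Ties are broken by [enum_rank], so that the bands are disjoint. *)
Definition first_max (j : J) (w : vec n) : Prop :=
  (forall i, val_ i w <= val_ j w) /\
  (forall i, (enum_rank i < enum_rank j)%N -> val_ i w < val_ j w).

Definition band (j : J) (t e : R) : set (vec n) :=
  [set w | t < val_ j w <= t + e /\ first_max j w].

Let mval j : measurable_fun [set: vec n] (fun w => val_ j w).
Proof. by apply: measurable_funB => //; exact: measurable_linform. Qed.

Lemma measurable_band j t e : measurable (band j t e).
Proof.
have -> : band j t e = ((fun w => val_ j w) @^-1` `]t, t + e]) `&`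
   ((\bigcap_(i in [set: J]) [set w | val_ i w <= val_ j w]) `&`
    (\bigcap_(i in [set i : J | (enum_rank i < enum_rank j)%N])
      [set w | val_ i w < val_ j w])).
  apply/seteqP; split=> w.
    move=> [wj [w1 w2]]; split; first by rewrite /= in_itv.
    by split=> i ij; [exact: w1|exact: w2].
  move=> [wj [w1 w2]]; split; first by move: wj; rewrite /= in_itv.
  by split=> i; [exact: w1|exact: w2].
apply: measurableI.
  rewrite -[X in measurable X]setTI.
  exact: (mval j measurableT (measurable_itv _)).
have mD i : measurable_fun [set: vec n] (fun w => val_ i w - val_ j w).
  by apply: measurable_funB; exact: mval.
apply: measurableI; apply: fin_bigcap_measurable => // i _.
- have := mD i measurableT _ (measurable_itv `]-oo, 0]); rewrite setTI.
  by congr measurable; apply/seteqP; split=> w /=; rewrite in_itv/= subr_le0.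
- have := mD i measurableT _ (measurable_itv `]-oo, 0[); rewrite setTI.
  by congr measurable; apply/seteqP; split=> w /=; rewrite in_itv/= subr_lt0.
Qed.

Lemma first_max_ex w : (exists j : J, True) -> exists j, first_max j w.
Proof.
move=> [j0 _].
have [j _ jm] := @arg_maxP _ _ J j0 xpredT (fun j => val_ j w) isT.
pose p (k : nat) := [exists i : J, (enum_rank i == k :> nat) &&
  [forall l, val_ l w <= val_ i w]].
have exP : exists k, p k.
  exists (enum_rank j); apply/existsP; exists j; rewrite eqxx/=.
  by apply/forallP => l; exact: jm.
case: (ex_minnP exP) => k /existsP[i /andP[/eqP ik /forallP im]] kmin.
exists i; split=> // l li; rewrite lt_neqAle im andbT; apply/eqP => E.
have : p (enum_rank l).
  apply/existsP; exists l; rewrite eqxx/=; apply/forallP => l'.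
  by rewrite E.
by move=> /kmin; rewrite -ik leqNgt li.
Qed.

Lemma below_band t e : 0 <= e ->
  below (t + e) `\` below t = \bigcup_(j in [set: J]) band j t e.
Proof.
move=> e0; apply/seteqP; split=> w.
- move=> [wte wt].
  have [j0 wj0] : exists j, t < val_ j w.
    apply: contrapT => h; apply: wt => j; rewrite leNgt; apply/negP => tj.
    by apply: h; exists j.
  have [j [jm jf]] : exists j, first_max j w by apply: first_max_ex; exists j0.
  exists j => //.
  by split; [rewrite (lt_le_trans wj0)//=; exact: wte|split].
- move=> [j _ [/andP[tj jt] [jm _]]]; split=> [i|/(_ j)].
    exact: le_trans (jm i) jt.
  by rewrite leNgt tj.
Qed.

Lemma trivIset_band t e : trivIset [set: J] (fun j => band j t e).
Proof.
move=> i j _ _ [w [[_ [im imf]] [_ [jm jmf]]]].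
apply: enum_rank_inj; apply/val_inj => /=.
have [ij|ij|//] := ltngtP (enum_rank i) (enum_rank j).
  by have := jmf i ij; rewrite ltNge im.
by have := imf j ij; rewrite ltNge jm.
Qed.

Local Notation fQ A := (fine (Q A)).

Let fQE A : measurable A -> Q A = (fQ A)%:E.
Proof. by move=> mA; rewrite fineK// fin_num_measure. Qed.

Lemma below_diff t e : 0 <= e ->
  fQ (below (t + e)) - fQ (below t) = \sum_(j : J) fQ (band j t e).
Proof.
move=> e0.
have sub : below t `<=` below (t + e).
  by move=> w h j; rewrite (le_trans (h j))// lerDl.
have mB s : measurable (below s) by exact: measurable_below.
apply: EFin_inj; rewrite EFinB -!fQE//.
have -> : Q (below (t + e)) = (Q (below (t + e) `\` below t) + Q (below t))%E.
  by rewrite -[in LHS](setDKU sub) measureU// ?setDKI//; exact: measurableD.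
rewrite addeK ?fin_num_measure// below_band//.
rewrite measure_fin_bigcup//; last 3 first.
- exact: finite_finset.
- exact: trivIset_band.
- by move=> j _; exact: measurable_band.
rewrite (fsbigE (index_enum J)); last 3 first.
- exact: index_enum_uniq.
- by [].
- by move=> j _; rewrite mem_index_enum.
rewrite -sumEFin big_mkcond/=; apply: eq_bigr => j _.
by rewrite in_setT fQE//; exact: measurable_band.
Qed.

Lemma unit_inner i j : \sum_(k < n) a i k * a j k <= 1.
Proof.
have : \sum_(k < n) a i k * a j k <=
    \sum_(k < n) (a i k ^+ 2 / 2 + a j k ^+ 2 / 2).
  apply: ler_sum => k _; have := sqr_ge0 (a i k - a j k); rewrite sqrrB; lra.
by rewrite big_split/= -!mulr_suml !a_unit -splitr.
Qed.

(** Translation along [s] times the unit vector [a j] raises the value of [j] by exactly [s] and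
    every other value by at most [s]. Hence [j] remains the first maximizer and the band moves into
    the band at level [t + s]. On the band the linear form is at most [H], which bounds the cost of
    the translation. *)
Lemma band_shift j t e s H : 0 <= s -> t + e + b j <= H ->
  expR (- (s * H) - s ^+ 2 / 2) * fQ (band j t e) <= fQ (band j (t + s) e).
Proof.
move=> s0 tH.
pose u k := s * a j k.
have := @gauss_translate R n u (band j t e) (s * H) (measurable_band j t e).
have -> : \sum_(k < n) u k ^+ 2 = s ^+ 2.
  by under eq_bigr do rewrite exprMn; rewrite -mulr_sumr a_unit mulr1.
move=> /(_ _)/le_trans; apply.
  move=> w [/andP[_ wt] _].
  under eq_bigr do rewrite -mulrA.
  rewrite -mulr_sumr ler_wpM2l//; apply: le_trans tH.
  by rewrite -lerBlDr.
have msh : measurable (shift u @^-1` band j t e).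
  rewrite -[X in measurable X]setTI.
  apply: (_ : measurable_fun [set: vec n] (shift u)) => //; last exact: measurable_band.
  apply: (eq_measurable_fun (shift_upto u n)) => [w _|].
    by apply: eq_from_tnth => k; rewrite !tnth_mktuple ltn_ord.
  exact: measurable_shift_upto.
have mb : measurable (band j (t + s) e) by exact: measurable_band.
apply: fine_le; rewrite ?fin_num_measure//.
apply: le_measure; rewrite ?inE//.
move=> w; rewrite /= => -[].
have E i : linform a i (shift u w) = linform a i w - s * \sum_(k < n) a i k * a j k.
  rewrite /linform mulr_sumr -sumrB; apply: eq_bigr => k _.
  by rewrite tnth_mktuple /u; ring.
have jj : \sum_(k < n) a j k * a j k = 1.
  by rewrite -(a_unit j); apply: eq_bigr => k _; rewrite expr2.
rewrite !E jj => /andP[wt wte] [w1 w2].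
have ij i := unit_inner i j.
have sij i : s * (\sum_(k < n) a i k * a j k) <= s.
  by rewrite -[leRHS]mulr1 ler_wpM2l.
split; first by apply/andP; split; lra.
split=> i.
  have := w1 i; rewrite !E jj; have := sij i; lra.
move=> /w2; rewrite !E jj; have := sij i; lra.
Qed.

(** About [1 / (e * H)] consecutive strips of width [e], starting with the given one, are disjoint
    and have total mass at most 1. Their distance [s] from the first satisfies [s * H <= 1] and
    [s <= 1], so each carries at least [expR (- (3 / 2))] times the mass of the first. *)
Lemma below_anticoncentration t e H : 1 <= H -> 0 < e ->
  (forall j, t + e + b j <= H) ->
  fQ (below (t + e)) - fQ (below t) <= 2 * expR (3 / 2) * (e * H).
Proof.
move=> H1 e0 tH.
have H0 : 0 < H by rewrite (lt_le_trans _ H1).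
have f01 A : measurable A -> 0 <= fQ A <= 1.
  move=> mA; rewrite fine_ge0//= -lee_fin -fQE//.
  exact: probability_le1.
have mB s : measurable (below s) by exact: measurable_below.
have sub1 (x y : R) : x <= 1 -> 0 <= y -> x - y <= 1 by lra.
set D := fQ _ - fQ _.
have E1 : 1 <= expR (3 / 2) :> R by rewrite one_le_expR.
have [eH|eH] := leP 1 (e * H).
  have /andP[_ ?] := f01 _ (mB (t + e)); have /andP[? _] := f01 _ (mB t).
  apply: (@le_trans _ _ 1); first exact: sub1.
  have E2 : 1 <= 2 * expR (3 / 2) :> R by rewrite (le_trans E1)// ler_peMl ?expR_ge0// ler1n.
  by rewrite -[leLHS]mulr1 ler_pM.
have eH0 : 0 < e * H by rewrite mulr_gt0.
pose K := Num.truncn (e * H)^-1.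
have /andP[K1 K2] : K%:R <= (e * H)^-1 < K.+1%:R.
  by apply: truncn_itv; rewrite invr_ge0 ltW.
have Kp : (0 < K)%N by rewrite truncn_gt0 invf_ge1// ltW.
have step m : (m < K)%N -> expR (- (3 / 2)) * D <=
    fQ (below (t + m.+1%:R * e)) - fQ (below (t + m%:R * e)).
  move=> mK; pose s := m%:R * e.
  have s0 : 0 <= s by rewrite mulr_ge0// ltW.
  have sH : s * H <= 1.
    rewrite /s -mulrA -ler_pdivlMr// div1r (le_trans _ K1)// ler_nat.
    exact: ltnW.
  have s1 : s <= 1.
    by rewrite (le_trans _ sH)// ler_peMr.
  rewrite (_ : t + m.+1%:R * e = (t + s) + e); last by rewrite /s -natr1; ring.
  rewrite /D !below_diff ?(ltW e0)// mulr_sumr; apply: ler_sum => j _.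
  apply: le_trans (band_shift s0 (tH j)); rewrite ler_wpM2r//.
    by have /andP[] := f01 _ (measurable_band j t e).
  rewrite ler_expR; have : s ^+ 2 <= 1 by rewrite exprn_ile1.
  lra.
have tel : K%:R * (expR (- (3 / 2)) * D) <= 1.
  apply: (@le_trans _ _ (fQ (below (t + K%:R * e)) - fQ (below (t + 0%:R * e)))).
    rewrite -(telescope_sumr (fun m => fQ (below (t + m%:R * e))))//.
    rewrite mulr_natl -[X in _ *+ X]subn0 -sumr_const_nat.
    rewrite big_nat_cond [leRHS]big_nat_cond; apply: ler_sum => m.
    by rewrite andbT => /andP[_]; exact: step.
  have /andP[_ ?] := f01 _ (mB (t + K%:R * e)).
  by have /andP[? _] := f01 _ (mB (t + 0%:R * e)); exact: sub1.
have D0 : 0 <= D.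
  rewrite /D below_diff ?(ltW e0)//; apply: sumr_ge0 => j _.
  by have /andP[] := f01 _ (measurable_band j t e).
have K2' : (e * H)^-1 <= 2 * K%:R.
  rewrite (le_trans (ltW K2))// -natr1.
  have : 1 <= K%:R :> R by rewrite ler1n.
  lra.
have : (e * H)^-1 * (expR (- (3 / 2)) * D) <= 2.
  apply: (@le_trans _ _ (2 * K%:R * (expR (- (3 / 2)) * D))).
    by rewrite ler_wpM2r// mulr_ge0 ?expR_ge0.
  by rewrite -mulrA -[leRHS]mulr1 ler_pM2l.
rewrite expRN mulrA -invfM mulrC ler_pdivrMr ?mulr_gt0 ?expR_gt0//.
by move=> /le_trans; apply; rewrite le_eqVlt; apply/orP; left; apply/eqP; ring.
Qed.
End anticoncentration.

(** * Expansion of the likelihood ratio *)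

Section exponential_family_expansion.
Context {R : realType}.
Local Notation TR := (measurableTypeR R).
Local Notation law := (probability TR R).
Variables (nu : {sigma_finite_measure set TR -> \bar R}) (F : R -> law).
Hypothesis hopen : open (natural_space nu).
Hypothesis hF : forall theta, natural_space nu theta ->
  forall A : set TR, measurable A ->
  F theta A = (\int[nu]_(x in A) (expfam_pdf nu theta x)%:E)%E.
Hypothesis hconv : strictly_convex_on (natural_space nu) (cumulant nu).
Hypothesis hvar : forall theta, natural_space nu theta ->
  (0 < 'V_(F theta)[(fun x : TR => x : R)])%E.
Variable theta0 : R.
Hypothesis htheta0 : natural_space nu theta0.

Local Notation psi := (cumulant nu).
Local Notation N := (natural_space nu).
Local Notation F0 := (F theta0).

Lemma measurable_expfam_pdf theta : measurable_fun [set: TR] (expfam_pdf nu theta).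
Proof.
apply: measurableT_comp => //; apply: measurable_funB => //.
Qed.

Lemma integral_expRMr (mu : {measure set TR -> \bar R}) (h c : R) :
  (\int[mu]_x ((expR (h * (x : R)))%:E * (expR c)%:E) =
   \int[mu]_x (expR (h * (x : R)))%:E * (expR c)%:E)%E.
Proof.
have mE : measurable_fun [set: TR] (fun x : TR => (expR (h * (x : R)))%:E).
  by apply/measurable_EFinP; exact: measurable_expRM.
have E0 (y : R) : (0 <= (expR y)%:E)%E by rewrite lee_fin expR_ge0.
by rewrite (ge0_integralZr _ _ mE).
Qed.

(** Derived from the total mass 1 of [F theta], which excludes the default values of [fine] and [ln]
    in [cumulant]. *)
Lemma partition_function theta : N theta ->
  (\int[nu]_x (expR (theta * (x : R)))%:E = (expR (psi theta))%:E)%E.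
Proof.
move=> Nt; have := hF Nt measurableT.
rewrite [LHS](_ : _ = 1%E); last exact: probability_setT.
under eq_integral do rewrite /expfam_pdf expRD EFinM.
rewrite integral_expRMr.
set I := integral _ _ _ => E.
have -> : I = (I * (expR (- psi theta))%:E * (expR (psi theta))%:E)%E.
  by rewrite -muleA -EFinM -expRD addNr expR0 mule1.
by rewrite -E mul1e.
Qed.

Lemma exp_moment_expfam (h : R) : N (theta0 + h) ->
  exp_moment F0 h = (expR (psi (theta0 + h) - psi theta0))%:E.
Proof.
move=> Nh; rewrite /exp_moment.
rewrite (@ge0_integral_density _ _ _ nu _ (expfam_pdf nu theta0)); last 5 first.
- exact: measurable_expfam_pdf.
- by move=> x; exact: expR_ge0.
- exact: hF.
- by apply/measurable_EFinP; exact: measurable_expRM.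
- by move=> x; rewrite lee_fin expR_ge0.
under eq_integral => x _.
  rewrite -EFinM /expfam_pdf -expRD.
  rewrite (_ : h * x + _ = (theta0 + h) * (x : R) + - psi theta0); last by ring.
  rewrite expRD EFinM; over.
rewrite integral_expRMr.
by rewrite (partition_function Nh) -EFinM -expRD.
Qed.

Lemma natural_space_nbhs : exists2 e : R, 0 < e & forall h, `|h| <= e -> N (theta0 + h).
Proof.
have /nbhs_ballP[e /= e0 be] := open_nbhs_nbhs (conj hopen htheta0).
exists (e / 2); first by rewrite divr_gt0.
move=> h he; apply: be; rewrite /ball/= opprD addrA subrr sub0r normrN.
by rewrite (le_lt_trans he)// ltr_pdivrMr// ltr_pMr// ltr1n.
Qed.

Definition expfam_mean : R := \int[F0]_x (x : R).
Definition expfam_variance : R := \int[F0]_x (((x : R) - expfam_mean) ^+ 2).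
Definition expfam_sd : R := Num.sqrt expfam_variance.

Local Notation m := expfam_mean.
Local Notation sd := expfam_sd.

(** Half the radius, because the moment lemmas ask for exponential moments at twice the exponent
    that they deliver. *)
Let rho0 := sval (cid2 natural_space_nbhs) / 2.
Let rho00 : 0 < rho0.
Proof. by rewrite /rho0; case: cid2 => e /= e0 _; rewrite divr_gt0. Qed.
Let rho0N h : `|h| <= 2 * rho0 -> N (theta0 + h).
Proof.
by rewrite /rho0; case: cid2 => e /= e0 he; rewrite mulrC divfK//; exact: he.
Qed.

Let rho02 : `|2 * rho0| <= 2 * rho0.
Proof. by rewrite ger0_norm// mulr_ge0// ltW. Qed.

Let Fp : (exp_moment F0 (2 * rho0) < +oo)%E.
Proof. by rewrite exp_moment_expfam ?ltry//; exact: rho0N. Qed.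

Let Fn : (exp_moment F0 (- (2 * rho0)) < +oo)%E.
Proof. by rewrite exp_moment_expfam ?ltry//; apply: rho0N; rewrite normrN. Qed.

Let I1 : F0.-integrable [set: TR] (EFin \o (fun x : TR => x : R)).
Proof.
have := integrable_pow rho00 Fp Fn 1.
by apply: eq_integrable => // x _ /=; rewrite expr1.
Qed.

Let I2 : F0.-integrable [set: TR] (EFin \o (fun x : TR => ((x : R) - m) ^+ 2)).
Proof.
have Ic : F0.-integrable [set: TR] (EFin \o (fun _ : TR => m ^+ 2)).
  exact: (@bounded_integrable _ _ _ _ _ `|m ^+ 2|).
have := integrableD measurableT (integrable_pow rho00 Fp Fn 2)
  (integrableD measurableT (integrableZl measurableT (- 2 * m) I1) Ic).
apply: eq_integrable => // x _ /=.
by congr EFin; ring.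
Qed.

Lemma expfam_sd_gt0 : 0 < sd.
Proof.
rewrite sqrtr_gt0; have := hvar htheta0.
rewrite /variance unlock unlock /=.
rewrite -lte_fin; congr (_ < _)%E.
rewrite /expfam_variance /Rintegral fineK; last exact: integrable_fin_num I2.
apply: eq_integral => x _; congr EFin; rewrite expr2.
Qed.


Definition standardize (x : TR) : TR := ((x : R) - m) / sd.

Lemma measurable_standardize : measurable_fun [set: TR] standardize.
Proof. by apply: measurable_funM => //; exact: measurable_funB. Qed.

HB.instance Definition _ :=
  isMeasurableFun.Build _ _ _ _ standardize measurable_standardize.

Definition std_law : law := distribution F0 standardize.

(** The cumulant generating function of a standardized observation; [h] is the displacement of the
    parameter from [theta0] in units of [1 / sd]. *)
Definition std_cumulant (h : R) : R :=
  psi (theta0 + h / sd) - psi theta0 - h * m / sd.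

Lemma exp_moment_std_law h : N (theta0 + h / sd) ->
  exp_moment std_law h = (expR (std_cumulant h))%:E.
Proof.
move=> Nh; rewrite /exp_moment /std_law.
have mE : measurable_fun [set: TR] (fun x : TR => (expR (h * (x : R)))%:E).
  by apply/measurable_EFinP; exact: measurable_expRM.
have E0 (y : TR) : (0 <= (expR (h * (y : R)))%:E)%E by rewrite lee_fin expR_ge0.
rewrite (ge0_integral_distribution _ mE E0).
rewrite (eq_integral (fun x : TR => (expR (h / sd * (x : R)))%:E * (expR (- (h * m / sd)))%:E)%E).
  by rewrite integral_expRMr -/(exp_moment F0 (h / sd)) exp_moment_expfam// -EFinM -expRD.
move=> x _ /=; rewrite -EFinM -expRD; congr (expR _)%:E.
by rewrite /standardize; field; rewrite gt_eqF// expfam_sd_gt0.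
Qed.

Let rho := rho0 * sd.
Let rho_gt0 : 0 < rho. Proof. by rewrite mulr_gt0// expfam_sd_gt0. Qed.

Let rhoN h : `|h| <= 2 * rho -> N (theta0 + h / sd).
Proof.
move=> hr; apply: rho0N; rewrite normrM normfV (gtr0_norm expfam_sd_gt0).
by rewrite ler_pdivrMr ?expfam_sd_gt0// (le_trans hr)// /rho mulrA.
Qed.

Let sdp : (exp_moment std_law (2 * rho) < +oo)%E.
Proof.
rewrite exp_moment_std_law ?ltry//; apply: rhoN.
by rewrite ger0_norm// mulr_ge0// ltW.
Qed.

Let sdn : (exp_moment std_law (- (2 * rho)) < +oo)%E.
Proof.
rewrite exp_moment_std_law ?ltry//; apply: rhoN.
by rewrite normrN ger0_norm// mulr_ge0// ltW.
Qed.

Let mean0 : \int[std_law]_x (x : R) = 0.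
Proof.
have Is : F0.-integrable [set: TR] (EFin \o (fun x : TR => sd^-1 * ((x : R) - m))).
  have Ic : F0.-integrable [set: TR] (EFin \o (fun _ : TR => m)).
    exact: (@bounded_integrable _ _ _ _ _ `|m|).
  exact: (integrableZl measurableT _ (integrableB measurableT I1 Ic)).
have sE : (fun x : TR => sd^-1 * ((x : R) - m)) = (fun x => standardize x : R).
  by apply/funext => x; rewrite mulrC.
rewrite sE in Is.
have mI : measurable_fun [set: TR] (fun x : TR => (x : R)%:E) by apply/measurable_EFinP.
rewrite /Rintegral (integral_distribution mI Is).
rewrite (eq_integral (fun x : TR => (sd^-1 * ((x : R) - m))%:E)); last first.
  by move=> x _ /=; rewrite /standardize mulrC.
have Ic : F0.-integrable [set: TR] (EFin \o (fun _ : TR => m)).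
  exact: (@bounded_integrable _ _ _ _ _ `|m|).
rewrite -/(Rintegral F0 setT (fun x : TR => sd^-1 * ((x : R) - m))).
rewrite RintegralZl//; last exact: (integrableB measurableT I1 Ic).
by rewrite RintegralB// Rintegral_prob_cst subrr mulr0.
Qed.

Let var1 : \int[std_law]_x ((x : R) ^+ 2) = 1.
Proof.
have I2' := integrableZl measurableT (sd ^- 2) I2.
have mI : measurable_fun [set: TR] (fun x : TR => ((x : R) ^+ 2)%:E).
  by apply/measurable_EFinP; exact: measurable_funX.
have Is : F0.-integrable [set: TR] ((fun x : TR => ((x : R) ^+ 2)%:E) \o standardize).
  apply: eq_integrable I2' => // x _ /=; rewrite -EFinM; congr EFin.
  by rewrite /standardize exprMn exprVn mulrC.
rewrite /Rintegral (integral_distribution mI Is).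
rewrite (eq_integral (fun x : TR => (sd ^- 2 * ((x : R) - m) ^+ 2)%:E)); last first.
  by move=> x _ /=; rewrite /standardize exprMn exprVn mulrC.
rewrite -/(Rintegral F0 setT (fun x : TR => sd ^- 2 * ((x : R) - m) ^+ 2)).
rewrite RintegralZl// -/expfam_variance.
have v0 : 0 < expfam_variance by have := expfam_sd_gt0; rewrite sqrtr_gt0.
by rewrite /expfam_sd sqr_sqrtr ?mulVf ?gt_eqF// ltW.
Qed.

Lemma std_law_standardized : exists rho M : R,
  [/\ 0 < rho, 0 <= M & standardized std_law rho M].
Proof.
exists rho, (cubexp_moment std_law rho); split => //.
  exact: cubexp_moment_ge0.
by apply: exp_moments_standardized => //.
Qed.

(** The moment expansion gives [expR (std_cumulant h) = 1 + u] with [u] close to [h ^+ 2 / 2], and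
    the logarithm of [1 + u] lies between [u - 2 * u ^+ 2] and [u]. In the constant [K + 1], [K]
    comes from the moment expansion and 1 from [2 * u ^+ 2]; the choice of [e] ensures
    [|u| <= h ^+ 2 <= 1 / 4]. *)
Lemma std_cumulant_taylor : exists C e : R, [/\ 0 <= C, 0 < e &
  forall h, `|h| <= e -> N (theta0 + h / sd) /\
    `|std_cumulant h - h ^+ 2 / 2| <= C * `|h| ^+ 3].
Proof.
pose K := cubexp_moment std_law rho.
have K0 : 0 <= K by exact: cubexp_moment_ge0.
pose e := Num.min rho (Num.min (1 / 2) (1 / (2 * (K + 1)))).
have e0 : 0 < e.
  by rewrite !lt_min rho_gt0/= !divr_gt0// mulr_gt0// ltr_wpDl.
exists (K + 1), e; split => //; first by rewrite addr_ge0.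
move=> h he.
have h1 : `|h| <= rho by rewrite (le_trans he)// ge_min lexx.
have h2 : `|h| <= 1 / 2 by rewrite (le_trans he)// !ge_min lexx orbT.
have h3 : `|h| <= 1 / (2 * (K + 1)) by rewrite (le_trans he)// !ge_min lexx !orbT.
have Nh : N (theta0 + h / sd).
  by apply: rhoN; rewrite (le_trans h1)// ler_peMl ?ler1n// ltW.
split=> //.
have := mgf_taylor rho_gt0 sdp sdn h1.
rewrite mean0 var1 mulr0 addr0 mulr1 -/K.
rewrite (_ : \int[std_law]_x expR _ = expR (std_cumulant h)); last first.
  by rewrite /Rintegral -/(exp_moment std_law h) exp_moment_std_law.
set k := std_cumulant h; set r := expR k - _ => rK.
pose u := h ^+ 2 / 2 + r.
have eu : expR k = 1 + u by rewrite /u /r; ring.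
have h0 : 0 <= `|h| by [].
have KK : K * `|h| <= 1 / 2.
  have : `|h| * (2 * (K + 1)) <= 1 by rewrite -ler_pdivlMr// mulr_gt0// ltr_wpDl.
  by move: h0; lra.
have hh : `|h| ^+ 2 = h ^+ 2 by rewrite real_normK// num_real.
have h20 := sqr_ge0 h.
have h3K : `|h| ^+ 3 * K <= h ^+ 2 / 2.
  rewrite exprSr hh -mulrA [`|h| * K]mulrC.
  by have := ler_wpM2l h20 KK; lra.
have u1 : `|u| <= h ^+ 2.
  rewrite /u (le_trans (ler_normD _ _))// ger0_norm ?divr_ge0//.
  by have := le_trans rK h3K; lra.
have h4 : h ^+ 2 <= 1 / 4.
  have := ler_pM h0 h0 h2 h2; rewrite -expr2 hh; lra.
have ku : k <= u by have := expR_ge1Dx k; rewrite eu; lra.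
have u_ge : - (1 / 4) <= u by move: u1; rewrite ler_norml => /andP[]; lra.
have ku2 : u - 2 * u ^+ 2 <= k.
  have up : 0 < 1 + u by lra.
  have : 1 - k <= (1 + u)^-1 by rewrite -eu -expRN; have := expR_ge1Dx (- k); lra.
  have : (1 + u)^-1 <= 1 - u + 2 * u ^+ 2.
    rewrite -div1r ler_pdivrMr//.
    have : 0 <= u ^+ 2 * (1 + 2 * u) by rewrite mulr_ge0 ?sqr_ge0//; lra.
    lra.
  lra.
have u22 : 2 * u ^+ 2 <= `|h| ^+ 3.
  have : u ^+ 2 <= h ^+ 2 * h ^+ 2.
    by rewrite -(real_normK (num_real u)) expr2 ler_pM.
  have : `|h| ^+ 2 * `|h| ^+ 2 <= `|h| ^+ 3 * (1 / 2).
    by rewrite -exprD (exprSr _ 3) ler_wpM2l ?exprn_ge0.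
  rewrite hh; lra.
rewrite mulrDl mul1r [K * _]mulrC.
have := rK; rewrite !ler_norml => /andP[r1 r2].
by apply/andP; split; move: ku ku2 u22; rewrite /u; lra.
Qed.


Lemma std_cumulant0 : std_cumulant 0 = 0.
Proof. by rewrite /std_cumulant !mul0r addr0 subrr subr0. Qed.

(** Convexity on the segment from [theta0], where [std_cumulant] vanishes. It carries the growth
    near [theta0] to the whole parameter space, and so excludes a likelihood maximum far away. *)
Lemma std_cumulant_ray h t : N (theta0 + h / sd) -> 0 < t -> t < 1 -> h != 0 ->
  std_cumulant (t * h) <= t * std_cumulant h.
Proof.
move=> Nh t0 t1 h0.
have ne : theta0 + h / sd != theta0.
  by rewrite -subr_eq0 addrAC subrr add0r mulf_neq0// invr_eq0 gt_eqF// expfam_sd_gt0.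
have := hconv Nh htheta0 ne t0 t1.
rewrite (_ : t * _ + (1 - t) * theta0 = theta0 + t * h / sd); last first.
  by field; rewrite gt_eqF// expfam_sd_gt0.
move=> /ltW c; rewrite /std_cumulant.
rewrite (_ : t * (_ - _) = t * psi (theta0 + h / sd) + (1 - t) * psi theta0
    - psi theta0 - t * h * m / sd); last first.
  by field; rewrite gt_eqF// expfam_sd_gt0.
by rewrite !lerD2r.
Qed.

(** The Legendre transform of [std_cumulant] near 0. The lower bound takes [h = x]. For the upper
    bound, the Taylor expansion and a completed square serve for [|h| <= 4 * |x|]; for larger
    [|h| <= d] the quadratic growth makes the expression nonpositive; beyond [d] the point is scaled
    back to distance [d] by convexity. *)
Lemma legendre_expansion : exists C e : R, [/\ 0 <= C, 0 < e &
  forall x, `|x| <= e ->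
    (forall h, N (theta0 + h / sd) -> h * x - std_cumulant h <= x ^+ 2 / 2 + C * `|x| ^+ 3) /\
    exists2 h, N (theta0 + h / sd) & x ^+ 2 / 2 - C * `|x| ^+ 3 <= h * x - std_cumulant h].
Proof.
have [C [e [C0 e0 T]]] := std_cumulant_taylor.
pose d := Num.min e (1 / (4 * (C + 1))).
have C1 : 0 < C + 1 by rewrite ltr_wpDl.
have d0 : 0 < d by rewrite lt_min e0/= divr_gt0// mulr_gt0.
have de : d <= e by rewrite ge_min lexx.
have dC : C * d <= 1 / 4.
  have : d <= 1 / (4 * (C + 1)) by rewrite ge_min lexx orbT.
  rewrite ler_pdivlMr ?mulr_gt0// => ?; lra.
have low h : `|h| <= d -> h ^+ 2 / 4 <= std_cumulant h.
  move=> hd; have [_] := T h (le_trans hd de); rewrite ler_norml => /andP[].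
  have h2 : `|h| ^+ 2 = h ^+ 2 by rewrite real_normK// num_real.
  have : C * `|h| ^+ 3 <= h ^+ 2 / 4.
    rewrite exprS mulrA h2 [leRHS]mulrC ler_wpM2r ?sqr_ge0//.
    by apply: le_trans (ler_wpM2l C0 hd) _; rewrite -div1r.
  lra.
(* Here 64 is the cube of 4, from the range [|h| <= 4 * |x|]; with [|x| <= d / 8] the expression is
   nonpositive at distance [d]. *)
exists (64 * C), (d / 8); split; first by rewrite mulr_ge0.
  by rewrite divr_gt0.
move=> x xd; have x3 : 0 <= 64 * C * `|x| ^+ 3 by rewrite !mulr_ge0// exprn_ge0.
have R0 : 0 <= x ^+ 2 / 2 + 64 * C * `|x| ^+ 3.
  by rewrite addr_ge0// divr_ge0// sqr_ge0.
have hx_le h : h * x <= `|h| * `|x| by rewrite -normrM ler_norm.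
split=> [h Nh|]; last first.
  exists x.
    by have [] := T x; rewrite // (le_trans xd)// (le_trans _ de)// ler_pdivrMr// ler_peMr// ?ler1n// ltW.
  have [|_] := T x.
    by rewrite (le_trans xd)// (le_trans _ de)// ler_pdivrMr// ler_peMr// ?ler1n// ltW.
  have : 0 <= C * `|x| ^+ 3 by rewrite mulr_ge0// exprn_ge0.
  by rewrite ler_norml => ? /andP[_]; rewrite expr2; lra.
have [hd|hd] := leP `|h| d.
  have [h4|h4] := leP `|h| (4 * `|x|).
    have [_] := T h (le_trans hd de); rewrite ler_norml => /andP[kl _].
    have : C * `|h| ^+ 3 <= C * (4 * `|x|) ^+ 3.
      by rewrite ler_wpM2l// lerXn2r// nnegrE// mulr_ge0.
    rewrite exprMn => h3; have := sqr_ge0 (h - x); rewrite sqrrB.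
    move: kl h3; set a := C * `|h| ^+ 3; set b := `|x| ^+ 3; lra.
  apply: le_trans R0; have := low h hd; have := hx_le h.
  have : `|h| * (4 * `|x|) <= `|h| * `|h| by rewrite ler_wpM2l// ltW.
  rewrite -[`|h| * `|h|]expr2 real_normK ?num_real//; lra.
apply: le_trans R0.
have h0 : h != 0 by rewrite -normr_gt0 (lt_trans d0).
pose t := d / `|h|.
have hn : 0 < `|h| by rewrite normr_gt0.
have t0 : 0 < t by rewrite divr_gt0.
have t1 : t < 1 by rewrite ltr_pdivrMr// mul1r.
have := std_cumulant_ray Nh t0 t1 h0.
have th : `|t * h| = d by rewrite normrM (gtr0_norm t0) /t divfK// gt_eqF.
have := low (t * h); rewrite th lexx => /(_ isT).
have := hx_le (t * h); rewrite th.
have : d * `|x| <= d * (d / 8) by rewrite ler_wpM2l// ltW.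
have : (t * h) ^+ 2 = d ^+ 2 by rewrite -th real_normK// num_real.
move=> -> dx thx l1 l2.
have : t * (h * x - std_cumulant h) <= 0.
  have := sqr_ge0 d; rewrite mulrBr mulrA; move: l1 l2 thx dx; rewrite expr2; lra.
by rewrite pmulr_rle0.
Qed.

Section likelihood_ratio.
Variables (n d : nat) (y : grid n d -> R) (A : {set grid n d}).
Local Notation card := (#|A|%:R : R).

Definition std_sum : R := \sum_(i in A) (y i - m) / sd.

Lemma prod_pdf h : \prod_(i in A) expfam_pdf nu (theta0 + h / sd) (y i) =
  \prod_(i in A) expfam_pdf nu theta0 (y i) * expR (h * std_sum - card * std_cumulant h).
Proof.
have -> : expR (h * std_sum - card * std_cumulant h) =
    \prod_(i in A) expR (h * ((y i - m) / sd) - std_cumulant h).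
  by rewrite -expR_sum sumrB sumr_const -mulr_sumr -/std_sum [#|A|%:R * _]mulr_natl.
rewrite -big_split; apply: eq_bigr => i _ /=; rewrite /expfam_pdf -expRD.
congr expR; rewrite /std_cumulant; field.
by rewrite gt_eqF// expfam_sd_gt0.
Qed.

(** The bound [up] makes the supremum finite, and the competitor [h = 0], that is [theta0] itself,
    makes the logarithm nonnegative. This brings the statistic from the extended reals to an
    ordinary square root. *)
Lemma local_lr_bounds (lo up : R) : 0 <= up ->
  (forall h, N (theta0 + h / sd) -> h * std_sum - card * std_cumulant h <= up) ->
  (exists2 h, N (theta0 + h / sd) & lo <= h * std_sum - card * std_cumulant h) ->
  exists l : R, [/\ local_lr nu theta0 y A = (Num.sqrt (2 * l))%:E,
    0 <= l, lo <= l & l <= up].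
Proof.
move=> up0 hup [h0 Nh0 hlo].
pose p0 := \prod_(i in A) expfam_pdf nu theta0 (y i).
have p00 : 0 < p0 by apply: prodr_gt0 => i _; exact: expR_gt0.
pose S := [set (\prod_(i in A) expfam_pdf nu theta (y i))%:E | theta in N].
have Sth theta : theta0 + ((theta - theta0) * sd) / sd = theta.
  by rewrite mulfK ?subrKC// gt_eqF// expfam_sd_gt0.
have Sup : (ereal_sup S <= (p0 * expR up)%:E)%E.
  apply: ge_ereal_sup => _ [theta Nt <-]; rewrite lee_fin -{1}(Sth theta) prod_pdf.
  by rewrite ler_wpM2l ?(ltW p00)// ler_expR hup// Sth.
have Slo h : N (theta0 + h / sd) ->
    ((p0 * expR (h * std_sum - card * std_cumulant h))%:E <= ereal_sup S)%E.
  by move=> Nh; apply: ereal_sup_ubound; exists (theta0 + h / sd) => //; rewrite prod_pdf.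
have Sfin : ereal_sup S \is a fin_num.
  rewrite fin_numE; apply/andP; split; apply/eqP => E.
    by have := Slo _ Nh0; rewrite E leeNy_eq.
  by move: Sup; rewrite E leye_eq.
pose s := fine (ereal_sup S).
have sE : ereal_sup S = s%:E by rewrite fineK.
rewrite sE in Sup Slo.
have N0 : N (theta0 + 0 / sd) by rewrite mul0r addr0.
have s0 : p0 <= s.
  by have := Slo 0 N0; rewrite std_cumulant0 mul0r mulr0 subrr expR0 mulr1 lee_fin.
have sp : 0 < s := lt_le_trans p00 s0.
exists (ln (s / p0)); split.
- rewrite /local_lr -/S sE inver (gt_eqF p00) -EFinM.
  by rewrite lne_EFin ?divr_gt0// -EFinM.
- by rewrite ln_ge0// ler_pdivlMr// mul1r.
- apply: le_trans hlo _; rewrite -[leLHS]expRK ler_ln ?posrE ?expR_gt0 ?divr_gt0//.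
  by rewrite ler_pdivlMr// mulrC -lee_fin; exact: Slo.
- rewrite -[leRHS]expRK ler_ln ?posrE ?expR_gt0 ?divr_gt0//.
  by rewrite ler_pdivrMr// mulrC -lee_fin.
Qed.

End likelihood_ratio.

(** With [x = Z / q], [q] the square root of the cardinality, the logarithm of the ratio is [q ^+ 2]
    times the Legendre transform at [x], so the squared statistic differs from [Z ^+ 2] by at most
    [2 * C * |Z| ^+ 3 / q]. Division by [t + |Z| >= |Z|] gives the claim; for [Z = 0] the statistic
    is forced to be 0. *)
Lemma local_lr_expansion : exists C e : R, [/\ 0 <= C, 0 < e &
  forall n d (y : grid n d -> R) (A : {set grid n d}), (0 < #|A|)%N ->
  let Z := (Num.sqrt #|A|%:R)^-1 * std_sum y A in
  `|Z| <= e * Num.sqrt #|A|%:R ->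
  exists2 t : R, local_lr nu theta0 y A = t%:E &
    `|t - `|Z| | <= C * Z ^+ 2 / Num.sqrt #|A|%:R].
Proof.
have [C [e [C0 e0 L]]] := legendre_expansion.
exists (2 * C), e; split => //; first by rewrite mulr_ge0.
move=> n d y A A0 Z Ze.
set q := Num.sqrt #|A|%:R in Z Ze *.
have q0 : 0 < q by rewrite sqrtr_gt0 ltr0n.
have q2 : q ^+ 2 = #|A|%:R by rewrite sqr_sqrtr.
pose x := Z / q.
have xe : `|x| <= e by rewrite normrM normfV (gtr0_norm q0) ler_pdivrMr.
have [Lup [h0 Nh0 Llo]] := L x xe.
have sx : std_sum y A = q ^+ 2 * x by rewrite /x /Z; field; rewrite gt_eqF.
have E h : h * std_sum y A - #|A|%:R * std_cumulant h = q ^+ 2 * (h * x - std_cumulant h).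
  by rewrite sx -q2; ring.
have qq : 0 <= q ^+ 2 by exact: sqr_ge0.
have r0 : 0 <= C * `|x| ^+ 3 by rewrite mulr_ge0// exprn_ge0.
have [| | |l [-> l0 lo up]] := @local_lr_bounds n d y A
  (q ^+ 2 * (x ^+ 2 / 2 - C * `|x| ^+ 3)) (q ^+ 2 * (x ^+ 2 / 2 + C * `|x| ^+ 3)).
- by rewrite mulr_ge0// addr_ge0// divr_ge0// sqr_ge0.
- by move=> h Nh; rewrite E ler_wpM2l// Lup.
- by exists h0 => //; rewrite E ler_wpM2l.
exists (Num.sqrt (2 * l)) => //.
set t := Num.sqrt _.
have t0 : 0 <= t by exact: sqrtr_ge0.
have t2 : t ^+ 2 = 2 * l by rewrite sqr_sqrtr// mulr_ge0.
have xZ : x * q = Z by rewrite /x divfK// gt_eqF.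
have [Z0|Z0] := eqVneq Z 0.
  have l00 : l = 0.
    apply/eqP; rewrite eq_le l0 andbT (le_trans up)//.
    by rewrite /x Z0 mul0r normr0 !expr0n/= mul0r mulr0 addr0 mulr0.
  by rewrite /t l00 mulr0 sqrtr0 Z0 normr0 subrr normr0 expr0n/= mulr0 mul0r.
have Zp : 0 < `|Z| by rewrite normr_gt0.
have tZ : 0 < t + `|Z| by rewrite ltr_wpDl.
have key : `|t - `|Z| | * (t + `|Z|) <= 2 * C * Z ^+ 2 / q * `|Z|.
  rewrite -[X in _ * X <= _](gtr0_norm tZ) -normrM.
  have -> : (t - `|Z|) * (t + `|Z|) = 2 * l - Z ^+ 2.
    by rewrite -t2 -(real_normK (num_real Z)); ring.
  have -> : 2 * C * Z ^+ 2 / q * `|Z| = 2 * (q ^+ 2 * (C * `|x| ^+ 3)).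
    rewrite -(real_normK (num_real Z)) -xZ normrM (gtr0_norm q0); field.
    by rewrite gt_eqF.
  have -> : Z ^+ 2 = 2 * (q ^+ 2 * (x ^+ 2 / 2)) by rewrite -xZ; field.
  rewrite ler_norml; apply/andP; split; move: lo up; lra.
have r1 : 0 <= 2 * C * Z ^+ 2 / q.
  by rewrite divr_ge0 ?(ltW q0)// mulr_ge0 ?sqr_ge0// mulr_ge0.
rewrite -(ler_pM2r Zp); apply: le_trans key.
by rewrite ler_wpM2l// lerDr.
Qed.

End exponential_family_expansion.

(** * Measurability of the likelihood ratio statistic *)

Section measurability.
Context {R : realType}.
Local Notation TR := (measurableTypeR R).

Lemma measurable_fun_gt d (T : measurableType d) (f : T -> \bar R) :
  (forall a : R, measurable [set w | (a%:E < f w)%E]) -> measurable_fun [set: T] f.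
Proof.
move=> H; apply: (measurability _ (ErealGenOInfty.measurableE R)) => _ [_ [a ->] <-].
rewrite setTI (_ : _ @^-1` _ = [set w | (a%:E < f w)%E]) ?H//.
by apply/seteqP; split=> w /=; rewrite in_itv/= andbT.
Qed.

(** Reduces superlevel sets of the statistic to those of the ratio inside the logarithm, the
    infinite and nonpositive values included. *)
Lemma sqrte_lne_gt (a : R) (x : \bar R) : 0 <= a ->
  (a%:E < sqrte (2%:E * lne x))%E = ((expR (a ^+ 2 / 2))%:E < x)%E.
Proof.
have two : (0 < 2%:E :> \bar R)%E by rewrite lte_fin.
have sNy : (a%:E < sqrte (2%:E * -oo))%E = (a < 0).
  by rewrite gt0_muleNy// -[sqrte _]/(0%:E) lte_fin.
move=> a0; case: x => [r| |]; rewrite /lne.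
- case: ifPn => r0.
    rewrite sNy ltNge a0 lte_fin; apply/esym/negbTE.
    by rewrite -leNgt (le_trans r0)// expR_ge0.
  rewrite -ltNge in r0; rewrite -EFinM /= !lte_fin.
  rewrite -[in RHS](lnK r0) ltr_expR ltr_pdivrMr// [in RHS]mulrC.
  have [l0|l0] := leP 0 (2 * ln r).
    by rewrite -(ltr_pXn2r (ltn0Sn 1)) ?nnegrE ?sqrtr_ge0// sqr_sqrtr.
  rewrite ler0_sqrtr; last exact: ltW.
  by rewrite ltNge a0; apply/esym/negbTE; rewrite -leNgt (le_trans (ltW l0))// sqr_ge0.
- by rewrite gt0_muley//= !ltry.
- by rewrite sNy ltNge a0.
Qed.

Variables (nu : set TR -> \bar R) (theta0 : R).

Definition max_likelihood (k : nat) (s : R) : \bar R :=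
  ereal_sup [set (expR (theta * s - k%:R * cumulant nu theta))%:E |
    theta in natural_space nu].

(** A supremum over uncountably many parameters: each function is continuous in [s], so superlevel
    sets are unions of open sets. *)
Lemma measurable_max_likelihood k : measurable_fun [set: R] (max_likelihood k).
Proof.
apply: lower_semicontinuous_measurable; apply/lower_semicontinuousP => a.
have -> : [set s | (a%:E < max_likelihood k s)%E] =
    \bigcup_(theta in natural_space nu)
      [set s | a < expR (theta * s - k%:R * cumulant nu theta)].
  apply/seteqP; split=> s /=.
    move=> /ereal_sup_gt[_ [theta Nt <-]]; rewrite lte_fin => h.
    by exists theta.
  move=> [theta Nt h]; apply: lt_le_trans (_ : (_ < (expR (theta * s - k%:R * cumulant nu theta))%:E)%E) _.
    by rewrite lte_fin.
  by apply: ereal_sup_ubound; exists theta.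
apply: bigcup_open => theta _.
apply: (@open_comp _ _ (fun s : R => expR (theta * s - k%:R * cumulant nu theta)) [set x | a < x]).
  move=> s _; apply: continuous_comp; last exact: continuous_expR.
  apply: continuousB; last exact: cvg_cst.
  apply: continuousM; [exact: cvg_cst|exact: cvg_id].
exact: open_gt.
Qed.

Section fields.
Context d (T : measurableType d) (P : probability T R) (n dd : nat).
Variable Y : grid n dd -> {RV P >-> R}.

(** The sum of the observations is a sufficient statistic, so the supremum becomes a function of one
    real variable. *)
Lemma local_lrE (y : grid n dd -> R) (A : {set grid n dd}) :
  let s := \sum_(i in A) y i in
  local_lr nu theta0 y A = sqrte (2%:E * lne (max_likelihood #|A| s *
    (expR (- (theta0 * s - #|A|%:R * cumulant nu theta0)))%:E))%E.
Proof.
move=> s.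
have E theta : \prod_(i in A) expfam_pdf nu theta (y i) =
    expR (theta * s - #|A|%:R * cumulant nu theta).
  by rewrite -expR_sum sumrB sumr_const mulr_natl mulr_sumr.
have SE : [set (\prod_(i in A) expfam_pdf nu theta (y i))%:E |
      theta in natural_space nu] =
    [set (expR (theta * s - #|A|%:R * cumulant nu theta))%:E |
      theta in natural_space nu].
  by apply: eq_imagel => theta _; rewrite E.
by rewrite /local_lr SE E inver (gt_eqF (expR_gt0 _)) expRN.
Qed.

Lemma measurable_local_lr (A : {set grid n dd}) :
  measurable_fun [set: T] (fun w => local_lr nu theta0 (fun i => Y i w) A).
Proof.
pose S w := \sum_(i in A) Y i w.
have mS : measurable_fun [set: T] S.
  rewrite /S; under eq_fun do rewrite big_mkcond.
  apply: measurable_sum => i; case: (i \in A) => //.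
pose u w := (max_likelihood #|A| (S w) *
   (expR (- (theta0 * S w - #|A|%:R * cumulant nu theta0)))%:E)%E.
have mu : measurable_fun [set: T] u.
  apply: emeasurable_funM.
    exact: (measurableT_comp (measurable_max_likelihood #|A|) mS).
  apply/measurable_EFinP; apply: measurableT_comp => //.
  apply: measurableT_comp => //; apply: measurable_funB => //.
  exact: measurable_funM.
apply: measurable_fun_gt => a.
have [a0|a0] := ltP a 0.
  rewrite (_ : [set w | _] = setT)//; apply/seteqP; split=> // w _ /=.
  by apply: lt_le_trans (sqrte_ge0 _); rewrite lte_fin.
have -> : [set w | (a%:E < local_lr nu theta0 (fun i => Y i w) A)%E] =
    u @^-1` `](expR (a ^+ 2 / 2))%:E, +oo[.
  apply/seteqP; split=> w; rewrite /= local_lrE -/(S w) -/(u w) sqrte_lne_gt//.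
    by rewrite in_itv/= andbT.
  by rewrite in_itv/= andbT.
by rewrite -[X in measurable X]setTI; apply: mu => //; exact: emeasurable_itv.
Qed.

End fields.
End measurability.

(** * Coupling *)

Section coupling.
Context {R : realType}.

Lemma maximal_coupling (K : nat) (p q : nat -> R) :
  (forall i, 0 <= p i) -> (forall i, 0 <= q i) ->
  \sum_(i < K) p i = 1 -> \sum_(i < K) q i = 1 ->
  exists pi : nat -> nat -> R, [/\ forall i j, 0 <= pi i j,
    forall i : 'I_K, \sum_(j < K) pi i j = p i,
    forall j : 'I_K, \sum_(i < K) pi i j = q j &
    forall i, Num.min (p i) (q i) <= pi i i].
Proof.
move=> p0 q0 p1 q1.
pose m i := Num.min (p i) (q i).
have [s sE] : exists s, s = 1 - \sum_(i < K) m i by eexists.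
have mp i : m i <= p i by rewrite /m ge_min lexx.
have mq i : m i <= q i by rewrite /m ge_min lexx orbT.
have m0 i : 0 <= m i by rewrite /m le_min p0 q0.
have s0 : 0 <= s by rewrite sE subr_ge0 -p1 ler_sum.
have sp : \sum_(i < K) (p i - m i) = s by rewrite sumrB p1 sE.
have sq : \sum_(i < K) (q i - m i) = s by rewrite sumrB q1 sE.
have E (g : nat -> R) (i : 'I_K) : (forall i, m i <= g i) ->
    \sum_(i < K) (g i - m i) = s -> (g i - m i) * (s / s) = g i - m i.
  move=> mg sg; have [s1|s1] := eqVneq s 0; last by rewrite divff// mulr1.
  suff -> : g i - m i = 0 by rewrite mul0r.
  apply/eqP; rewrite eq_le subr_ge0 mg andbT -[leRHS]s1 -sg (bigD1 i)//= lerDl.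
  by apply: sumr_ge0 => k _; rewrite subr_ge0.
(* The diagonal mass [min p q] plus the normalized product of the excesses; if
   [s = 0] both excesses vanish and so does the quotient. *)
exists (fun i j => (i == j)%:R * m i + (p i - m i) * (q j - m j) / s); split.
- by move=> i j; rewrite addr_ge0 ?mulr_ge0 ?invr_ge0 ?subr_ge0// .
- move=> i; rewrite big_split/= (bigD1 i)//= eqxx mul1r big1 ?addr0; last first.
    by move=> j; rewrite -val_eqE eq_sym/= => /negbTE ->; rewrite mul0r.
  by rewrite -mulr_suml -mulr_sumr sq -mulrA E// subrKC.
- move=> j; rewrite big_split/= (bigD1 j)//= eqxx mul1r big1 ?addr0; last first.
    by move=> i; rewrite -val_eqE/= => /negbTE ->; rewrite mul0r.
  by rewrite -mulr_suml -mulr_suml sp mulrAC mulrC mulrA -mulrA E// subrKC.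
- by move=> i; rewrite eqxx mul1r lerDl !mulr_ge0 ?invr_ge0 ?subr_ge0//.
Qed.

Section product_coupling.
Context d1 d2 (T1 : measurableType d1) (T2 : measurableType d2).
Variables (Q1 : probability T1 R) (Q2 : probability T2 R) (K : nat).
Variables (c1 : T1 -> nat) (c2 : T2 -> nat).
Hypotheses (c1K : forall x, (c1 x < K)%N) (c2K : forall x, (c2 x < K)%N).
Hypotheses (mc1 : forall i, measurable (c1 @^-1` [set i]))
  (mc2 : forall i, measurable (c2 @^-1` [set i])).

Let p i := fine (Q1 (c1 @^-1` [set i])).
Let q i := fine (Q2 (c2 @^-1` [set i])).

Lemma probability_cells d (T : measurableType d) (Q : probability T R)
    (c : T -> nat) (A : set T) :
  (forall x, (c x < K)%N) -> (forall i, measurable (c @^-1` [set i])) ->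
  measurable A -> (\sum_(i < K) Q (A `&` c @^-1` [set val i]) = Q A)%E.
Proof.
move=> cK mc mA; rewrite -(@measure_bigsetU _ _ _ Q (fun i => A `&` c @^-1` [set i]))//; last first.
- by move=> i j _ _ [x [[_ <-] [_]]].
- by move=> i; exact: measurableI.
congr (Q _); rewrite -(bigcup_mkord K (fun i => A `&` c @^-1` [set i])).
by apply/seteqP; split=> [x [i _ []]|x Ax]//; exists (c x) => //=; exact: cK.
Qed.

(** The cells are coupled maximally and, given the pair of cells, the two points are independent.
    The marginals are right because the rows and columns of [pi] sum to [p] and [q]. *)
Lemma product_coupling : exists P : probability (T1 * T2)%type R,
  [/\ forall A, measurable A -> P (A `*` setT) = Q1 A,
      forall B, measurable B -> P (setT `*` B) = Q2 B &
      (P [set z | c1 z.1 <> c2 z.2] <=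
        (\sum_(i < K) (q i - Num.min (p i) (q i)))%:E)%E].
Proof.
have pE i : Q1 (c1 @^-1` [set i]) = (p i)%:E by rewrite fineK ?fin_num_measure.
have qE i : Q2 (c2 @^-1` [set i]) = (q i)%:E by rewrite fineK ?fin_num_measure.
have p0 i : 0 <= p i by rewrite fine_ge0.
have q0 i : 0 <= q i by rewrite fine_ge0.
have p1 : \sum_(i < K) p i = 1.
  apply: EFin_inj; rewrite -sumEFin -[RHS](probability_setT Q1).
  rewrite -(probability_cells Q1 c1K mc1 measurableT).
  by apply: eq_bigr => i _; rewrite setTI pE.
have q1 : \sum_(i < K) q i = 1.
  apply: EFin_inj; rewrite -sumEFin -[RHS](probability_setT Q2).
  rewrite -(probability_cells Q2 c2K mc2 measurableT).
  by apply: eq_bigr => i _; rewrite setTI qE.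
have [pi [pi0 pip piq pim]] := maximal_coupling p0 q0 p1 q1.
have w0 i j : 0 <= pi i j / (p i * q j) by rewrite divr_ge0 ?mulr_ge0.
have mcell i j : measurable ((c1 @^-1` [set i]) `*` (c2 @^-1` [set j])).
  exact: measurableX.
pose mu := msum (fun i => msum (fun j =>
  mscale (NngNum (w0 i j)) (mrestr (Q1 \x Q2)%E (mcell i j))) K) K.
have muD E : mu E = (\sum_(i < K) \sum_(j < K) (pi i j / (p i * q j))%:E *
    (Q1 \x Q2) (E `&` (c1 @^-1` [set val i]) `*` (c2 @^-1` [set val j])))%E by [].
have muE A B : measurable A -> measurable B -> mu (A `*` B) =
    (\sum_(i < K) \sum_(j < K) (pi i j / (p i * q j))%:E *
      (Q1 (A `&` c1 @^-1` [set val i]) * Q2 (B `&` c2 @^-1` [set val j])))%E.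
  move=> mA mB; apply: eq_bigr => i _; apply: eq_bigr => j _.
  by rewrite -product_measure1E ?setXI//; exact: measurableI.
(* If a cell has mass 0, division by it gives 0; this is consistent because [pi i j] is at most
   [p i] and at most [q j]. *)
have cancelM (w u x t : R) : 0 <= w <= t -> w / (u * t) * (x * t) = w * x / u.
  have [-> /andP[w1 w2]|t0 _] := eqVneq t 0; last first.
    by rewrite invfM -!mulrA (mulrC x t) mulKf// (mulrC x).
  by rewrite (_ : w = 0) ?mul0r//; apply/eqP; rewrite eq_le w1 w2.
have piP (i j : 'I_K) : pi i j <= p i.
  by rewrite -pip (bigD1 j)//= lerDl sumr_ge0.
have piQ (i j : 'I_K) : pi i j <= q j.
  by rewrite -piq (bigD1 i)//= lerDl sumr_ge0.
have absorb (u x : R) : 0 <= x <= u -> u * x / u = x.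
  have [-> x0|u0 _] := eqVneq u 0; last by rewrite mulrAC divff// mul1r.
  by rewrite mul0r mul0r; apply/eqP; rewrite eq_le.
have mu1A A : measurable A -> mu (A `*` setT) = Q1 A.
  move=> mA; rewrite muE// -(probability_cells Q1 c1K mc1 mA).
  apply: eq_bigr => i _; pose x := fine (Q1 (A `&` c1 @^-1` [set val i])).
  have xE : Q1 (A `&` c1 @^-1` [set val i]) = x%:E.
    by rewrite fineK ?fin_num_measure//; exact: measurableI.
  rewrite xE.
  have x01 : 0 <= x <= p i.
    rewrite fine_ge0//= fine_le ?fin_num_measure ?le_measure ?inE//; exact: measurableI.
  under eq_bigr => j _ do rewrite setTI qE -!EFinM cancelM ?pi0 ?piQ//.
  by rewrite sumEFin -!mulr_suml pip absorb.
have mu2B B : measurable B -> mu (setT `*` B) = Q2 B.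
  move=> mB; rewrite muE// exchange_big/= -(probability_cells Q2 c2K mc2 mB).
  apply: eq_bigr => j _; pose x := fine (Q2 (B `&` c2 @^-1` [set val j])).
  have xE : Q2 (B `&` c2 @^-1` [set val j]) = x%:E.
    by rewrite fineK ?fin_num_measure//; exact: measurableI.
  rewrite xE.
  have x01 : 0 <= x <= q j.
    rewrite fine_ge0//= fine_le ?fin_num_measure ?le_measure ?inE//; exact: measurableI.
  under eq_bigr => i _ do rewrite setTI pE -!EFinM (mulrC (p i)) (mulrC (p i)) cancelM ?pi0 ?piP//.
  by rewrite sumEFin -!mulr_suml piq absorb.
have muT : mu setT = 1%E by rewrite -setXTT mu1A// probability_setT.
pose isP := Measure_isProbability.Build _ _ _ mu muT.
pose P : probability (T1 * T2)%type R := HB.pack mu isP.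
exists P; split => //.
have -> : P [set z | c1 z.1 <> c2 z.2] =
    (\sum_(i < K) \sum_(j < K | j != i) (pi i j / (p i * q j) * (p i * q j))%:E)%E.
  rewrite -[P _]/(mu _) muD; apply: eq_bigr => i _; rewrite [RHS]big_mkcond/=; apply: eq_bigr => j _.
  case: ifPn => ji.
    rewrite setIidr; last by move=> z [/= -> ->] /val_inj ij; rewrite ij eqxx in ji.
    rewrite product_measure1E// [RHS]EFinM [X in _ = (_ * X)%E]EFinM; congr (_ * (_ * _))%E; [exact: pE|exact: qE].
  rewrite (_ : _ `&` _ = set0) ?measure0 ?mule0//; move: ji; rewrite negbK => /eqP ->.
  by apply/seteqP; split=> // z [/= + [e1 e2]]; rewrite e1 e2.
under eq_bigr do rewrite sumEFin.
rewrite sumEFin lee_fin.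
apply: (@le_trans _ _ (\sum_(i < K) (p i - pi i i))).
  apply: ler_sum => i _; rewrite -[in leRHS]pip [in leRHS](bigD1 i)//= addrAC subrr add0r.
  apply: ler_sum => j _; rewrite (mulrC (p i) (q j)) [q j * _]mulrC.
  rewrite cancelM ?pi0 ?piQ// mulrAC.
  have [->|pi_n0] := eqVneq (p i) 0; first by rewrite mulr0 pi0.
  by rewrite divfK.
rewrite [leRHS]sumrB q1 -p1 -sumrB; apply: ler_sum => i _.
exact: lerB.
Qed.
End product_coupling.
End coupling.

(** * Coupling two real statistics through cells *)

Section cell_coupling.
Context {R : realType}.

Section cells.
Variables (t0 w : R) (K : nat).
Hypothesis w0 : 0 <= w.

(** The number of cut points below [x]. The [K] cut points give [K.+1] cells, of which those
    numbered 0 and [K] are unbounded. *)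
Definition cell (x : R) : nat := \sum_(0 <= i < K) (t0 + i%:R * w < x)%R.

Lemma cell_max x : (cell x < K.+1)%N.
Proof.
rewrite ltnS -[leqRHS]subn0 -[leqRHS]muln1 -sum_nat_const_nat.
by apply: leq_sum => i _; case: (_ < _)%R.
Qed.

Lemma cell_le x i : (i < K)%N -> (cell x <= i)%N = (x <= t0 + i%:R * w).
Proof.
move=> iK; rewrite leNgt; have [h|h] /= := ltP.
- apply/negbTE; rewrite -ltnNge /cell (big_cat_nat _ (n := i.+1))//=.
  rewrite big_nat (eq_bigr (fun=> 1%N)) -?big_nat.
    by rewrite sum_nat_const_nat subn0 muln1 leq_addr.
  move=> j; rewrite ltnS => ji; suff -> : (t0 + j%:R * w < x)%R by []; apply: le_lt_trans h.
  by rewrite lerD2l ler_wpM2r// ler_nat.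
- apply/idP; rewrite /cell (big_cat_nat _ (n := i))//=; last exact: ltnW.
  rewrite [X in (_ + X)%N]big_nat_cond [X in (_ + X)%N]big1 => [|j]; last first.
    rewrite andbT => /andP[ij _]; apply/eqP; rewrite eqb0 -leNgt.
    by apply: le_trans h _; rewrite lerD2l ler_wpM2r// ler_nat.
  rewrite addn0 -[leqRHS]subn0 -[leqRHS]muln1 -sum_nat_const_nat.
  by apply: leq_sum => j _; case: (_ < _)%R.
Qed.

Lemma cell_preimage i : cell @^-1` [set i] =
  [set x | (i < K)%N ==> (x <= t0 + i%:R * w)] `&`
  [set x | (0 < i <= K)%N ==> (t0 + i.-1%:R * w < x)] `&` [set x | (i <= K)%N].
Proof.
apply/seteqP; split=> x /=.
  move=> <-; split; last by rewrite -ltnS cell_max.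
  split; apply/implyP => h; first by rewrite -cell_le.
  move: h => /andP[h1 h2]; rewrite ltNge -cell_le ?prednK//.
  by rewrite -ltnNge prednK.
move=> [[h1 h2] iK]; apply/eqP; rewrite eqn_leq; apply/andP; split.
  move: h1; rewrite leq_eqVlt in iK; move: iK => /orP[/eqP ->|iK].
    by move=> _; exact: cell_max.
  by rewrite iK /= cell_le.
case: i h1 h2 iK => // i _ h2 iK; move: h2; rewrite iK /= ltNge -cell_le//.
by rewrite -ltnNge.
Qed.

Lemma measurable_cell i : measurable (cell @^-1` [set i] : set R).
Proof.
rewrite cell_preimage; apply: measurableI; first apply: measurableI.
- case: (i < K)%N => /=; last by rewrite (_ : [set _ | _] = setT)//; apply/seteqP.
  by rewrite (_ : [set _ | _] = `]-oo, t0 + i%:R * w]%classic)//; apply/seteqP; split=> x; rewrite /= in_itv.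
- case: (0 < i <= K)%N => /=; last by rewrite (_ : [set _ | _] = setT)//; apply/seteqP.
  by rewrite (_ : [set _ | _] = `]t0 + i.-1%:R * w, +oo[%classic)//; apply/seteqP; split=> x; rewrite /= in_itv/= andbT.
- case: (i <= K)%N => /=; first by rewrite (_ : [set _ | _] = setT)//; apply/seteqP.
  by rewrite (_ : [set _ | _] = set0)//; apply/seteqP; split=> x.
Qed.

Lemma cell_dist x y : cell x = cell y -> (0 < cell y < K)%N -> `|x - y| <= w.
Proof.
move=> xy /andP[y0 yK].
have bnd u : cell u = cell y -> t0 + (cell y).-1%:R * w < u <= t0 + (cell y)%:R * w.
  move=> e; rewrite -cell_le ?e// leqnn andbT ltNge -cell_le ?prednK//; last exact: ltnW.
  by rewrite e -ltnNge prednK.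
have [/andP[x1 x2] /andP[y1 y2]] := (bnd x xy, bnd y erefl).
have E : (cell y)%:R = (cell y).-1%:R + 1 :> R by rewrite natr1 prednK.
rewrite E in x2 y2; rewrite ler_norml; apply/andP; split; lra.
Qed.
End cells.

Section one_space.
Context d (T : measurableType d) (Q : probability T R) (S : T -> R).
Hypothesis mS : measurable_fun [set: T] S.
Variables (t0 w : R) (K : nat).
Hypothesis w0 : 0 <= w.

Lemma measurable_sublevel t : measurable [set x | S x <= t].
Proof.
rewrite (_ : [set _ | _] = S @^-1` `]-oo, t]); last first.
  by apply/seteqP; split=> x; rewrite /= in_itv.
by rewrite -[X in measurable X]setTI; exact: mS.
Qed.

Definition cell_cdf (i : nat) : R :=
  fine (Q [set x | (cell t0 w K (S x) <= i)%N]).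

Lemma cell_cdfE i : (i < K)%N -> cell_cdf i = fine (Q [set x | S x <= t0 + i%:R * w]).
Proof.
move=> iK; congr (fine (Q _)).
by apply/seteqP; split=> x /=; rewrite cell_le.
Qed.

Lemma cell_cdf_max : cell_cdf K = 1.
Proof.
rewrite /cell_cdf (_ : [set _ | _] = setT) ?probability_setT//.
by apply/seteqP; split=> x //= _; rewrite -ltnS cell_max.
Qed.

Lemma measurable_cell_preimage i : measurable ((fun x => cell t0 w K (S x)) @^-1` [set i]).
Proof. by rewrite -[X in measurable X]setTI; exact: (mS measurableT (measurable_cell t0 K w0 i)). Qed.

Lemma cell_probS i : (i < K)%N ->
  fine (Q ((fun x => cell t0 w K (S x)) @^-1` [set i.+1])) = cell_cdf i.+1 - cell_cdf i.
Proof.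
move=> iK.
have mE j : (j <= K)%N -> measurable [set x | (cell t0 w K (S x) <= j)%N].
  rewrite leq_eqVlt => /orP[/eqP ->|jK].
    rewrite (_ : [set _ | _] = setT)//; apply/seteqP; split=> x //= _.
    by rewrite -ltnS cell_max.
  rewrite (_ : [set _ | _] = [set x | S x <= t0 + j%:R * w]); first exact: measurable_sublevel.
  by apply/seteqP; split=> x /=; rewrite cell_le.
rewrite (_ : _ @^-1` _ = [set x | (cell t0 w K (S x) <= i.+1)%N] `\`
    [set x | (cell t0 w K (S x) <= i)%N]); last first.
  apply/seteqP; split=> x /=; first by move=> ->; rewrite ltnn.
  move=> [h1 h2]; apply/eqP; rewrite eqn_leq h1/= ltnNge; exact/negP.
have mi := mE _ (ltnW iK); have mi1 := mE _ iK.
rewrite measureD//; last by rewrite ltey_eq fin_num_measure.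
rewrite setIidr; last by move=> x /= /leq_trans; apply.
by rewrite fineB// fin_num_measure.
Qed.
End one_space.

Section two_spaces.
Context d1 d2 (T1 : measurableType d1) (T2 : measurableType d2).
Variables (Q1 : probability T1 R) (Q2 : probability T2 R).
Variables (S1 : T1 -> R) (S2 : T2 -> R).
Hypotheses (mS1 : measurable_fun [set: T1] S1) (mS2 : measurable_fun [set: T2] S2).
Let F1 t := fine (Q1 [set x | S1 x <= t]).
Let F2 t := fine (Q2 [set x | S2 x <= t]).

(** The distance exceeds [w] only if the cells differ or [S2] falls in an unbounded cell. The
    probability of a cell is a difference of the distribution functions at two consecutive cut
    points, so each cut point is counted twice. *)
Lemma cell_coupling (t0 w : R) (K : nat) : 0 <= w -> (0 < K)%N ->
  exists P : probability (T1 * T2)%type R,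
  [/\ forall A, measurable A -> P (A `*` setT) = Q1 A,
      forall B, measurable B -> P (setT `*` B) = Q2 B &
      (P [set z | (w < `|S1 z.1 - S2 z.2|)%R] <=
        (F2 t0 + (1 - F2 (t0 + K.-1%:R * w)) +
         2 * \sum_(i < K) `|F1 (t0 + i%:R * w) - F2 (t0 + i%:R * w)|)%:E)%E].
Proof.
move=> w0 K0; pose c1 x := cell t0 w K (S1 x); pose c2 x := cell t0 w K (S2 x).
have mc1 := measurable_cell_preimage mS1 t0 K w0.
have mc2 := measurable_cell_preimage mS2 t0 K w0.
have [P [P1 P2 Pne]] := @product_coupling _ _ _ _ _ Q1 Q2 K.+1 c1 c2
  (fun x => cell_max _ _ _ _) (fun x => cell_max _ _ _ _) mc1 mc2.
exists P; split=> //.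
set E2 := [set y | S2 y <= t0]; set E3 := ~` [set y | S2 y <= t0 + K.-1%:R * w].
have mE2 : measurable E2 by exact: measurable_sublevel.
have mL : measurable [set y | S2 y <= t0 + K.-1%:R * w] by exact: measurable_sublevel.
have mE3 : measurable E3 by exact: measurableC.
set E1 := [set z | c1 z.1 <> c2 z.2] in Pne.
have mE1 : measurable E1.
  rewrite (_ : E1 = ~` \bigcup_i ((c1 @^-1` [set i]) `*` (c2 @^-1` [set i]))).
    apply: measurableC; apply: bigcup_measurable => i _.
    by apply: measurableX; [exact: mc1|exact: mc2].
  apply/seteqP; split=> z /=; first by move=> h [i _ [/= e1 e2]]; apply: h; rewrite e1 e2.
  by move=> h e; apply: h; exists (c1 z.1).
have mD : measurable [set z : T1 * T2 | w < `|S1 z.1 - S2 z.2|].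
  rewrite (_ : [set _ | _] = (fun z : T1 * T2 => `|S1 z.1 - S2 z.2|) @^-1` `]w, +oo[).
    rewrite -[X in measurable X]setTI.
    have mf : measurable_fun [set: T1 * T2] (fun z => `|S1 z.1 - S2 z.2|).
      apply: measurableT_comp => //; apply: measurable_funB.
        exact: (measurableT_comp mS1 measurable_fst).
      exact: (measurableT_comp mS2 measurable_snd).
    exact: mf.
  by apply/seteqP; split=> z; rewrite /= in_itv/= andbT.
have sub : [set z | w < `|S1 z.1 - S2 z.2|] `<=` E1 `|` (setT `*` E2) `|` (setT `*` E3).
  move=> z /= wz; have [e|] := pselect (c1 z.1 = c2 z.2); last by left; left.
  have [h2|h2] := leP (S2 z.2) t0; first by left; right.
  have [h3|h3] := leP (S2 z.2) (t0 + K.-1%:R * w); last first.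
    by right; split=> //=; apply/negP; rewrite -ltNge.
  exfalso; move: wz; apply/negP; rewrite -leNgt; apply: cell_dist e _ => //.
  rewrite lt0n -leqn0 cell_le// mul0r addr0 -ltNge h2/=.
  by rewrite -(prednK K0) ltnS cell_le// prednK.
have mF2 : measurable ([set: T1] `*` E2) by exact: measurableX.
have mF3 : measurable ([set: T1] `*` E3) by exact: measurableX.
have mU := measurableU _ _ mE1 mF2.
apply: (@le_trans _ _ (P (E1 `|` setT `*` E2 `|` setT `*` E3))).
  by apply: le_measure => //; rewrite inE//; exact: measurableU.
apply: (le_trans (measureU2 _ mU mF3)).
rewrite -[_ + 2 * _]addrC addrA EFinD [X in (_ <= X + _)%E]EFinD.
have PE2 : (P ([set: T1] `*` E2) <= (F2 t0)%:E)%E by rewrite P2// fineK// fin_num_measure.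
have PE3 : (P ([set: T1] `*` E3) <= (1 - F2 (t0 + K.-1%:R * w))%:E)%E.
  rewrite P2// probability_setC// EFinB; apply: leeB => //.
  by rewrite fineK// fin_num_measure.
apply: leeD PE3; apply: (le_trans (measureU2 _ mE1 mF2)); apply: leeD PE2.
apply: (le_trans Pne); rewrite lee_fin.
pose A := cell_cdf Q1 S1 t0 w K; pose B := cell_cdf Q2 S2 t0 w K.
pose D i := `|A i - B i|.
have DK : D K = 0 by rewrite /D /A /B !cell_cdf_max subrr normr0.
have -> : \sum_(i < K) `|F1 (t0 + i%:R * w) - F2 (t0 + i%:R * w)| = \sum_(i < K) D i.
  by apply: eq_bigr => i _; rewrite /D /A /B !cell_cdfE.
have sumS : \sum_(i < K) D i.+1 + D 0 = \sum_(i < K) D i.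
  by rewrite addrC -(big_ord_recl K (fun i => D (val i))) big_ord_recr/= DK addr0.
have minE (x y : R) : x - Num.min y x <= `|y - x|.
  by rewrite minEle distrC; case: ifP => _; [exact: ler_norm|rewrite subrr].
rewrite big_ord_recl (_ : 2 * _ = D 0 + \sum_(i < K) (D i.+1 + D i)); last first.
  by rewrite big_split/= addrA [D 0 + _]addrC sumS; lra.
apply: lerD.
  apply: le_trans (minE _ _) _; rewrite /D /A /B /cell_cdf.
  rewrite (_ : c1 @^-1` _ = [set x | (cell t0 w K (S1 x) <= 0)%N]); last first.
  by apply/seteqP; split=> x; rewrite /= /c1 leqn0 => /eqP.
  rewrite (_ : c2 @^-1` _ = [set x | (cell t0 w K (S2 x) <= 0)%N])//.
  by apply/seteqP; split=> x; rewrite /= /c2 leqn0 => /eqP.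
apply: ler_sum => i _; apply: le_trans (minE _ _) _.
rewrite /c1 /c2 !cell_probS// -/A -/B /D.
rewrite (_ : _ - _ = (A i.+1 - B i.+1) - (A i - B i)); last by ring.
exact: ler_normB.
Qed.
(** The offset [l] moves the cut points to the right by less than [w]: the first one lies below
    [- L + w], and the last one is at least [L] by the assumption on [K]. This accounts for the two
    tail terms. *)
Lemma levy_coupling (delta eta L : R) (m K : nat) : 0 < delta ->
  (0 < m)%N -> (0 < K)%N ->
  (forall t, F1 t <= F2 (t + delta) + eta) ->
  (forall t, F2 t <= F1 (t + delta) + eta) ->
  let w := 2 * delta * m%:R in 2 * L <= K.-1%:R * w ->
  exists P : probability (T1 * T2)%type R,
  [/\ forall A, measurable A -> P (A `*` setT) = Q1 A,
      forall B, measurable B -> P (setT `*` B) = Q2 B &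
      (P [set z | (w < `|S1 z.1 - S2 z.2|)%R] <=
        (F2 (- L + w) + (1 - F2 L) + 2 * (K%:R * eta + m%:R^-1))%:E)%E].
Proof.
move=> d0 m0 K0 F12 F21 w Lw.
have w0 : 0 <= w by rewrite !mulr_ge0// ltW.
have mF t : measurable [set y | S2 y <= t] by exact: measurable_sublevel.
have F2m : {homo F2 : s t / s <= t}.
  move=> s t st; rewrite fine_le ?fin_num_measure//.
  by apply: le_measure; rewrite ?inE// => y /= h; exact: le_trans st.
have F2_ge0 t : 0 <= F2 t by rewrite fine_ge0.
have F2_le1 t : F2 t <= 1.
  by rewrite -lee_fin fineK ?fin_num_measure// probability_le1.
pose H k := F2 (- L + 2 * delta * k - delta).
pose band t := F2 (t + delta) - F2 (t - delta).
have bandP t : `|F1 t - F2 t| <= eta + band t.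
  have := F12 t; have := F21 (t - delta); rewrite subrK /band => h1 h2.
  have h3 : F2 t <= F2 (t + delta) by apply: F2m; rewrite lerDl ltW.
  have h4 : F2 (t - delta) <= F2 t by apply: F2m; rewrite gerBl ltW.
  by rewrite ler_norml; apply/andP; split; lra.
have bandE (l i : nat) : band (- L + 2 * delta * l%:R + i%:R * w) =
    H (i * m + l).+1%:R - H (i * m + l)%:R.
  rewrite /band /H -[(i * m + l).+1%:R]natr1 natrD natrM.
  by congr (F2 _ - F2 _); rewrite /w; ring.
(* The bands around the cut points of the [m] grids tile an interval. *)
have [l lm hl] : exists2 l, (l < m)%N &
    \sum_(i < K) band (- L + 2 * delta * l%:R + i%:R * w) <= m%:R^-1.
  apply: contrapT => hno.
  have : \sum_(l < m) m%:R^-1 < \sum_(l < m) \sum_(i < K)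
      band (- L + 2 * delta * l%:R + i%:R * w).
    apply: ltr_sum => [|l _]; first by apply/hasP; exists (Ordinal m0); rewrite ?mem_index_enum.
    by rewrite ltNge; apply/negP => h; exact: hno (ex_intro2 _ _ (val l) (ltn_ord l) h).
  rewrite sumr_const card_ord -[_ *+ m]mulr_natr mulVf ?pnatr_eq0 -?lt0n// exchange_big/=.
  under eq_bigr => i _.
    under eq_bigr => l _ do rewrite bandE.
    rewrite -(big_mkord xpredT (fun l => H (i * m + l).+1%:R - H (i * m + l)%:R)).
    under eq_bigr => l _ do rewrite -addnS.
    rewrite (telescope_sumr (fun l => H (i * m + l)%N%:R))// addn0 addnC -mulSn.
    over.
  rewrite -(big_mkord xpredT (fun i => H (i.+1 * m)%N%:R - H (i * m)%N%:R)).
  rewrite (telescope_sumr (fun i => H (i * m)%N%:R))//.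
  apply/negP; rewrite -leNgt lerBlDr (le_trans (F2_le1 _))// lerDl; exact: F2_ge0.
have [P [P1 P2 Pw]] := cell_coupling (- L + 2 * delta * l%:R) w0 K0.
exists P; split=> //; apply: (le_trans Pw); rewrite lee_fin; apply: lerD.
  apply: lerD.
    apply: F2m; rewrite lerD2l /w ler_wpM2l// ?mulr_ge0 ?ltW//.
    by rewrite ltr_nat.
  rewrite lerB//; apply: F2m.
  have := mulr_ge0 (mulr_ge0 (ltW (@ltr0Sn R 1)) (ltW d0)) (ler0n R l); lra.
rewrite ler_wpM2l//; apply: (@le_trans _ _ (\sum_(i < K)
    (eta + band (- L + 2 * delta * l%:R + i%:R * w)))).
  by apply: ler_sum => i _; exact: bandP.
by rewrite big_split/= sumr_const card_ord -[eta *+ K]mulr_natl lerD2l.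
Qed.
End two_spaces.
End cell_coupling.

(** * The scan statistics *)

Section scan.
Context {R : realType}.
Local Notation TR := (measurableTypeR R).
Local Notation law := (probability TR R).
Variables (n d : nat) (AA : {set {set grid n d}}) (v : R).
Implicit Types (x : grid n d -> R).

(* The sign in the second component unfolds the absolute value. *)
Definition scan_index : finType :=
  ({A : {set grid n d} | A \in AA} * bool)%type.

Definition scan_dir (j : scan_index) (k : nat) : R :=
  (if insub k is Some i then (@enum_val (grid n d) predT i \in val j.1)%:R else 0) *
  ((-1) ^+ j.2 / Num.sqrt #|val j.1|%:R).

Definition scan_pen (j : scan_index) : R := pen n d v #|val j.1|%:R.

Lemma linform_scan (j : scan_index) x : linform scan_dir j (field_vec x) =
  (-1) ^+ j.2 * ((Num.sqrt #|val j.1|%:R)^-1 * \sum_(i in val j.1) x i).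
Proof.
rewrite /linform (reindex (@enum_rank (grid n d))); last first.
  by apply: onW_bij; exact: enum_rank_bij.
rewrite mulrA mulr_sumr [RHS]big_mkcond; apply: eq_bigr => i _.
rewrite tnth_field_vec /scan_dir valK enum_rankK.
by case: (i \in val j.1); rewrite ?mul1r ?mul0r.
Qed.

Lemma scan_dir_unit (j : scan_index) : (0 < #|val j.1|)%N ->
  \sum_(k < #|{: grid n d}|) scan_dir j k ^+ 2 = 1.
Proof.
move=> A0; rewrite (reindex (@enum_rank (grid n d))); last first.
  by apply: onW_bij; exact: enum_rank_bij.
transitivity (\sum_(i in val j.1) (#|val j.1|%:R : R)^-1).
  rewrite [RHS]big_mkcond; apply: eq_bigr => i _.
  rewrite /scan_dir valK enum_rankK; case: (i \in val j.1).
    by rewrite mul1r expr_div_n sqr_sqrtr ?ler0n// -exprM mulnC exprM sqrrN !expr1n mul1r.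
  by rewrite mul0r expr0n.
by rewrite sumr_const -[_ *+ _]mulr_natl divff// pnatr_eq0 -lt0n.
Qed.

Lemma scan_dir_le (j : scan_index) k (r : R) : 0 < r -> r <= #|val j.1|%:R ->
  `|scan_dir j k| <= (Num.sqrt r)^-1.
Proof.
move=> r0 rA; have sr : 0 < Num.sqrt r by rewrite sqrtr_gt0.
have sle : Num.sqrt r <= Num.sqrt #|val j.1|%:R by rewrite ler_sqrt// (lt_le_trans r0).
rewrite /scan_dir normrM normrM normrX normrN1 expr1n mul1r.
apply: (@le_trans _ _ (1 * (Num.sqrt #|val j.1|%:R)^-1)).
  rewrite [X in _ * X <= _]ger0_norm ?invr_ge0 ?sqrtr_ge0// ler_wpM2r ?invr_ge0 ?sqrtr_ge0//.
  by case: insub => [i|]; rewrite ?normr0//; case: (_ \in _); rewrite ?normr1 ?normr0.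
by rewrite mul1r lef_pV2// posrE (lt_le_trans sr).
Qed.

Lemma card_scan_index : #|scan_index| = (2 * #|AA|)%N.
Proof. by rewrite card_prod card_bool card_sig mulnC. Qed.

Lemma gauss_multiscale_le x q :
  (gauss_multiscale x AA v <= q%:E)%E <-> below scan_dir scan_pen q (field_vec x).
Proof.
split.
  move=> /bigmax_leP[_ h] -[[A AAA] s]; have := h A AAA; rewrite lee_fin linform_scan/=.
  apply: le_trans; rewrite lerD2r; apply: le_trans (ler_norm _) _.
  rewrite normrM normrX normrN1 expr1n mul1r normrM [X in X * _]ger0_norm.
    exact: lexx.
  by rewrite invr_ge0 sqrtr_ge0.
move=> h; apply/bigmax_leP; split; first exact: leNye.
move=> A AAA; rewrite lee_fin; set S := \sum_(i in A) x i.
have := h (Sub A AAA, S < 0); rewrite linform_scan/= -/S.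
apply: le_trans; rewrite lerD2r [leRHS]mulrCA ler_wpM2l ?invr_ge0 ?sqrtr_ge0//.
by have [S0|S0] /= := ltP S 0; rewrite ?expr1 ?expr0 ?mulN1r ?mul1r ?(ltr0_norm S0) ?(ger0_norm S0) lexx.
Qed.

Lemma gauss_multiscale_fin x : AA != finset.set0 -> gauss_multiscale x AA v \is a fin_num.
Proof.
move=> /set0Pn[A AAA]; rewrite fin_numE; apply/andP; split.
  rewrite -ltNye; apply: lt_le_trans (le_bigmax_cond _ _ AAA); exact: ltNyr.
by rewrite -ltey; apply/bigmax_ltP; split => // B _; exact: ltry.
Qed.

Section random.
Context dd (T : measurableType dd) (P : probability T R).
Variables (Y : grid n d -> {RV P >-> R}).

Lemma gauss_multiscale_le_preimage q :
  [set w | (gauss_multiscale (fun i => Y i w) AA v <= q%:E)%E] =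
  (fun w => field_vec (fun i => Y i w)) @^-1` below scan_dir scan_pen q.
Proof. by apply/seteqP; split=> w /=; rewrite gauss_multiscale_le. Qed.

Lemma measurable_gauss_multiscale :
  measurable_fun [set: T] (fun w => gauss_multiscale (fun i => Y i w) AA v).
Proof.
apply: measurable_fun_gt => a.
rewrite (_ : [set _ | _] = ~` [set w | (gauss_multiscale (fun i => Y i w) AA v <= a%:E)%E]).
  apply: measurableC; rewrite gauss_multiscale_le_preimage.
  rewrite -[X in measurable X]setTI; apply: measurable_field_vec => //.
  exact: measurable_below.
by apply/seteqP; split=> w /=; rewrite ltNge => /negP.
Qed.

Lemma gauss_multiscale_law (mu : law) q : iid_field Y mu ->
  P [set w | (gauss_multiscale (fun i => Y i w) AA v <= q%:E)%E] =
  prod_law #|{: grid n d}| (fun=> mu) (below scan_dir scan_pen q).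
Proof.
move=> iY; rewrite gauss_multiscale_le_preimage.
by apply: iid_field_law => //; exact: measurable_below.
Qed.

Lemma measurable_multiscale (nu : set TR -> \bar R) theta0 :
  measurable_fun [set: T] (fun w => multiscale nu (fun i => Y i w) theta0 AA v).
Proof.
rewrite /multiscale /index_enum; elim: (Finite.enum _) => [|A s IH].
  by under eq_fun do rewrite big_nil; exact: measurable_cst.
under eq_fun do rewrite big_cons; case: (A \in AA) => //.
apply: measurable_maxe => //; apply: emeasurable_funB => //.
exact: measurable_local_lr.
Qed.
End random.

(** Both maxima carry the same penalties, and a maximum is 1-Lipschitz in its entries. *)
Lemma multiscale_approx (nu : set TR -> \bar R) (F : R -> law) theta0 (y : grid n d -> R) e :
  AA != finset.set0 ->
  (forall A, A \in AA -> exists2 t : R, local_lr nu theta0 y A = t%:E &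
    `|t - `|(Num.sqrt #|A|%:R)^-1 * std_sum F theta0 y A| | <= e) ->
  exists2 t : R, multiscale nu y theta0 AA v = t%:E &
    `|t - fine (gauss_multiscale (fun i => standardize F theta0 (y i)) AA v)| <= e.
Proof.
move=> AA0 H; pose x (i : grid n d) : R := standardize F theta0 (y i).

have xfin := gauss_multiscale_fin x AA0.
have termE (A : {set grid n d}) : (Num.sqrt #|A|%:R)^-1 * `|\sum_(i in A) x i| =
    `|(Num.sqrt #|A|%:R)^-1 * std_sum F theta0 y A|.
  by rewrite normrM [X in _ = X * _]ger0_norm// invr_ge0 sqrtr_ge0.
set g := fine _.
have gE : gauss_multiscale x AA v = g%:E by rewrite fineK.
have up : (multiscale nu y theta0 AA v <= (g + e)%:E)%E.
  apply/bigmax_leP; split => [|A AAA]; first exact: leNye.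
  have [t -> te] := H A AAA.
  have : ((((Num.sqrt #|A|%:R)^-1 * `|\sum_(i in A) x i| - pen n d v #|A|%:R)%:E) <= g%:E)%E.
    by rewrite -gE; exact: (le_bigmax_cond _ _ AAA).
  rewrite -EFinB !lee_fin termE => h; move: te; rewrite ler_norml => /andP[_ h2]; lra.
have dn : ((g - e)%:E <= multiscale nu y theta0 AA v)%E.
  rewrite EFinB leeBlDr// -gE; apply/bigmax_leP; split => [|A AAA]; first exact: leNye.
  have [t tE te] := H A AAA.
  apply: (@le_trans _ _ ((t - pen n d v #|A|%:R) + e)%:E).
    rewrite lee_fin termE; move: te; rewrite ler_norml => /andP[h2 _]; lra.
  rewrite EFinD leeD2r// EFinB -tE; exact: (le_bigmax_cond _ _ AAA).
have mfin : multiscale nu y theta0 AA v \is a fin_num.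
  rewrite fin_numE -ltNye -ltey (lt_le_trans _ dn) ?ltNyr//=.
  exact: le_lt_trans up (ltry _).
exists (fine (multiscale nu y theta0 AA v)); first by rewrite fineK.
move: up dn; rewrite -(fineK mfin) !lee_fin /= => h1 h2.
by rewrite ler_norml; apply/andP; split; lra.
Qed.

End scan.

(** * Fields of standardized observations and coordinate fields *)

Section iid.
Context {R : realType}.
Local Notation TR := (measurableTypeR R).
Local Notation law := (probability TR R).
Variables (F : R -> law) (theta0 : R).
Context d (T : measurableType d) (P : probability T R) (I : finType).

Section standardized_field.
Variables (Y : I -> {RV P >-> R}) (i : I).

Let Z (w : T) : R := standardize F theta0 (Y i w).

Let mZ : measurable_fun [set: T] Z.
Proof.
exact: (measurableT_comp (measurable_standardize F theta0) (measurable_funPT (Y i))).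
Qed.

HB.instance Definition _ := isMeasurableFun.Build _ _ _ _ Z mZ.

Definition standardized_field : {RV P >-> R} := Z.
End standardized_field.

Lemma iid_standardized_field Y : iid_field Y (F theta0) ->
  iid_field (standardized_field Y) (std_law F theta0).
Proof.
move=> [iY lY]; have mS (A : set R) : measurable A ->
    measurable (standardize F theta0 @^-1` A).
  by move=> mA; rewrite -[X in measurable X]setTI; exact: measurable_standardize.
split=> [J B mB|i A mA].
  exact: (iY J (fun i => standardize F theta0 @^-1` B i) (fun i => mS _ (mB i))).
exact: (lY i _ (mS _ mA)).
Qed.
End iid.

Section coordinates.
Context {R : realType}.
Local Notation TR := (measurableTypeR R).
Local Notation law := (probability TR R).
Context d (T : measurableType d) (P : probability T R) (I : finType).
Variable p : T -> #|I|.-tuple TR.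
Hypothesis mp : measurable_fun [set: T] p.

Section coordinate.
Variable i : I.

Let Z (w : T) : R := tnth (p w) (enum_rank i).

Let mZ : measurable_fun [set: T] Z.
Proof. exact: (measurableT_comp (measurable_tnth (enum_rank i)) mp). Qed.

HB.instance Definition _ := isMeasurableFun.Build _ _ _ _ Z mZ.

Definition coordinate : {RV P >-> R} := Z.
End coordinate.

(** The converse of [iid_field_law]; it yields the fields of part (a) on the space of the
    coupling. *)
Lemma iid_coordinate (mu : law) :
  (forall A, measurable A -> P (p @^-1` A) = prod_law #|I| (fun=> mu) A) ->
  iid_field coordinate mu.
Proof.
move=> Pp.
have H (J : {set I}) (B : I -> set R) : (forall i, measurable (B i)) ->
    P (\bigcap_(i in [set` J]) (coordinate i @^-1` B i)) = (\prod_(i in J) mu (B i))%E.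
  move=> mB; pose B' (k : nat) : set R := if insub k is Some k' then B (@enum_val I predT k') else setT.
  have mB' k : measurable (B' k) by rewrite /B'; case: insub => [k'|//]; exact: mB.
  have B'E i : B' (enum_rank i) = B i by rewrite /B' valK enum_rankK.
  pose J' : {set 'I_#|I|} := [set k | enum_val k \in J]%SET.
  transitivity (P (p @^-1` \bigcap_(k in [set` J']) ((@tnth _ TR)^~ k @^-1` B' k))).
    congr (P _); apply/seteqP; split=> w /= h.
      by move=> k /=; rewrite inE => /h /=; rewrite /coordinate /= enum_valK /B' valK.
    by move=> i iJ; have := h (enum_rank i); rewrite /= inE enum_rankK B'E; apply.
  rewrite Pp; last first.
    apply: fin_bigcap_measurable => [|k _]; first exact: finite_finset.
    rewrite -[X in measurable X]setTI.
    exact: (measurable_tnth k measurableT (mB' k)).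
  rewrite prod_law_coord_iid// [RHS](reindex_onto (@enum_val I predT) (@enum_rank I)) /=; last first.
    by move=> i _; rewrite enum_rankK.
  apply: eq_big => [k|k _]; first by rewrite inE enum_valK eqxx andbT.
  by rewrite /B' valK.
have H1 i (B : set R) : measurable B -> P (coordinate i @^-1` B) = mu B.
  move=> mB; have := H [set i]%SET (fun=> B) (fun=> mB); rewrite big_set1 => <-.
  by congr (P _); apply/seteqP; split=> w /= h; [move=> j; rewrite /= inE => /eqP ->|apply: (h i); rewrite /= inE].
split=> [J B mB|i A mA]; last exact: H1.
by rewrite H//; apply: eq_bigr => i _; rewrite H1.
Qed.
End coordinates.

(** * Error bounds at a fixed sample size *)

Section regime.
Context {R : realType}.
Local Notation TR := (measurableTypeR R).
Local Notation law := (probability TR R).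
Local Notation gauss := (normal_prob 0 1 : law).

Lemma standardized_weaken (mu : law) (rho rho' m m' : R) :
  rho' <= rho -> m <= m' -> standardized mu rho m -> standardized mu rho' m'.
Proof.
move=> rr mm [? ? ? ? h]; split => //; apply: (@le_trans _ _ m%:E); last by rewrite lee_fin.
apply: le_trans h; apply: ge0_le_integral; [exact: measurableT| | | |].
- by move=> x _; rewrite lee_fin mulr_ge0 ?exprn_ge0 ?expR_ge0.
- by apply/measurable_EFinP; exact: measurable_cubexp.
- by apply/measurable_EFinP; exact: measurable_cubexp.
- by move=> x _; rewrite lee_fin ler_wpM2l ?exprn_ge0// ler_expR ler_wpM2r.
Qed.

Lemma union_bound d (T : measurableType d) (P : probability T R) (J : finType)
    (E : J -> set T) (b : R) :
  (forall j, measurable (E j)) -> (forall j, (P (E j) <= b%:E)%E) ->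
  (P (\bigcup_j E j) <= (#|J|%:R * b)%:E)%E.
Proof.
move=> mE Eb; have -> : \bigcup_j E j = \big[setU/set0]_(j <- index_enum J) E j.
  rewrite -bigcup_seq; apply/seteqP; split=> w [j _ Ew]; exists j => //=.
  exact: mem_index_enum.
have -> : (#|J|%:R * b)%:E = (\sum_(j <- index_enum J) b%:E)%E.
  by rewrite sumEFin sumr_const mulr_natl.
suff [] : measurable (\big[setU/set0]_(j <- index_enum J) E j) /\
  (P (\big[setU/set0]_(j <- index_enum J) E j) <= (\sum_(j <- index_enum J) b%:E))%E by [].
apply: (big_ind2 (fun U x => measurable U /\ (P U <= x)%E)) => //.
  by rewrite measure0.
move=> U x V y [mU Ux] [mV Vy]; split; first exact: measurableU.
by apply: (le_trans (measureU2 _ mU mV)); exact: leeD.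
Qed.

Lemma below_tail n (J : finType) (a : J -> nat -> R) (mu : law) (rho m kappa lambda t : R) :
  standardized mu rho m -> 0 <= m -> 0 < rho -> 0 <= lambda ->
  (forall j k, `|a j k| <= kappa) -> lambda * kappa <= rho ->
  (forall j, \sum_(k < n) a j k ^+ 2 <= 1) ->
  (prod_law n (fun=> mu) (~` below a (fun=> 0%R) t) <=
  (#|J|%:R * expR ((1 + rho * m) * lambda ^+ 2 - lambda * t))%:E)%E.
Proof.
move=> smu m0 rho0 l0 ak lk a2.
have -> : ~` below a (fun=> 0) t = \bigcup_j [set w : n.-tuple TR | t < linform a j w].
  apply/seteqP; split=> w /=.
    by move=> /existsNP[j]; rewrite subr0 => /negP; rewrite -ltNge => h; exists j.
  by move=> [j _ /= h] /(_ j); rewrite subr0 leNgt h.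
apply: union_bound => j; last exact: (linform_tail _ smu m0 rho0 l0 (ak j) lk (a2 j)).
rewrite (_ : [set _ | _] = linform a j @^-1` `]t, +oo[); last first.
  by apply/seteqP; split=> w; rewrite /= in_itv/= andbT.
by rewrite -[X in measurable X]setTI; exact: measurable_linform.
Qed.

Section scan_bounds.
Variables (n d : nat) (AA : {set {set grid n d}}) (v r s a c1 c2 rho M : R).
Hypotheses (s1 : 1 <= s) (a0 : 0 < a) (a1 : a <= 1) (r0 : 0 < r)
  (rE : Num.sqrt r = s ^+ 12 / a ^+ 5)
  (c20 : 0 <= c2)
  (cardAA : #|AA|%:R <= c1 * expR (c2 * s ^+ 2))
  (rAA : forall A, A \in AA -> r <= #|A|%:R)
  (rho0 : 0 < rho) (M0 : 0 <= M).
Local Notation N := #|{: grid n d}|.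
Local Notation below_scan := (below (@scan_dir R n d AA) (@scan_pen R n d AA v)).

Let s0 : 0 < s. Proof. exact: lt_le_trans s1. Qed.

Lemma regime_kappa j k : `|@scan_dir R n d AA j k| <= a ^+ 5 / s ^+ 12.
Proof.
rewrite -[_ / _]invf_div -rE; apply: scan_dir_le => //.
exact: rAA (valP j.1).
Qed.

Lemma regime_card_gt0 A : A \in AA -> (0 < #|A|)%N.
Proof. by move=> /rAA h; rewrite -(ltr0n R); exact: lt_le_trans h. Qed.

Lemma regime_unit (j : scan_index AA) : \sum_(k < N) @scan_dir R n d AA j k ^+ 2 = 1.
Proof. by apply: scan_dir_unit; exact: regime_card_gt0 (valP j.1). Qed.

Lemma regime_card : #|{: scan_index AA}|%:R <= 2 * c1 * expR (c2 * s ^+ 2).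
Proof. by rewrite card_scan_index natrM -mulrA ler_wpM2l. Qed.

(** With [beta = 2 * D * s ^+ 3 / a] and shift [a / s] the smoothing exponent is [D * s ^+ 2],
    against [expR (c2 * s ^+ 2)] regions up to a constant. With [kappa = a ^+ 5 / s ^+ 12] the
    replacement error is [16 * 8 * M * D ^+ 3] times [a ^+ 2 / s ^+ 3]. The two conditions on [D]
    keep [beta * kappa <= 2 * D / s] small enough. *)
Lemma scan_comparison (mu nu : law) (D q : R) : 0 <= D -> 12 * D <= s -> 8 * D <= rho * s ->
  standardized mu rho M -> standardized nu rho M ->
  fine (prod_law N (fun=> nu) (below_scan q)) <=
  fine (prod_law N (fun=> mu) (below_scan (q + a / s))) +
    (128 * M * D ^+ 3 * (a ^+ 2 / s ^+ 3) + (2 * c1 + 1) * expR ((c2 - D) * s ^+ 2)).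
Proof.
move=> D0 Ds Drho smu snu.
have an0 : a != 0 by rewrite gt_eqF.
have sn0 : s != 0 by rewrite gt_eqF.
pose beta := 2 * D * s ^+ 3 / a; pose kappa := a ^+ 5 / s ^+ 12.
have beta0 : 0 <= beta by rewrite divr_ge0 ?mulr_ge0 ?exprn_ge0// ltW.
have kappa0 : 0 <= kappa by rewrite divr_ge0 ?exprn_ge0// ltW.
pose u := s^-1; have u0 : 0 <= u by rewrite invr_ge0 ltW.
have u1 : u <= 1 by rewrite invf_le1.
have bk : beta * kappa <= 2 * D * u.
  rewrite (_ : beta * kappa = 2 * D * u * (a ^+ 4 * u ^+ 8)); last first.
    rewrite /beta /kappa /u; field.
    by rewrite an0 sn0.
  by rewrite ler_piMr ?mulr_ge0// mulr_ile1 ?exprn_ge0 ?exprn_ile1 ?(ltW a0).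
have su : s * u = 1 by rewrite /u divff.
have h1 : beta * kappa <= 6^-1.
  apply: le_trans bk _; have := ler_wpM2r u0 Ds; rewrite su; lra.
have h2 : 4 * (beta * kappa) <= rho.
  have := ler_wpM2r u0 Drho; rewrite -(mulrA rho) su mulr1; lra.
have d0 : 0 <= a / s by rewrite divr_ge0 ?ltW.
have a2 (j : scan_index AA) : \sum_(k < N) @scan_dir R n d AA j k ^+ 2 <= 1.
  by rewrite regime_unit.
apply: le_trans (below_comparison (scan_pen v (AA:=AA)) q kappa0 beta0 regime_kappa
  a2 h1 h2 M0 d0 smu snu) _.
rewrite lerD2l; apply: lerD.
  rewrite le_eqVlt; apply/orP; left; apply/eqP.
  by rewrite /beta /kappa; field; rewrite an0 sn0.
rewrite (_ : beta * (a / s) / 2 = D * s ^+ 2); last first.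
  by rewrite /beta; field; rewrite an0 sn0.
rewrite mulrBl expRD mulrA ler_wpM2r ?expR_ge0// -natr1 mulrDl mul1r lerD ?regime_card//.
by rewrite one_le_expR// mulr_ge0// sqr_ge0.
Qed.

(** The Chernoff bound with [lambda = s], which at levels [t] of order [s] beats the number of
    regions. *)
Lemma scan_tail (mu : law) (t : R) : 1 <= rho * s -> standardized mu rho M ->
  (prod_law N (fun=> mu) (~` below (@scan_dir R n d AA) (fun=> 0%R) t) <=
   (2 * c1 * expR ((c2 + 1 + rho * M) * s ^+ 2 - s * t))%:E)%E.
Proof.
move=> rs smu.
have sn0 : s != 0 by rewrite gt_eqF.
pose u := s^-1; have u0 : 0 <= u by rewrite invr_ge0 ltW.
have u1 : u <= 1 by rewrite invf_le1.
have su : s * u = 1 by rewrite /u divff.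
have lk : s * (a ^+ 5 / s ^+ 12) <= rho.
  apply: (@le_trans _ _ u); last by have := ler_wpM2r u0 rs; rewrite -(mulrA rho) su mulr1 mul1r.
  rewrite (_ : s * _ = u * (a ^+ 5 * u ^+ 10)); last by rewrite /u; field.
  by rewrite ler_piMr ?mulr_ge0// mulr_ile1 ?exprn_ge0 ?exprn_ile1 ?(ltW a0).
have a2 (j : scan_index AA) : \sum_(k < N) @scan_dir R n d AA j k ^+ 2 <= 1.
  by rewrite regime_unit.
apply: le_trans (below_tail t smu M0 rho0 (ltW s0) regime_kappa lk a2) _.
rewrite lee_fin (_ : (c2 + 1 + rho * M) * s ^+ 2 - s * t =
  c2 * s ^+ 2 + ((1 + rho * M) * s ^+ 2 - s * t)); last by ring.
by rewrite [X in _ <= _ * X]expRD [leRHS]mulrA ler_wpM2r ?expR_ge0// regime_card.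
Qed.

Section likelihood_ratio.
Variables (nu : set TR -> \bar R) (F : R -> law) (theta0 C e : R).
Hypotheses (C0 : 0 <= C) (AA0 : AA != finset.set0)
  (lr_expansion : forall (y : grid n d -> R) (A : {set grid n d}), (0 < #|A|)%N ->
    let Z := (Num.sqrt #|A|%:R)^-1 * std_sum F theta0 y A in
    `|Z| <= e * Num.sqrt #|A|%:R ->
    exists2 t : R, local_lr nu theta0 y A = t%:E &
      `|t - `|Z| | <= C * Z ^+ 2 / Num.sqrt #|A|%:R)
  (e0 : 0 < e).

(** With zero offsets the polyhedron bounds every [|Z|] by [t], since each direction occurs with
    both signs. *)
Lemma multiscale_approx_below (y : grid n d -> R) (t : R) : t <= e * Num.sqrt r ->
  below (@scan_dir R n d AA) (fun=> 0) t (field_vec (fun i => standardize F theta0 (y i))) ->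
  exists2 T : R, multiscale nu y theta0 AA v = T%:E &
    `|T - fine (gauss_multiscale (fun i => standardize F theta0 (y i)) AA v)| <=
    C * t ^+ 2 / Num.sqrt r.
Proof.
move=> te bt; apply: multiscale_approx => // A AAA.
have sr0 : 0 < Num.sqrt r by rewrite sqrtr_gt0.
have srA : Num.sqrt r <= Num.sqrt #|A|%:R.
  by rewrite ler_sqrt ?rAA// (lt_le_trans r0) ?rAA.
set Z := _ * std_sum _ _ _ _.
have Zt : `|Z| <= t.
  have := bt (Sub A AAA, false); have := bt (Sub A AAA, true).
  rewrite !linform_scan /= expr1 expr0 mul1r mulN1r !subr0 => h1 h2.
  by rewrite ler_norml h2 andbT lerNl.
have [|T TE h] := lr_expansion (y := y) (regime_card_gt0 AAA).
  by rewrite -/Z (le_trans Zt)// (le_trans te)// ler_wpM2l// ltW.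
exists T => //; apply: (le_trans h); rewrite -/Z.
apply: ler_pM; [by apply: mulr_ge0; rewrite ?sqr_ge0|by rewrite invr_ge0 sqrtr_ge0| |].
  by rewrite ler_wpM2l// -real_normK ?num_real// ler_sqr ?nnegrE// (le_trans _ Zt).
by rewrite lef_pV2// posrE (lt_le_trans sr0).
Qed.

Section one_field.
Context dd (T : measurableType dd) (P : probability T R).
Variable Y : grid n d -> {RV P >-> R}.
Hypothesis iY : iid_field Y (F theta0).
Hypotheses (std : standardized (std_law F theta0) rho M) (rs : 1 <= rho * s).

Definition unusual (t : R) : set T :=
  [set w | ~ below (@scan_dir R n d AA) (fun=> 0) t
     (field_vec (fun i => standardize F theta0 (Y i w)))].

Lemma measurable_unusual t : measurable (unusual t).
Proof.
apply: measurableC; rewrite -[X in measurable X]setTI.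
apply: (@measurable_field_vec _ _ _ P _ (standardized_field F theta0 Y)) => //.
exact: measurable_below.
Qed.

Lemma unusual_bound t :
  (P (unusual t) <= (2 * c1 * expR ((c2 + 1 + rho * M) * s ^+ 2 - s * t))%:E)%E.
Proof.
apply: le_trans (scan_tail t rs std).
have mB : measurable (~` below (@scan_dir R n d AA) (fun=> 0) t : set (N.-tuple TR)).
  by apply: measurableC; exact: measurable_below.
by rewrite -(iid_field_law (iid_standardized_field iY) mB).
Qed.

End one_field.

Section kolmogorov.
Context dY (OmY : measurableType dY) (PY : probability OmY R).
Context dX (OmX : measurableType dX) (PX : probability OmX R).
Variables (Y : grid n d -> {RV PY >-> R}) (X : grid n d -> {RV PX >-> R}).
Hypotheses (iY : iid_field Y (F theta0)) (iX : iid_field X gauss).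
Variable D : R.
Hypotheses (D0 : 0 <= D) (Ds : 12 * D <= s) (Drho : 8 * D <= rho * s).
Hypotheses (std : standardized (std_law F theta0) rho M)
  (gstd : standardized gauss rho M) (rs : 1 <= rho * s).

(** Off [unusual Y t] the multiscale statistic is within [C * t ^+ 2 / sqrt r] of the maximum for
    the standardized field, and the comparison adds the shift [a / s]. The total shift [h] in both
    directions is removed by the anti-concentration of the Gaussian maximum on a band of width
    [2 * h]. *)
Lemma kolmogorov_bound (q t H : R) : t <= e * Num.sqrt r ->
  let h := C * t ^+ 2 / Num.sqrt r + a / s in
  1 <= H -> (forall A, A \in AA -> q + h + pen n d v #|A|%:R <= H) ->
  (`|PY [set w | q%:E < multiscale nu (fun i => Y i w) theta0 AA v] -
     PX [set w | q%:E < gauss_multiscale (fun i => X i w) AA v]| <=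
   (2 * c1 * expR ((c2 + 1 + rho * M) * s ^+ 2 - s * t) +
    (128 * M * D ^+ 3 * (a ^+ 2 / s ^+ 3) + (2 * c1 + 1) * expR ((c2 - D) * s ^+ 2)) +
    2 * expR (3 / 2) * (2 * h * H))%:E)%E.
Proof.
move=> te h H1 Hpen.
pose ep := C * t ^+ 2 / Num.sqrt r.
have hE : h = ep + a / s by [].
clearbody h.
have ep0 : 0 <= ep by rewrite divr_ge0 ?sqrtr_ge0// mulr_ge0 ?sqr_ge0.
have d0 : 0 < a / s by rewrite divr_gt0.
set tail := 2 * c1 * _; set eta := 128 * M * D ^+ 3 * _ + _.
pose G q := fine (prod_law N (fun=> gauss) (below_scan q)).
pose G1 q := fine (prod_law N (fun=> std_law F theta0) (below_scan q)).
pose Z := standardized_field F theta0 Y.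
have mgt dd (T : measurableType dd) (f : T -> \bar R) x :
    measurable_fun [set: T] f -> measurable [set w | (x%:E < f w)%E].
  move=> mf; rewrite (_ : [set _ | _] = f @^-1` `]x%:E, +oo[).
    by rewrite -[X in measurable X]setTI; apply: mf => //; exact: emeasurable_itv.
  by apply/seteqP; split=> w; rewrite /= in_itv/= andbT.
have gtE dd (T : measurableType dd) (P : probability T R) (W : grid n d -> {RV P >-> R})
    (mu : law) x : iid_field W mu ->
    P [set w | (x%:E < gauss_multiscale (fun i => W i w) AA v)%E] =
    (1 - fine (prod_law N (fun=> mu) (below_scan x)))%:E.
  move=> iW; rewrite (_ : [set _ | _] =
      ~` [set w | (gauss_multiscale (fun i => W i w) AA v <= x%:E)%E]); last first.
    by apply/seteqP; split=> w /=; rewrite ltNge => /negP.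
  rewrite probability_setC; last first.
    rewrite gauss_multiscale_le_preimage -[X in measurable X]setTI.
    by apply: measurable_field_vec => //; exact: measurable_below.
  rewrite (gauss_multiscale_law _ _ _ iW) EFinB fineK// fin_num_measure//.
  exact: measurable_below.
have iZ : iid_field Z (std_law F theta0) := iid_standardized_field iY.
rewrite (gtE _ _ _ _ _ _ iX).
set U := [set w | _].
have mU : measurable U by apply: mgt; exact: measurable_multiscale.
have mB := measurable_unusual Y t.
have PB := unusual_bound iY std rs t; rewrite -/tail in PB.
have PUE : PY U = (fine (PY U))%:E by rewrite fineK// fin_num_measure.
have approx w : ~ unusual Y t w -> exists2 T : R,
    multiscale nu (fun i => Y i w) theta0 AA v = T%:E &
    exists2 g : R, gauss_multiscale (fun i => Z i w) AA v = g%:E & `|T - g| <= ep.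
  move=> /contrapT bw; have [T TE Tg] := multiscale_approx_below te bw.
  exists T => //; exists (fine (gauss_multiscale (fun i => Z i w) AA v)) => //.
  by rewrite fineK// gauss_multiscale_fin.
have up : fine (PY U) <= 1 - G1 (q - ep) + tail.
  rewrite -lee_fin -PUE EFinD -(gtE _ _ _ _ _ (q - ep) iZ).
  set V := [set w | _]; have mV : measurable V by apply: mgt; exact: measurable_gauss_multiscale.
  apply: (@le_trans _ _ (PY (V `|` unusual Y t))).
    apply: le_measure; rewrite ?inE//; first exact: measurableU.
    move=> w Uw; have [|/approx[T TE [g gE]]] := pselect (unusual Y t w); first by right.
    move=> Tg; left; move: Uw; rewrite /U /V /= TE gE !lte_fin.
    by move: Tg; rewrite ler_norml => /andP[? ?]; lra.
  by apply: (le_trans (measureU2 _ mV mB)); exact: leeD.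
have lo : 1 - G1 (q + ep) <= fine (PY U) + tail.
  rewrite -lee_fin [X in (_ <= X)%E]EFinD -PUE -(gtE _ _ _ _ _ (q + ep) iZ).
  set V := [set w | _]; have mV : measurable V by apply: mgt; exact: measurable_gauss_multiscale.
  apply: (@le_trans _ _ (PY (U `|` unusual Y t))).
    apply: le_measure; rewrite ?inE//; first exact: measurableU.
    move=> w Vw; have [|/approx[T TE [g gE]]] := pselect (unusual Y t w); first by right.
    move=> Tg; left; move: Vw; rewrite /U /V /= TE gE !lte_fin.
    by move: Tg; rewrite ler_norml => /andP[? ?]; lra.
  by apply: (le_trans (measureU2 _ mU mB)); exact: leeD.
have c12 := scan_comparison (q - ep - a / s) D0 Ds Drho std gstd.
rewrite subrK -/eta -/(G _) -/(G1 _) in c12.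
have c21 := scan_comparison (q + ep) D0 Ds Drho gstd std.
rewrite -/eta -/(G _) -/(G1 _) in c21.
have h0 : 0 < 2 * h by rewrite mulr_gt0// hE ltr_wpDl.
have anti : G (q - h + 2 * h) - G (q - h) <= 2 * expR (3 / 2) * (2 * h * H).
  apply: (below_anticoncentration regime_unit H1 h0) => j.
  by have := Hpen _ (valP j.1); rewrite /scan_pen; lra.
have Gm x y : x <= y -> G x <= G y.
  move=> xy; rewrite /G fine_le ?fin_num_measure//; [|exact: measurable_below..|].
    exact: measurable_below.
  apply: le_measure; rewrite ?inE; [exact: measurable_below..|].
  by move=> w bw j; exact: le_trans (bw j) xy.
have Gm1 : G (q - h) <= G q by apply: Gm; lra.
have Gm2 : G q <= G (q - h + 2 * h) by apply: Gm; lra.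
have e1 : q - ep - a / s = q - h by rewrite hE; ring.
have e2 : q + ep + a / s = q - h + 2 * h by rewrite hE; ring.
rewrite e1 in c12; rewrite e2 in c21.
rewrite PUE -EFinB /= lee_fin -/(G q) ler_norml; apply/andP; split; lra.
Qed.
End kolmogorov.

Section coupling.
Variable D : R.
Hypotheses (D0 : 0 <= D) (Ds : 12 * D <= s) (Drho : 8 * D <= rho * s).
Hypotheses (std : standardized (std_law F theta0) rho M)
  (gstd : standardized gauss rho M) (rs : 1 <= rho * s).
Local Notation vecN := (N.-tuple TR).

Lemma gauss_multiscale_fine_law dd (T : measurableType dd) (P : probability T R)
    (W : grid n d -> {RV P >-> R}) (mu : law) x : iid_field W mu ->
  fine (P [set w | fine (gauss_multiscale (fun i => W i w) AA v) <= x]) =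
  fine (prod_law N (fun=> mu) (below_scan x)).
Proof.
move=> iW; rewrite -(gauss_multiscale_law AA v x iW); congr (fine (P _)).
apply/seteqP; split=> w /=; by rewrite -lee_fin fineK// gauss_multiscale_fin.
Qed.

(** The laws of the original observations and of the Gaussian field are coupled, but the cells are
    those of the maxima of normalized sums. The likelihood ratio enters afterwards, off
    [unusual Y L]. The tail bound occurs twice, for the observations and for the Gaussian field. *)
Lemma coupling_bound (L B x : R) (m K : nat) : (0 < m)%N -> (0 < K)%N ->
  let w := 2 * (a / s) * m%:R in
  2 * L <= K.-1%:R * w -> L <= e * Num.sqrt r ->
  (forall A, A \in AA -> 0 <= pen n d v #|A|%:R <= B) -> w + B < L ->
  w + C * L ^+ 2 / Num.sqrt r <= x ->
  exists P : probability (vecN * vecN)%type R,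
  [/\ iid_field (coordinate P measurable_fst) (F theta0),
      iid_field (coordinate P measurable_snd) gauss &
      (P [set z | x%:E <
         `|multiscale nu (fun i => coordinate P measurable_fst i z) theta0 AA v -
           gauss_multiscale (fun i => coordinate P measurable_snd i z) AA v|] <=
       (2 * (2 * c1 * expR ((c2 + 1 + rho * M) * s ^+ 2 - s * L)) +
        2 * (K%:R * (128 * M * D ^+ 3 * (a ^+ 2 / s ^+ 3) +
               (2 * c1 + 1) * expR ((c2 - D) * s ^+ 2)) + m%:R^-1))%:E)%E].
Proof.
move=> m0 K0 w Lw Le Bpen wBL wx.
set eta := 128 * M * D ^+ 3 * _ + _; set tail := 2 * c1 * _.
pose Q1 := prod_law N (fun=> F theta0); pose Q2 := prod_law N (fun=> gauss).
pose Y1 := coordinate Q1 (@measurable_id _ vecN setT).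
pose X2 := coordinate Q2 (@measurable_id _ vecN setT).
have iY1 : iid_field Y1 (F theta0) by apply: iid_coordinate.
have iX2 : iid_field X2 gauss by apply: iid_coordinate.
pose S1 y := fine (gauss_multiscale (fun i => standardized_field F theta0 Y1 i y) AA v).
pose S2 y := fine (gauss_multiscale (fun i => X2 i y) AA v).
have mS1 : measurable_fun [set: vecN] S1.
  by apply: measurableT_comp; [exact: fine_measurable|exact: measurable_gauss_multiscale].
have mS2 : measurable_fun [set: vecN] S2.
  by apply: measurableT_comp; [exact: fine_measurable|exact: measurable_gauss_multiscale].
have F1E q : fine (Q1 [set x | S1 x <= q]) =
    fine (prod_law N (fun=> std_law F theta0) (below_scan q)).
  exact: (gauss_multiscale_fine_law _ (iid_standardized_field iY1)).
have F2E q : fine (Q2 [set x | S2 x <= q]) =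
    fine (prod_law N (fun=> gauss) (below_scan q)).
  exact: (gauss_multiscale_fine_law _ iX2).
have d0 : 0 < a / s by rewrite divr_gt0.
have c12 q : fine (Q1 [set x | S1 x <= q]) <= fine (Q2 [set x | S2 x <= q + a / s]) + eta.
  by rewrite F1E F2E; exact: scan_comparison.
have c21 q : fine (Q2 [set x | S2 x <= q]) <= fine (Q1 [set x | S1 x <= q + a / s]) + eta.
  by rewrite F1E F2E; exact: scan_comparison.
have [P [P1 P2 PS]] := levy_coupling mS1 mS2 d0 m0 K0 c12 c21 Lw.
exists P; pose Y := coordinate P measurable_fst; pose X := coordinate P measurable_snd.
have iY : iid_field Y (F theta0).
  apply: iid_coordinate => A mA; rewrite -[RHS](P1 A mA); congr (P _).
  by apply/seteqP; split=> z /=; [split|case].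
have iX : iid_field X gauss.
  apply: iid_coordinate => A mA; rewrite -[RHS](P2 A mA); congr (P _).
  by apply/seteqP; split=> z /=; [split|case].
split => //.
have mB := measurable_unusual Y L.
have PB := unusual_bound iY std rs L; rewrite -/tail in PB.
(* Since [|Z_R| >= 0], the Gaussian maximum is at least [- B], which exceeds [- L + w]. *)
have low : fine (Q2 [set x | S2 x <= - L + w]) = 0.
  rewrite F2E (_ : below_scan (- L + w) = set0) ?measure0//.
  apply/seteqP; split=> // u bx; have /set0Pn[A AAA] := AA0.
  have /andP[p0 pB] := Bpen A AAA.
  have := bx (Sub A AAA, false); have := bx (Sub A AAA, true).
  have -> : u = field_vec (fun i => tnth u (enum_rank i)).
    by apply: eq_from_tnth => k; rewrite tnth_mktuple enum_valK.
  rewrite !linform_scan /scan_pen /= expr1 expr0 mul1r mulN1r => h1 h2.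
  by exfalso; move: wBL; apply/negP; rewrite -leNgt; lra.
have high : 1 - fine (Q2 [set x | S2 x <= L]) <= tail.
  rewrite F2E -lee_fin EFinB fineK ?fin_num_measure//; last exact: measurable_below.
  rewrite -probability_setC; last exact: measurable_below.
  apply: le_trans (scan_tail L rs gstd); apply: le_measure; rewrite ?inE.
  - by apply: measurableC; exact: measurable_below.
  - by apply: measurableC; exact: measurable_below.
  - apply: subsetC => u bx j; apply: le_trans (bx j); rewrite lerD2l lerN2.
    by have /andP[] := Bpen _ (valP j.1).
rewrite low add0r in PS.
set E := [set z | _].
have mE : measurable E.
  have mf : measurable_fun [set: vecN * vecN] (fun z =>
      `|multiscale nu (fun i => Y i z) theta0 AA v - gauss_multiscale (fun i => X i z) AA v|%E).
    apply: measurableT_comp => //; apply: emeasurable_funB.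
      exact: measurable_multiscale.
    exact: measurable_gauss_multiscale.
  rewrite (_ : E = (fun z =>
      `|multiscale nu (fun i => Y i z) theta0 AA v - gauss_multiscale (fun i => X i z) AA v|%E) @^-1`
       `]x%:E, +oo[).
    by rewrite -[X in measurable X]setTI; apply: mf => //; exact: emeasurable_itv.
  by apply/seteqP; split=> z; rewrite /= in_itv/= andbT.
have mD : measurable [set z : vecN * vecN | w < `|S1 z.1 - S2 z.2|].
  have mf : measurable_fun [set: vecN * vecN] (fun z => `|S1 z.1 - S2 z.2|).
    apply: measurableT_comp => //; apply: measurable_funB.
      exact: (measurableT_comp mS1 measurable_fst).
    exact: (measurableT_comp mS2 measurable_snd).
  rewrite (_ : [set z | _] = (fun z : vecN * vecN => `|S1 z.1 - S2 z.2|) @^-1` `]w, +oo[).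
    by rewrite -[X in measurable X]setTI; exact: mf.
  by apply/seteqP; split=> z; rewrite /= in_itv/= andbT.
apply: (@le_trans _ _ (P (unusual Y L `|` [set z | w < `|S1 z.1 - S2 z.2|]))).
  apply: le_measure; rewrite ?inE//; first exact: measurableU.
  move=> z Ez; have [|/contrapT bz] := pselect (unusual Y L z); first by left.
  right; have [T TE Tg] := multiscale_approx_below Le bz.
  move: Ez; rewrite /E /= -/Y -/X TE.
  have -> : gauss_multiscale (fun i => X i z) AA v = (S2 z.2)%:E.
    by rewrite fineK// gauss_multiscale_fin.
  rewrite -EFinB lte_fin => h; rewrite -(ltrD2r (C * L ^+ 2 / Num.sqrt r)).
  apply: (le_lt_trans wx); apply: (lt_le_trans h); rewrite (_ : T - _ = (S1 z.1 - S2 z.2) + (T - S1 z.1)); last by ring.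
  by apply: le_trans (ler_normD _ _) _; rewrite lerD2l.
apply: (le_trans (measureU2 _ mB mD)).
rewrite mulr2n (mulrDl 1 1) mul1r -addrA EFinD; apply: leeD => //.
by apply: (le_trans PS); rewrite lee_fin; lra.
Qed.
End coupling.
End likelihood_ratio.
End scan_bounds.
End regime.

(** * Asymptotics *)

Section uniform_bounds.
Context {R : realType}.
Local Notation TR := (measurableTypeR R).
Local Notation law := (probability TR R).
Local Notation gauss := (normal_prob 0 1 : law).

Section error_terms.
Variables (d : nat) (c1 c2 rho M s a : R).
Hypotheses (s1 : 1 <= s) (a0 : 0 < a) (a1 : a <= 1) (c10 : 0 <= c1) (M0 : 0 <= M)
  (c20 : 0 <= c2).
(** Of the exponent [D], [c2] pays for the number of regions, [d] for the factor [a^-1] in the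
    number of cells, and 1 leaves [expR (- s ^+ 2)]. *)
Let D := c2 + d%:R + 1.

Let s0 : 0 < s. Proof. exact: lt_le_trans s1. Qed.

Lemma expRN_sqr_le : expR (- s ^+ 2) <= (s ^+ 2)^-1.
Proof.
rewrite expRN lef_pV2 ?posrE ?expR_gt0 ?exprn_gt0//.
by apply: le_trans (expR_ge1Dx _); rewrite lerDr.
Qed.

Lemma tail_le A : c2 + 2 + rho * M <= A ->
  2 * c1 * expR ((c2 + 1 + rho * M) * s ^+ 2 - s * (A * s)) <= 2 * c1 / s.
Proof.
move=> hA; rewrite ler_wpM2l ?mulr_ge0//.
apply: (@le_trans _ _ (expR (- s ^+ 2))).
  rewrite ler_expR -subr_ge0 (_ : _ - _ = (A - (c2 + 2 + rho * M)) * s ^+ 2); last by ring.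
  by rewrite mulr_ge0 ?sqr_ge0 ?subr_ge0.
apply: le_trans expRN_sqr_le _; rewrite lef_pV2 ?posrE ?exprn_gt0//.
by rewrite expr2 ler_peMl// ltW.
Qed.

Lemma eta_le : 128 * M * D ^+ 3 * (a ^+ 2 / s ^+ 3) +
    (2 * c1 + 1) * expR ((c2 - D) * s ^+ 2) <=
  (128 * M * D ^+ 3 + 2 * c1 + 1) * (a + s^-1).
Proof.
have D0 : 0 <= D by rewrite /D !addr_ge0.
have u0 : 0 <= s^-1 by rewrite invr_ge0 ltW.
have u1 : s^-1 <= 1 by rewrite invf_le1.
have h1 : a ^+ 2 / s ^+ 3 <= a + s^-1.
  apply: (@le_trans _ _ a); last by rewrite lerDl.
  rewrite -exprVn expr2 -mulrA ler_piMr ?(ltW a0)//.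
  by rewrite mulr_ile1 ?exprn_ge0 ?exprn_ile1 ?(ltW a0).
have h2 : expR ((c2 - D) * s ^+ 2) <= a + s^-1.
  apply: (@le_trans _ _ (expR (- s ^+ 2))).
    rewrite ler_expR /D -subr_ge0 (_ : _ - _ = d%:R * s ^+ 2); last by ring.
    by rewrite mulr_ge0 ?sqr_ge0.
  apply: le_trans expRN_sqr_le _; apply: (@le_trans _ _ s^-1); last by rewrite lerDr ltW.
  by rewrite lef_pV2 ?posrE ?exprn_gt0// expr2 ler_peMl// ltW.
rewrite -[128 * M * D ^+ 3 + 2 * c1 + 1]addrA [leRHS]mulrDl.
apply: lerD; rewrite ler_wpM2l//; first by rewrite !mulr_ge0 ?exprn_ge0.
by rewrite addr_ge0 ?mulr_ge0.
Qed.

(** The number [k] of cells is of order [s / a]. The polynomial term still has [a / s ^+ 2] left,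
    and the part [expR (- (d%:R * s ^+ 2))] of the exponential term absorbs [a^-1]. *)
Lemma cells_eta_le (A k : R) : 0 <= A -> a^-1 <= expR (d%:R * s ^+ 2) ->
  0 <= k -> k <= A * (s / a) ->
  k * (128 * M * D ^+ 3 * (a ^+ 2 / s ^+ 3) +
    (2 * c1 + 1) * expR ((c2 - D) * s ^+ 2)) <=
  A * (128 * M * D ^+ 3 + 2 * c1 + 1) * (a + s^-1).
Proof.
move=> A0 ad k0 kA.
have D0 : 0 <= D by rewrite /D !addr_ge0.
have u0 : 0 <= s^-1 by rewrite invr_ge0 ltW.
have u1 : s^-1 <= 1 by rewrite invf_le1.
have sn0 : s != 0 by rewrite gt_eqF.
have an0 : a != 0 by rewrite gt_eqF.
have h1 : s / a * (a ^+ 2 / s ^+ 3) <= a + s^-1.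
  apply: (@le_trans _ _ a); last by rewrite lerDl.
  rewrite (_ : s / a * _ = a * s^-1 ^+ 2); last by field; rewrite an0 sn0.
  by rewrite ler_piMr ?(ltW a0)// exprn_ile1.
have h2 : s / a * expR ((c2 - D) * s ^+ 2) <= a + s^-1.
  rewrite (_ : (c2 - D) * s ^+ 2 = - (d%:R * s ^+ 2) + - s ^+ 2); last by rewrite /D; ring.
  rewrite expRD expRN mulrA.
  apply: (@le_trans _ _ s^-1); last by rewrite lerDr ltW.
  apply: (@le_trans _ _ (s * (s ^+ 2)^-1)); last first.
    by rewrite (_ : s * _ = s^-1)//; field.
  apply: ler_pM; rewrite ?expR_ge0 ?mulr_ge0 ?invr_ge0 ?expR_ge0 ?(ltW s0) ?(ltW a0)//.
    by rewrite -mulrA ler_piMr ?(ltW s0)// ler_pdivrMr ?expR_gt0// mul1r.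
  exact: expRN_sqr_le.
have T1 : 0 <= 128 * M * D ^+ 3 by rewrite !mulr_ge0 ?exprn_ge0.
have T2 : 0 <= 2 * c1 + 1 by rewrite addr_ge0 ?mulr_ge0.
have E0 := expR_ge0 ((c2 - D) * s ^+ 2).
have E1 : 0 <= a ^+ 2 / s ^+ 3 by rewrite divr_ge0 ?exprn_ge0 ?ltW.
apply: (@le_trans _ _ (A * (s / a) * (128 * M * D ^+ 3 * (a ^+ 2 / s ^+ 3) +
    (2 * c1 + 1) * expR ((c2 - D) * s ^+ 2)))).
  by rewrite ler_wpM2r//; apply: addr_ge0; apply: mulr_ge0.
rewrite -!(mulrA A) ler_wpM2l// -[128 * M * D ^+ 3 + 2 * c1 + 1]addrA.
rewrite [leRHS]mulrDl [leLHS]mulrDr mulrCA [X in _ + X]mulrCA.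
by apply: lerD; rewrite ler_wpM2l.
Qed.
End error_terms.

Section uniform.
Variables (d : nat) (v c1 c2 rho M C e b : R) (nu : set TR -> \bar R) (F : R -> law) (theta0 : R).
Hypotheses (c10 : 0 <= c1) (c20 : 0 <= c2) (rho0 : 0 < rho) (M0 : 0 <= M)
  (C0 : 0 <= C) (e0 : 0 < e) (b0 : 0 <= b).
Hypotheses (std : standardized (std_law F theta0) rho M) (gstd : standardized gauss rho M).
Hypothesis lr_expansion : forall n (y : grid n d -> R) (A : {set grid n d}), (0 < #|A|)%N ->
    let Z := (Num.sqrt #|A|%:R)^-1 * std_sum F theta0 y A in
    `|Z| <= e * Num.sqrt #|A|%:R ->
    exists2 t : R, local_lr nu theta0 y A = t%:E &
      `|t - `|Z| | <= C * Z ^+ 2 / Num.sqrt #|A|%:R.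

(* [s] stands for [sqrt (log n)] and [a] for [(log^12 n / r)^(1/10)], hence the
   expression for [sqrt r]. *)
Definition regime n (AA : {set {set grid n d}}) (r s a : R) : Prop :=
  [/\ 1 <= s, 0 < a <= 1, 0 < r, Num.sqrt r = s ^+ 12 / a ^+ 5 &
      a^-1 <= expR (d%:R * s ^+ 2)] /\
  [/\ AA != finset.set0, #|AA|%:R <= c1 * expR (c2 * s ^+ 2),
      forall A, A \in AA -> r <= #|A|%:R &
      forall A, A \in AA -> 0 <= pen n d v #|A|%:R <= b * s].

Let D := c2 + d%:R + 1.
(** Sums are truncated at the level [A * s]: [c2 + 2 + rho * M] makes the tail probabilities small,
    [b] covers the penalties and 3 the width of a cell. *)
Let A := c2 + 2 + rho * M + 3 + b.
Let S0 := 12 * D + 8 * D / rho + rho^-1 + A / e.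

Let D0 : 0 <= D. Proof. by rewrite /D !addr_ge0. Qed.
Let A0 : 0 <= A. Proof. by rewrite /A !addr_ge0// mulr_ge0// ltW. Qed.

Lemma S0_le s : S0 <= s ->
  [/\ 12 * D <= s, 8 * D <= rho * s, 1 <= rho * s & A <= e * s].
Proof.
have n1 : 0 <= 12 * D by rewrite mulr_ge0.
have n2 : 0 <= 8 * D / rho by rewrite divr_ge0 ?mulr_ge0 ?(ltW rho0).
have n3 : 0 <= rho^-1 by rewrite invr_ge0 ltW.
have n4 : 0 <= A / e by rewrite divr_ge0 ?(ltW e0).
rewrite /S0 => h; split.
- lra.
- by rewrite -ler_pdivrMl// mulrC; lra.
- by rewrite -ler_pdivrMl// mulr1; lra.
- by rewrite -ler_pdivrMl// mulrC; lra.
Qed.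

Section one.
Variables (s a r : R).
Hypotheses (s1 : 1 <= s) (a0 : 0 < a) (a1 : a <= 1) (rE : Num.sqrt r = s ^+ 12 / a ^+ 5).
Let s0 : 0 < s. Proof. exact: lt_le_trans s1. Qed.

Lemma level_le : A <= e * s -> A * s <= e * Num.sqrt r.
Proof.
move=> As; apply: (@le_trans _ _ (e * s * s)); first by rewrite ler_wpM2r// ltW.
rewrite -mulrA ler_wpM2l ?(ltW e0)// rE -expr2.
apply: (@le_trans _ _ (s ^+ 12)); first by rewrite ler_weXn2l.
by rewrite ler_pdivlMr ?exprn_gt0// ler_piMr ?exprn_ge0 ?exprn_ile1 ?(ltW a0) ?(ltW s0).
Qed.

Lemma remainder_le : C * (A * s) ^+ 2 / Num.sqrt r <= C * A ^+ 2 * (a / s).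
Proof.
have sn0 : s != 0 by rewrite gt_eqF.
have an0 : a != 0 by rewrite gt_eqF.
have u0 : 0 <= s^-1 by rewrite invr_ge0 ltW.
have u1 : s^-1 <= 1 by rewrite invf_le1.
rewrite rE (_ : _ / _ = C * A ^+ 2 * (a / s) * (a ^+ 4 * s^-1 ^+ 9)); last first.
  by field; rewrite an0 sn0.
rewrite ler_piMr// ?mulr_ge0 ?sqr_ge0 ?(ltW a0)//.
by rewrite mulr_ile1 ?exprn_ge0 ?exprn_ile1 ?(ltW a0).
Qed.
End one.

Lemma uniform_coupling : exists S C1 C2 : R, [/\ 0 < C1, 0 <= C2 &
  forall n (AA : {set {set grid n d}}) r s a, regime AA r s a -> S <= s ->
  exists P : probability (#|{: grid n d}|.-tuple TR * #|{: grid n d}|.-tuple TR)%type R,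
  [/\ iid_field (coordinate P measurable_fst) (F theta0),
      iid_field (coordinate P measurable_snd) gauss &
      (P [set z | (C1 * a)%:E <
         `|multiscale nu (fun i => coordinate P measurable_fst i z) theta0 AA v -
           gauss_multiscale (fun i => coordinate P measurable_snd i z) AA v|] <=
       (C2 * (a + s^-1))%:E)%E]].
Proof.
pose E0 := 128 * M * D ^+ 3 + 2 * c1 + 1.
have E00 : 0 <= E0 by rewrite /E0 !addr_ge0 ?mulr_ge0 ?exprn_ge0.
exists S0, (2 + C * A ^+ 2), (4 * c1 + 2 * ((2 * A + 2) * E0) + 4); split.
- by rewrite ltr_wpDr// mulr_ge0 ?sqr_ge0.
- by rewrite !addr_ge0 ?mulr_ge0 ?addr_ge0 ?mulr_ge0.
move=> n AA r s a [[s1 /andP[a0 a1] r0 rE ad] [AA0 cardAA rAA penAA]] /S0_le[Ds Drho rs As].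
have s0 : 0 < s by exact: lt_le_trans s1.
have an0 : a != 0 by rewrite gt_eqF.
have sn0 : s != 0 by rewrite gt_eqF.
have u0 : 0 <= s^-1 by rewrite invr_ge0 ltW.
pose m := Num.truncn s.
(* With [m] between [s / 2] and [s], the cell width [w] lies between [a] and [2 * a]. *)
have /andP[ms sm] := truncn_itv (ltW s0).
have m0 : (0 < m)%N by rewrite truncn_gt0.
have m1 : 1 <= m%:R :> R by rewrite ler1n.
rewrite -/m -natr1 in ms sm.
pose w := 2 * (a / s) * m%:R.
have as0 : 0 < a / s by rewrite divr_gt0.
have w2 : w <= 2 * a.
  by rewrite /w -mulrA ler_wpM2l// -mulrA ler_piMr ?(ltW a0)// mulrC ler_pdivrMr// mul1r.
have wa : a <= w.
  rewrite (_ : w = a * (2 * m%:R / s)); last by rewrite /w; field.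
  by rewrite ler_peMr ?(ltW a0)// ler_pdivlMr// mul1r; lra.
have w0 : 0 < w by exact: lt_le_trans wa.
(* Two more than the integer part, because it is [K.-1] steps of width [w] that have to cover an
   interval of length [2 * (A * s)]. *)
pose K := (Num.truncn (2 * (A * s) / w)).+2.
have L0 : 0 <= 2 * (A * s) / w by rewrite divr_ge0 ?(ltW w0)// !mulr_ge0// ltW.
have /andP[K1 K2] := truncn_itv L0.
have Lw : 2 * (A * s) <= K.-1%:R * w by rewrite -ler_pdivrMr// ltW.
have sa1 : 1 <= s / a by rewrite ler_pdivlMr// mul1r (le_trans a1).
have KE : K%:R <= (2 * A + 2) * (s / a).
  rewrite /K -addn2 natrD [leRHS]mulrDl; apply: lerD; last by lra.
  apply: (le_trans K1); rewrite (_ : 2 * A * (s / a) = 2 * (A * s) / a); last by ring.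
  by rewrite ler_wpM2l ?mulr_ge0 ?(ltW s0)// lef_pV2// posrE.
have Le := level_le s1 a0 a1 rE As.
have wBL : w + b * s < A * s.
  have : (b + 3) * s <= A * s.
    rewrite ler_wpM2r ?(ltW s0)// /A -subr_ge0 (_ : _ - _ = c2 + 2 + rho * M); last by ring.
    by rewrite !addr_ge0// mulr_ge0// ltW.
  rewrite mulrDl; lra.
have wx : w + C * (A * s) ^+ 2 / Num.sqrt r <= (2 + C * A ^+ 2) * a.
  rewrite [leRHS]mulrDl; apply: lerD => //; apply: (le_trans (remainder_le s1 a0 a1 rE)).
  by rewrite ler_wpM2l ?mulr_ge0 ?sqr_ge0// ler_pdivrMr// ler_peMr// ltW.
have K0 : (0 < K)%N by [].
have [P [iY iX PE]] := coupling_bound s1 a0 a1 r0 rE c20 cardAA rAA rho0 M0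
  C0 AA0 (@lr_expansion n) e0 D0 Ds Drho std gstd rs m0 K0 Lw Le penAA wBL wx.
exists P; split=> //; apply: (le_trans PE); rewrite lee_fin.
have hA : c2 + 2 + rho * M <= A by rewrite /A -[leRHS]addrA lerDl addr_ge0.
have h1 := tail_le s1 c10 hA.
have A2 : 0 <= 2 * A + 2 by rewrite addr_ge0 ?mulr_ge0.
have h2 := cells_eta_le s1 a0 c10 M0 c20 A2 ad (ler0n _ K) KE.
have h3 : m%:R^-1 <= 2 * s^-1.
  by rewrite -(invrK 2) -invfM lef_pV2 ?posrE ?mulr_gt0 ?invr_gt0//; lra.
rewrite -/D -/E0 in h1 h2.
have h4 : 2 * c1 / s <= 2 * c1 * (a + s^-1) by rewrite ler_wpM2l ?mulr_ge0// lerDr ltW.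
rewrite 2!mulrDl; lra.
Qed.

(** The levels in the anti-concentration bound are at most [H * s], because of the penalties, while
    the shift is of order [a / s]; the product is of order [a]. *)
Lemma uniform_kolmogorov (q : R) : exists S C2 : R, 0 <= C2 /\
  forall n (AA : {set {set grid n d}}) r s a, regime AA r s a -> S <= s ->
  forall dY (OmY : measurableType dY) (PY : probability OmY R)
    dX (OmX : measurableType dX) (PX : probability OmX R)
    (Y : grid n d -> {RV PY >-> R}) (X : grid n d -> {RV PX >-> R}),
  iid_field Y (F theta0) -> iid_field X gauss ->
  (`|PY [set w | q%:E < multiscale nu (fun i => Y i w) theta0 AA v] -
     PX [set w | q%:E < gauss_multiscale (fun i => X i w) AA v]| <=
   (C2 * (a + s^-1))%:E)%E.
Proof.
pose E0 := 128 * M * D ^+ 3 + 2 * c1 + 1.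
have E00 : 0 <= E0 by rewrite /E0 !addr_ge0 ?mulr_ge0 ?exprn_ge0.
pose ch := C * A ^+ 2 + 1.
have ch0 : 0 <= ch by rewrite /ch addr_ge0 ?mulr_ge0 ?sqr_ge0.
pose H := `|q| + ch + b + 1.
have H0 : 0 <= `|q| + ch + b by apply: addr_ge0 => //; exact: addr_ge0.
have H1 : 1 <= H by rewrite /H lerDr.
have HH : 0 <= H := le_trans ler01 H1.
exists S0, (2 * c1 + E0 + 2 * expR (3 / 2) * (2 * (ch * H))); split.
  by rewrite !addr_ge0 ?mulr_ge0 ?expR_ge0.
move=> n AA r s a [[s1 /andP[a0 a1] r0 rE ad] [AA0 cardAA rAA penAA]] /S0_le[Ds Drho rs As].
move=> dY OmY PY dX OmX PX Y X iY iX.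
have s0 : 0 < s by exact: lt_le_trans s1.
have an0 : a != 0 by rewrite gt_eqF.
have sn0 : s != 0 by rewrite gt_eqF.
have u0 : 0 <= s^-1 by rewrite invr_ge0 ltW.
have Le := level_le s1 a0 a1 rE As.
pose h := C * (A * s) ^+ 2 / Num.sqrt r + a / s.
have as0 : 0 < a / s by rewrite divr_gt0.
have as1 : a / s <= 1 by rewrite ler_pdivrMr// mul1r (le_trans a1).
have hch : h <= ch * (a / s).
  by rewrite /ch mulrDl mul1r lerD2r; exact: remainder_le.
have h0 : 0 <= h.
  by rewrite addr_ge0 ?(ltW as0)// divr_ge0 ?sqrtr_ge0// mulr_ge0 ?sqr_ge0.
have hch1 : h <= ch by apply: le_trans hch _; rewrite ler_piMr.
have Hs : 1 <= H * s.
  by rewrite -[1]mul1r ler_pM.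
have Hpen B : B \in AA -> q + h + pen n d v #|B|%:R <= H * s.
  move=> /penAA/andP[_ hB].
  have l1 : `|q| <= `|q| * s by rewrite ler_peMr.
  have l2 : ch <= ch * s by rewrite ler_peMr.
  have l3 := ler_norm q.
  rewrite (_ : H * s = `|q| * s + ch * s + b * s + s); last by rewrite /H; ring.
  lra.
have := kolmogorov_bound s1 a0 a1 r0 rE c20 cardAA rAA rho0 M0
  C0 AA0 (@lr_expansion n) e0 iY iX D0 Ds Drho std gstd rs Le Hs Hpen.
move=> /le_trans; apply; rewrite lee_fin -/h.
have hA : c2 + 2 + rho * M <= A by rewrite /A -[leRHS]addrA lerDl addr_ge0.
have h1 := tail_le s1 c10 hA.
have h2 := eta_le d s1 a0 a1 c10 M0 c20; rewrite -/D -/E0 in h2.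
have h4 : 2 * c1 / s <= 2 * c1 * (a + s^-1) by rewrite ler_wpM2l ?mulr_ge0// lerDr ltW.
have h5 : h * (H * s) <= ch * H * (a + s^-1).
  apply: (@le_trans _ _ (ch * (a / s) * (H * s))); first by rewrite ler_wpM2r ?mulr_ge0 ?(ltW s0).
  rewrite (_ : ch * (a / s) * (H * s) = ch * H * a); last by field.
  by rewrite ler_wpM2l ?mulr_ge0// lerDl.
rewrite 2![in leRHS]mulrDl; apply: lerD; first by apply: lerD => //; exact: le_trans h1 h4.
rewrite -[leRHS]mulrA ler_wpM2l ?mulr_ge0 ?expR_ge0//.
by rewrite -!(mulrA 2) ler_wpM2l.
Qed.

End uniform.
End uniform_bounds.

(** * Passage to large sample sizes *)

Section asymptotics.
Context {R : realType}.
Variables (d : nat) (c1 c2 v : R) (RR : set (set 'rV[R]_d)) (r : nat -> R).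
Hypotheses (v0 : 0 <= v) (r0 : forall n, 0 < r n).
Hypotheses (card_regions : forall n, (0 < n)%N -> #|regions RR n|%:R <= c1 * n%:R `^ c2)
  (hlog : (fun n => ln n%:R ^+ 12 : R^o) =o_\oo (r : nat -> R^o))
  (nonempty : forall n, (0 < n)%N -> regions_ge RR n (r n) != finset.set0).

Let l n : R := ln n%:R.
Let s n : R := Num.sqrt (l n).
Let a n : R := (l n ^+ 12 / r n) `^ (10%:R^-1).

Lemma log_large (B : R) : \forall n \near \oo, B <= l n.
Proof.
near=> n; have n1 : expR B <= n%:R by near: n; exact: nbhs_infty_ger.
by rewrite -[leLHS]expRK /l ler_ln// posrE (lt_le_trans (expR_gt0 B)).
Unshelve. all: by end_near. Qed.

Lemma rate_pow n : 0 < l n -> a n ^+ 10 = l n ^+ 12 / r n.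
Proof.
move=> l0; have h : 0 <= l n ^+ 12 / r n by rewrite divr_ge0 ?exprn_ge0 ?ltW.
by rewrite -powR_mulrn ?powR_ge0// -powRrM mulVf ?pnatr_eq0// powRr1.
Qed.

Lemma rate_small (eps : R) : 0 < eps -> \forall n \near \oo, a n <= eps.
Proof.
move=> e0; have e10 : 0 < eps ^+ 10 by rewrite exprn_gt0.
have := hlog; rewrite eqoP => /(_ _ e10) H.
near=> n; have l1 : 1 <= l n by near: n; exact: log_large.
have l0 : 0 < l n by exact: lt_le_trans l1.
have : `|l n ^+ 12| <= eps ^+ 10 * `|r n| by near: n.
rewrite !ger0_norm ?exprn_ge0 ?(ltW l0) ?(ltW (r0 _))// => h.
rewrite -(ler_pXn2r (n := 10))// ?nnegrE ?powR_ge0 ?(ltW e0)//.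
by rewrite rate_pow// ler_pdivrMr.
Unshelve. all: by end_near. Qed.

Lemma eventually_regime (S eps : R) : 0 < eps ->
  \forall n \near \oo, [/\
    regime v c1 c2 (Num.sqrt (2 * v * (d%:R + 1))) (regions_ge RR n (r n)) (r n) (s n) (a n),
    S <= s n & a n + (s n)^-1 <= eps].
Proof.
move=> e0; near=> n.
have n0 : (0 < n)%N by near: n; exact: nbhs_infty_gt.
have l1 : 1 <= l n by near: n; exact: log_large.
have l0 : 0 < l n by exact: lt_le_trans l1.
have ls : (s n) ^+ 2 = l n by rewrite /s sqr_sqrtr// ltW.
have l0w := ltW l0.
have s1 : 1 <= s n by rewrite -[leLHS]sqrtr1 ler_sqrt.
have s0 : 0 < s n by exact: lt_le_trans s1.
have sB (B : R) : B ^+ 2 <= l n -> B <= s n.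
  by move=> h; rewrite (le_trans (ler_norm _))// -sqrtr_sqr ler_sqrt.
have hS : S <= s n by apply: sB; near: n; exact: log_large.
have he : 2 / eps <= s n by apply: sB; near: n; exact: log_large.
have a1 : a n <= 1 by near: n; exact: rate_small.
have ae : a n <= eps / 2 by near: n; apply: rate_small; rewrite divr_gt0.
have a0 : 0 < a n by rewrite /a powR_gt0// divr_gt0 ?exprn_gt0.
have nE : n%:R = expR (l n) :> R by rewrite /l lnK// posrE ltr0n.
have rA A : A \in regions_ge RR n (r n) -> r n <= #|A|%:R.
  by rewrite inE => /andP[].
have cardA (A : {set grid n d}) : #|A|%:R <= expR (d%:R * l n).
  rewrite expRM_natl -nE -natrX ler_nat (leq_trans (max_card _))//.
  by rewrite card_ffun !card_ord.
split => //; last first.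
  have : (s n)^-1 <= eps / 2.
    by rewrite -[leRHS]invrK invf_div lef_pV2 ?posrE// divr_gt0.
  lra.
split; split.
- by [].
- by rewrite a0.
- by [].
- have : Num.sqrt (r n) = Num.sqrt ((s n ^+ 12 / a n ^+ 5) ^+ 2).
    congr Num.sqrt; rewrite expr_div_n -!exprM (_ : (12 * 2 = 2 * 12)%N)// exprM ls.
    by rewrite rate_pow// invf_div mulrCA divff ?mulr1// gt_eqF// exprn_gt0.
  by rewrite sqrtr_sqr ger0_norm// divr_ge0 ?exprn_ge0 ?ltW.
(* A region of cardinality at least [r n] forces [r n <= n ^ d], so [a n] cannot be too small: its
   inverse is at most the tenth power of that inverse, which is [r n / log ^ 12 n]. *)
- rewrite ls; have /set0Pn[A /rA rnA] := nonempty n0.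
  have ra : r n <= expR (d%:R * l n) by exact: le_trans rnA (cardA A).
  apply: (@le_trans _ _ ((a n ^+ 10)^-1)).
    rewrite lef_pV2 ?posrE ?exprn_gt0// exprS ler_piMr ?(ltW a0)//.
    by rewrite exprn_ile1 ?(ltW a0).
  rewrite rate_pow// invf_div ler_pdivrMr ?exprn_gt0//.
  by rewrite (le_trans ra)// ler_peMr ?expR_ge0// exprn_ege1.
- exact: nonempty.
- rewrite ls; apply: (@le_trans _ _ #|regions RR n|%:R).
    by rewrite ler_nat; apply: subset_leq_card; apply/fintype.subsetP => A; rewrite inE => /andP[].
  by rewrite (le_trans (card_regions n0))// /powR pnatr_eq0 eqn0Ngt n0.
- by [].
- move=> A AA; rewrite sqrtr_ge0/=.
  have A0 : 0 < #|A|%:R :> R by rewrite (lt_le_trans (r0 n))// rA.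
  (* Together with [1 <= l n] this bounds the penalty by [sqrt (2 * v * (d + 1))] times [s n]. *)
  have kl : 0 <= ln (n%:R ^+ d / #|A|%:R : R) <= d%:R * l n.
    have -> : ln (n%:R ^+ d / #|A|%:R : R) = d%:R * l n - ln (#|A|%:R : R).
      by rewrite nE -expRM_natl ln_div ?posrE ?expR_gt0// expRK.
    have h1 : ln (#|A|%:R : R) <= d%:R * l n.
      by rewrite -[leRHS]expRK ler_ln ?posrE ?expR_gt0.
    have h2 : 0 <= ln (#|A|%:R : R) by rewrite ln_ge0// ler1n -(ltr0n R).
    by rewrite subr_ge0 h1 gerBl.
  rewrite /pen -[s n]ger0_norm ?(ltW s0)// -sqrtr_sqr -sqrtrM; last first.
    by rewrite !mulr_ge0 ?addr_ge0.
  rewrite ls ler_sqrt; last by rewrite !mulr_ge0 ?addr_ge0// ltW.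
  rewrite -[leRHS]mulrA ler_wpM2l ?mulr_ge0// mulrDl mul1r.
  by move: kl => /andP[_ ?]; rewrite lerD.
Unshelve. all: by end_near. Qed.
End asymptotics.

(** The product coupling with a single cell. It supplies the fields for the finitely many [n] at
    which the regime is not yet reached. *)
Lemma independent_coupling (R : realType) (I : finType)
    (mu1 mu2 : probability (measurableTypeR R) R) :
  exists P : probability (#|I|.-tuple (measurableTypeR R) *
      #|I|.-tuple (measurableTypeR R))%type R,
    iid_field (@coordinate R _ _ P I _ measurable_fst) mu1 /\
    iid_field (@coordinate R _ _ P I _ measurable_snd) mu2.
Proof.
have c0 (T : Type) i : (fun _ : T => 0%N) @^-1` [set i] = if i == 0%N then setT else set0.
  by apply/seteqP; split=> x; case: eqVneq => [->|/eqP h] //= e; apply: h.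
have [||||P [P1 P2 _]] := @product_coupling R _ _ _ _
  (prod_law #|I| (fun=> mu1)) (prod_law #|I| (fun=> mu2)) 1 (fun=> 0%N) (fun=> 0%N).
- by [].
- by [].
- by move=> i; rewrite c0; case: ifP => _; [exact: measurableT|exact: measurable0].
- by move=> i; rewrite c0; case: ifP => _; [exact: measurableT|exact: measurable0].
exists P; split; apply: iid_coordinate => A mA.
- by rewrite -[RHS](P1 A mA); congr (P _); apply/seteqP; split=> z /=; [split|case].
- by rewrite -[RHS](P2 A mA); congr (P _); apply/seteqP; split=> z /=; [split|case].
Qed.

Theorem theorem2p5 (R : realType) (d : nat) (hd : (0 < d)%N)
  (nu : {sigma_finite_measure set (measurableTypeR R) -> \bar R})
  (F : R -> probability (measurableTypeR R) R)
  (hopen : open (natural_space nu))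
  (hF : forall theta, natural_space nu theta ->
    forall A : set (measurableTypeR R), measurable A ->
    F theta A = (\int[nu]_(x in A) (expfam_pdf nu theta x)%:E)%E)
  (hconv : strictly_convex_on (natural_space nu) (cumulant nu))
  (hvar : forall theta, natural_space nu theta ->
    (0 < 'V_(F theta)[(fun x : measurableTypeR R => x : R)])%E)
  (theta0 : R) (htheta0 : natural_space nu theta0)
  (RR : set (set 'rV[R]_d)) (hRR : forall S, RR S -> S `<=` @unit_cube R d)
  (c1 c2 : R) (hc1 : 0 < c1) (hc2 : 0 < c2)
  (hcard : forall n, (0 < n)%N -> #|regions RR n|%:R <= c1 * n%:R `^ c2)
  (r : nat -> R) (hr : forall n, 0 < r n)
  (hlog : (fun n => ln n%:R ^+ 12 : R^o) =o_\oo (r : nat -> R^o))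
  (hne : forall n, (0 < n)%N -> regions_ge RR n (r n) != finset.set0)
  (v : R) (hv : 0 <= v) :
  (exists (disp : nat -> measure_display)
          (Om : forall n, measurableType (disp n))
          (P : forall n, probability (Om n) R)
          (Y X : forall n, grid n d -> {RV (P n) >-> R}),
     [/\ forall n, iid_field (Y n) (F theta0),
         forall n, iid_field (X n) (normal_prob 0 1)
       & bigO_prob P
           (fun n w =>
              (multiscale nu (fun i => Y n i w) theta0 (regions_ge RR n (r n)) v
               - gauss_multiscale (fun i => X n i w) (regions_ge RR n (r n)) v)%E)
           (fun n => (ln n%:R ^+ 12 / r n) `^ (10%:R^-1))])
  /\
  (forall (q : R)
     (dispY dispX : nat -> measure_display)
     (OmY : forall n, measurableType (dispY n))
     (OmX : forall n, measurableType (dispX n))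
     (PY : forall n, probability (OmY n) R)
     (PX : forall n, probability (OmX n) R)
     (Y : forall n, grid n d -> {RV (PY n) >-> R})
     (X : forall n, grid n d -> {RV (PX n) >-> R}),
     (forall n, iid_field (Y n) (F theta0)) ->
     (forall n, iid_field (X n) (normal_prob 0 1)) ->
     (fun n =>
        `| PY n [set w | (q%:E < multiscale nu (fun i => Y n i w) theta0
                                   (regions_ge RR n (r n)) v)%E]
           - PX n [set w | (q%:E < gauss_multiscale (fun i => X n i w)
                                     (regions_ge RR n (r n)) v)%E] |%E)
       @ \oo --> (0%E : \bar R)).
Proof.
have [rho1 [M1 [rho10 M10 std1]]] := std_law_standardized hopen hF hvar htheta0.
(* The comparison asks for common moment constants of the two laws. *)
pose rho := Num.min rho1 1; pose M := Num.max M1 (cubexp_moment (normal_prob 0 1) 1).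
have rho0 : 0 < rho by rewrite lt_min rho10 ltr01.
have M0 : 0 <= M by rewrite le_max M10.
have std : standardized (std_law F theta0) rho M.
  by apply: standardized_weaken std1; rewrite ?ge_min ?le_max lexx.
have gstd : standardized (normal_prob 0 1 : probability (measurableTypeR R) R) rho M.
  by apply: standardized_weaken (@gauss_standardized R); rewrite ?ge_min ?le_max lexx orbT.
have [C [e [C0 e0 lr]]] := local_lr_expansion hopen hF hconv hvar htheta0.
pose b := Num.sqrt (2 * v * (d%:R + 1)).
have b0 : 0 <= b by exact: sqrtr_ge0.
have c10 := ltW hc1; have c20 := ltW hc2.
pose a n : R := (ln n%:R ^+ 12 / r n) `^ (10%:R^-1).
pose s n : R := Num.sqrt (ln n%:R).
have reg := eventually_regime hv hr hcard hlog hne.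
split.
  have [S [C1 [C2 [C10 C20 H]]]] := uniform_coupling v c10 c20 rho0 M0 C0 e0 b0 std gstd (fun n => @lr n d).
  pose good n := regime v c1 c2 b (regions_ge RR n (r n)) (r n) (s n) (a n) /\ S <= s n.
  have HP n : exists P : probability (#|{: grid n d}|.-tuple (measurableTypeR R) *
      #|{: grid n d}|.-tuple (measurableTypeR R))%type R,
    [/\ iid_field (coordinate P measurable_fst) (F theta0),
        iid_field (coordinate P measurable_snd) (normal_prob 0 1) &
        good n -> (P [set z | (C1 * a n)%:E <
         `|multiscale nu (fun i => coordinate P measurable_fst i z) theta0 (regions_ge RR n (r n)) v -
           gauss_multiscale (fun i => coordinate P measurable_snd i z) (regions_ge RR n (r n)) v|] <=
       (C2 * (a n + (s n)^-1))%:E)%E].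
    (* The fields must exist for every [n], the bound only for large [n]. *)
    have [[gr gS]|ng] := pselect (good n).
      by have [P [P1 P2 P3]] := H _ _ _ _ _ gr gS; exists P.
    have [P [P1 P2]] := independent_coupling {: grid n d} (F theta0) (normal_prob 0 1).
    by exists P.
  pose P n := projT1 (cid (HP n)).
  have PP n := projT2 (cid (HP n)); rewrite -/(P _) in PP.
  exists _, _, P, (fun n => coordinate (P n) measurable_fst),
    (fun n => coordinate (P n) measurable_snd).
  split; [by move=> n; have [] := PP n|by move=> n; have [] := PP n|].
  move=> eps eps0; exists C1 => //.
  have C21 : 0 < C2 + 1 by rewrite ltr_wpDl.
  have eC : 0 < eps / (C2 + 1) by rewrite divr_gt0.
  near=> n.
  have [gr gS gE] : [/\ regime v c1 c2 b (regions_ge RR n (r n)) (r n) (s n) (a n),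
      S <= s n & a n + (s n)^-1 <= eps / (C2 + 1)] by near: n; exact: reg.
  have [_ _ Pn] := PP n; apply: (le_trans (Pn (conj gr gS))); rewrite lee_fin.
  apply: (@le_trans _ _ ((C2 + 1) * (a n + (s n)^-1))).
    by rewrite ler_wpM2r ?lerDl// addr_ge0 ?powR_ge0// invr_ge0 sqrtr_ge0.
  by rewrite mulrC -ler_pdivlMr.
move=> q dispY dispX OmY OmX PY PX Y X iY iX.
have [S [C2 [C20 H]]] := uniform_kolmogorov v c10 c20 rho0 M0 C0 e0 b0 std gstd (fun n => @lr n d) q.
have C21 : 0 < C2 + 1 by rewrite ltr_wpDl.
set u := (fun n => _).
have small eps : 0 < eps -> \forall n \near \oo, (u n <= eps%:E)%E.
  move=> eps0; have eC : 0 < eps / (C2 + 1) by rewrite divr_gt0.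
  near=> n.
  have [gr gS gE] : [/\ regime v c1 c2 b (regions_ge RR n (r n)) (r n) (s n) (a n),
      S <= s n & a n + (s n)^-1 <= eps / (C2 + 1)] by near: n; exact: reg.
  apply: (le_trans (H _ _ _ _ _ gr gS _ _ _ _ _ _ _ _ (iY n) (iX n))); rewrite lee_fin.
  apply: le_trans (_ : (C2 + 1) * (eps / (C2 + 1)) <= _); last by rewrite mulrC divfK// gt_eqF.
  apply: ler_pM => //; last by rewrite lerDl.
  by rewrite addr_ge0 ?powR_ge0// invr_ge0 sqrtr_ge0.
have u0 n : (0 <= u n)%E by exact: abse_ge0.
apply/fine_cvgP; split.
  near=> n; rewrite ge0_fin_numE//.
  by apply: le_lt_trans (ltry 1); near: n; exact: small.
apply/cvgrPdist_le => eps eps0; near=> n.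
rewrite sub0r normrN ger0_norm ?fine_ge0// -lee_fin fineK; last first.
  rewrite ge0_fin_numE//; apply: le_lt_trans (ltry 1).
  by near: n; exact: small.
by near: n; exact: small.
Unshelve. all: by end_near. Qed.
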